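(* Let $G^{(4)}_{336}\simeq\mathrm{SL}_2(7)$ be a subgroup of the umbral group $G^{(4)}$ attached to the Niemeier root system $A_3^{\oplus 8}$, let $W^{(4)}_{\mathrm{tw}}=A(\mathfrak e)_{\mathrm{tw}}\otimes A(\mathfrak a)_{\mathrm{tw}}\otimes \underline{A}(\mathfrak b)_{\mathrm{tw}}$ (with $\dim\mathfrak e=2$, $\dim\mathfrak a=6$, $\dim\mathfrak b=8$) be the canonically twisted module, equipped with the action of $G^{(4)}_{336}$ and the operators $J_{\mathfrak e}(0)$, $(-1)^F$, $J(0)$, $L(0)$, specified in the context. For $g\in G^{(4)}_{336}$ define the formal series $$\widetilde\psi^{(4)}_g:=-\mathrm{tr}\left((g+g^{-1})\,J_{\mathfrak e}(0)\,(-1)^F\,y^{J(0)}q^{L(0)}\,\middle|\,W^{(4)}_{\mathrm{tw}}\right).$$ Then for every $g\in G^{(4)}_{336}$ the series $\widetilde\psi^{(4)}_g$ is the expansion of the meromorphic Jacobi form $\psi^{(4)}_g$ in the domain $0<-\mathrm{Im}(z)<\mathrm{Im}(\tau)$; that is, after the substitution $q=e^{2\pi i\tau}$, $y=e^{2\pi i z}$ the series converges to $\psi^{(4)}_g(\tau,z)$ for all $\tau\in\mathbb H$, $z\in\mathbb C$ with $0<-\mathrm{Im}(z)<\mathrm{Im}(\tau)$.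
   Context: **Clifford modules.** Let $\mathfrak a$ be a complex vector space of finite even dimension $d$ with a non-degenerate symmetric bilinear form $\langle\cdot,\cdot\rangle$ and a polarization $\mathfrak a=\mathfrak a^+\oplus\mathfrak a^-$ (both summands isotropic). For a space $\mathfrak u$ with symmetric form, $\mathrm{Cliff}(\mathfrak u)=T(\mathfrak u)/(u\otimes u'+u'\otimes u-\langle u,u'\rangle\mathbf 1)$. For $r\in\frac12\mathbb Z$ let $\mathfrak a(r)=\{a(r)\mid a\in\mathfrak a\}$ be a copy of $\mathfrak a$; put $\hat{\mathfrak a}=\bigoplus_{n\in\mathbb Z}\mathfrak a(n+\frac12)$, $\hat{\mathfrak a}_{\mathrm{tw}}=\bigoplus_{n\in\mathbb Z}\mathfrak a(n)$, with $\langle a(r),a'(r')\rangle=\langle a,a'\rangle\delta_{r+r',0}$. Put $\hat{\mathfrak a}^+=\bigoplus_{n\ge0}\mathfrak a(n+\frac12)$ and $\hat{\mathfrak a}_{\mathrm{tw}}^+=\mathfrak a^+(0)\oplus\bigoplus_{n>0}\mathfrak a(n)$. Then $A(\mathfrak a)=\mathrm{Cliff}(\hat{\mathfrak a})\otimes_{\langle\hat{\mathfrak a}^+\rangle}\mathbb C\mathbf v$ and $A(\mathfrak a)_{\mathrm{tw}}=\mathrm{Cliff}(\hat{\mathfrak a}_{\mathrm{tw}})\otimes_{\langle\hat{\mathfrak a}_{\mathrm{tw}}^+\rangle}\mathbb C\mathbf v_{\mathrm{tw}}$, where $\langle\cdot\rangle$ denotes the unital subalgebra generated, and $\hat{\mathfrak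 a}^+\mathbf v=0$, $\hat{\mathfrak a}_{\mathrm{tw}}^+\mathbf v_{\mathrm{tw}}=0$. $A(\mathfrak a)$ has the unique super vertex algebra structure with vacuum $\mathbf v$ and $Y(a(-\frac12)\mathbf v,z)=\sum_{n\in\mathbb Z}a(n+\frac12)z^{-n-1}$, and $A(\mathfrak a)_{\mathrm{tw}}$ has the unique canonically twisted $A(\mathfrak a)$-module structure with $Y_{\mathrm{tw}}(a(-\frac12)\mathbf v,z)=\sum_{n\in\mathbb Z}a(n)z^{-n-\frac12}$. With bases $\{a_i^\pm\}$ of $\mathfrak a^\pm$ such that $\langle a_i^\mp,a_j^\pm\rangle=\delta_{ij}$, put $\omega=\frac12\sum_i(a_i^+(-\frac32)a_i^-(-\frac12)-a_i^+(-\frac12)a_i^-(-\frac32))\mathbf v$ (Virasoro element, $c=\frac d2$) and $\jmath=\sum_i a_i^+(-\frac12)a_i^-(-\frac12)\mathbf v$. Writing $J(0)$ for the coefficient of $z^{-1}$ in $Y_{\mathrm{tw}}(\jmath,z)$ and $L(0)$ for that of $z^{-2}$ in $Y_{\mathrm{tw}}(\omega,z)$, $$\mathrm{tr}(y^{J(0)}q^{L(0)-c/24}|A(\mathfrak a)_{\mathrm{tw}})=y^{d/4}q^{d/24}\prod_{n>0}(1+y^{-1}q^{n-1})^{d/2}(1+yq^n)^{d/2}.$$ **Weyl modules.** Let $\mathfrak b$ be a complex vector space of finite even dimension $d$ with a non-degenerate anti-symmetric form $\langle\!\langle\cdot,\cdot\rangle\!\rangle$ and polarization $\mathfrak b=\mathfrak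 b^+\oplus\mathfrak b^-$. Replace the Clifford algebra by the Weyl algebra $T(\mathfrak u)/(u\otimes u'-u'\otimes u-\langle\!\langle u,u'\rangle\!\rangle\mathbf 1)$ and repeat the construction verbatim (same index sets, $\hat{\mathfrak b}^+=\bigoplus_{n\ge0}\mathfrak b(n+\frac12)$, $\hat{\mathfrak b}_{\mathrm{tw}}^+=\mathfrak b^+(0)\oplus\bigoplus_{n>0}\mathfrak b(n)$, same formulas for $Y$ and $Y_{\mathrm{tw}}$ on generators) to get a super vertex algebra $\underline A(\mathfrak b)$ and canonically twisted module $\underline A(\mathfrak b)_{\mathrm{tw}}$. With bases such that $\langle\!\langle b_i^\mp,b_j^\pm\rangle\!\rangle=\pm\delta_{ij}$, put $\omega=\frac12\sum_i(b_i^+(-\frac32)b_i^-(-\frac12)-b_i^+(-\frac12)b_i^-(-\frac32))\mathbf v$ ($c=-\frac d2$) and $\jmath=\sum_ib_i^+(-\frac12)b_i^-(-\frac12)\mathbf v$; then $$\mathrm{tr}(y^{J(0)}q^{L(0)-c/24}|\underline A(\mathfrak b)_{\mathrm{tw}})=y^{-d/4}q^{-d/24}\prod_{n>0}(1-y^{-1}q^{n-1})^{-d/2}(1-yq^n)^{-d/2},$$ with $(1-X)^{-1}=\sum_{k\ge0}X^k$. **Group actions.** $g\in\mathrm{GL}(\mathfrak a^+)$ acts on $\mathfrak a=\mathfrak a^+\oplus\mathfrak a^-$ as $(g,g')$, where $g'\in\mathrm{GL}(\mathfrak a^-)$ is determined by $\langle ga,g'a'\rangle=\langle a,a'\rangle$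 for $a\in\mathfrak a^+,a'\in\mathfrak a^-$, and on $A(\mathfrak a)$ and $A(\mathfrak a)_{\mathrm{tw}}$ by $g\cdot a_1(r_1)\cdots a_n(r_n)\mathbf v=(ga_1)(r_1)\cdots(ga_n)(r_n)\mathbf v$ (resp. with $\mathbf v_{\mathrm{tw}}$). Similarly $\mathrm{GL}(\mathfrak b^+)$ acts on $\underline A(\mathfrak b)$, $\underline A(\mathfrak b)_{\mathrm{tw}}$. **The case $\ell=4$.** Let $\mathfrak e$ and $\mathfrak a$ be of dimensions $2$ and $6$ with non-degenerate symmetric forms and $\mathfrak b$ of dimension $8$ with a non-degenerate anti-symmetric form, all with fixed polarizations. Set $W^{(4)}=A(\mathfrak e)\otimes A(\mathfrak a)\otimes\underline A(\mathfrak b)$, $W^{(4)}_{\mathrm{tw}}=A(\mathfrak e)_{\mathrm{tw}}\otimes A(\mathfrak a)_{\mathrm{tw}}\otimes\underline A(\mathfrak b)_{\mathrm{tw}}$; let $\omega^{(4)}$ be the tensor product Virasoro element (sum of the $\omega$'s of the three factors), $\jmath_{\mathfrak e}=\jmath\otimes\mathbf v\otimes\mathbf v$, $\jmath^{(4)}=2\,\mathbf v\otimes\jmath\otimes\mathbf v+\mathbf v\otimes\mathbf v\otimes\jmath$. On $W^{(4)}_{\mathrm{tw}}$: $J_{\mathfrak e}(0)$ and $J(0)$ are the coefficients of $z^{-1}$ in $Y_{\mathrm{tw}}(\jmath_{\mathfrak e},z)$ and $Y_{\mathrm{tw}}(\jmath^{(4)},z)$, $L(0)$ is the coefficient of $z^{-2}$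 in $Y_{\mathrm{tw}}(\omega^{(4)},z)$, and $(-1)^F=(-I)\otimes(-I)\otimes I\in \mathrm{GL}(\mathfrak e^+)\otimes\mathrm{GL}(\mathfrak a^+)\otimes\mathrm{GL}(\mathfrak b^+)$. **Group.** $G^{(4)}=\mathrm{Aut}(N)/\mathrm{Inn}(N)\simeq 2.\mathrm{AGL}_3(2)$, where $N$ is the Niemeier lattice with root system $A_3^{\oplus8}$ and $\mathrm{Inn}(N)$ is generated by reflections in roots. $G^{(4)}_{336}$ is a subgroup of $G^{(4)}$ isomorphic to $\mathrm{SL}_2(7)$ (such subgroups are maximal and unique up to conjugacy). Its conjugacy classes are 1A, 2A, 4A, 3A, 6A, 8A, 8B, 7A, 7B, 14A, 14B (the number is the element order); each lies in the class of $G^{(4)}$ of the same name, except that 8A and 8B both lie in the class 8A of $G^{(4)}$. With $b_7=(-1+\sqrt{-7})/2$, the irreducible characters $\chi_2,\chi_8$ of $G^{(4)}_{336}$ take on these classes, in this order, the values $\chi_2: 3,3,-1,0,0,1,1,b_7,\overline{b_7},b_7,\overline{b_7}$ and $\chi_8: 4,-4,0,1,-1,0,0,-\overline{b_7},-b_7,\overline{b_7},b_7$. Choose homomorphisms $\varrho:G^{(4)}_{336}\to\mathrm{GL}(\mathfrak a^+)$ and $\underline\varrho:G^{(4)}_{336}\to\mathrm{GL}(\mathfrak b^+)$ with characters $\chi_2$ and $\chi_8$; $g\in G^{(4)}_{336}$ acts on $W^{(4)}$ and $W^{(4)}_{\mathrm{tw}}$ as $I\otimes\varrho(g)\otimes\underline\varrho(g)$.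 **The functions $\psi^{(4)}_g$.** With $q=e^{2\pi i\tau}$, $y=e^{2\pi iz}$: $\eta(\tau)=q^{1/24}\prod_{n>0}(1-q^n)$, $\theta_1(\tau,z)=-iq^{1/8}y^{1/2}\prod_{n>0}(1-y^{-1}q^{n-1})(1-yq^n)(1-q^n)$, $\theta_2(\tau,z)=q^{1/8}y^{1/2}\prod_{n>0}(1+y^{-1}q^{n-1})(1+yq^n)(1-q^n)$ (where $y^{1/2}=e^{\pi i z}$). For $g\in G^{(4)}_{336}$ the meromorphic Jacobi form $\psi^{(4)}_g$ of umbral moonshine is given, according to the class of $g$, by: - 1A: $2i\,\eta(\tau)^3\theta_1(\tau,2z)^3/\theta_1(\tau,z)^4$ - 2A: $2i\,\eta(\tau)^3\theta_1(\tau,2z)^3/\theta_2(\tau,z)^4$ - 4A: $-2i\,\frac{\eta(2\tau)^2\theta_1(\tau,2z)\theta_2(\tau,2z)^2}{\eta(\tau)\theta_2(2\tau,2z)^2}$ - 3A: $2i\,\frac{\eta(\tau)^3\theta_1(3\tau,6z)}{\theta_1(\tau,z)\theta_1(3\tau,3z)}$ - 6A: $-2i\,\frac{\eta(\tau)^3\theta_1(3\tau,6z)}{\theta_2(\tau,z)\theta_2(3\tau,3z)}$ - 8A, 8B: $-2i\,\frac{\eta(\tau)\eta(4\tau)\theta_1(\tau,2z)\theta_2(2\tau,4z)}{\eta(2\tau)\theta_2(4\tau,4z)}$ - 7A, 7B: $-i\frac{\eta(7\tau)}{\eta(\tau)^4\theta_1(7\tau,7z)}\left(\prod_{k\in\{1,2,4\}}\theta_1(\tau,2z+\frac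 k7)\theta_1(\tau,z-\frac k7)+\prod_{k\in\{1,2,4\}}\theta_1(\tau,2z-\frac k7)\theta_1(\tau,z+\frac k7)\right)$ - 14A, 14B: $i\frac{\eta(7\tau)}{\eta(\tau)^4\theta_2(7\tau,7z)}\left(\prod_{k\in\{1,2,4\}}\theta_1(\tau,2z+\frac k7)\theta_2(\tau,z-\frac k7)+\prod_{k\in\{1,2,4\}}\theta_1(\tau,2z-\frac k7)\theta_2(\tau,z+\frac k7)\right)$ *)

(* Defs.v *)
From HB Require Import structures.
From mathcomp Require Import all_boot all_order all_algebra all_fingroup.
From mathcomp Require Import generic_quotient finmap monalg.
From mathcomp Require Import all_classical all_reals all_analysis.
From mathcomp Require Export summability complex.

Set Implicit Arguments.
Unset Strict Implicit.
Unset Printing Implicit Defensive.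

Import Order.TTheory GRing.Theory Num.Theory.
Import numFieldNormedType.Exports.

Local Open Scope quotient_scope.
Local Open Scope classical_set_scope.
Local Open Scope ring_scope.

Section Span.
Variables (K : fieldType) (V : lmodType K).

Definition subspace (U : set V) : Prop :=
  U 0 /\ forall (k : K) (x y : V), U x -> U y -> U (k *: x + y).

Definition lspan (S : set V) : set V := smallest subspace S.

Lemma lspan_subspace (S : set V) : subspace (lspan S).
Proof.
split=> [U [[U0 _] _]|k x y Sx Sy U [Uc SU]] //.
by apply: Uc.2; [apply: Sx | apply: Sy].
Qed.

End Span.

Section Quotient.
Variables (K : fieldType) (V : lmodType K) (S : set V).

Definition span_eq : rel V := fun x y => `[< lspan S (x - y) >].

Fact span_eq_refl : reflexive span_eq.
Proof. by move=> x; apply/asboolP; rewrite subrr; apply: (lspan_subspace S).1. Qed.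

Fact span_eq_sym : symmetric span_eq.
Proof.
have h x y : span_eq x y -> span_eq y x.
  move=> /asboolP xy; apply/asboolP.
  have [S0 SL] := lspan_subspace S.
  by have := SL (-1) _ _ xy S0; rewrite addr0 scaleN1r opprB.
by move=> x y; apply/idP/idP; apply: h.
Qed.

Fact span_eq_trans : transitive span_eq.
Proof.
move=> y x z /asboolP xy /asboolP yz; apply/asboolP.
by have := (lspan_subspace S).2 1 _ _ xy yz; rewrite scale1r addrA subrK.
Qed.

Canonical span_equiv := EquivRel span_eq span_eq_refl span_eq_sym span_eq_trans.

Definition quot := {eq_quot span_equiv}.

HB.instance Definition _ := Choice.on quot.
HB.instance Definition _ := EqQuotient.on quot.

Definition qclass (x : V) : quot := \pi_quot%qT x.

Lemma qclass_eq x y : qclass x = qclass y <-> lspan S (x - y).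
Proof.
by split=> [/eqmodP /asboolP //|h]; apply/eqmodP; apply/asboolP.
Qed.

Lemma qclass_repr (x : quot) : qclass (repr x) = x.
Proof. exact: reprK. Qed.

Lemma repr_qclass x : lspan S (repr (qclass x) - x).
Proof. by apply/qclass_eq; rewrite qclass_repr. Qed.

Definition qadd (x y : quot) : quot := qclass (repr x + repr y).
Definition qopp (x : quot) : quot := qclass (- repr x).
Definition qscale (k : K) (x : quot) : quot := qclass (k *: repr x).

Let spanD x y : lspan S x -> lspan S y -> lspan S (x + y).
Proof. by move=> Sx Sy; rewrite -[x]scale1r; apply: (lspan_subspace S).2. Qed.
Let spanZ k x : lspan S x -> lspan S (k *: x).
Proof.
by move=> Sx; rewrite -[k *: x]addr0; have [S0 SL] := lspan_subspace S; apply: SL.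
Qed.

Lemma qaddE x y : qadd (qclass x) (qclass y) = qclass (x + y).
Proof.
by apply/qclass_eq; rewrite opprD addrACA; apply: (spanD (repr_qclass x) (repr_qclass y)).
Qed.

Lemma qscaleE k x : qscale k (qclass x) = qclass (k *: x).
Proof. by apply/qclass_eq; rewrite -scalerBr; apply: (spanZ k (repr_qclass x)). Qed.

Lemma qoppE x : qopp (qclass x) = qclass (- x).
Proof.
apply/qclass_eq; have := spanZ (-1) (repr_qclass x).
by rewrite scaleN1r opprD.
Qed.

Fact qaddA : associative qadd.
Proof.
move=> x y z; rewrite -[x]qclass_repr -[y]qclass_repr -[z]qclass_repr.
by rewrite !qaddE addrA.
Qed.
Fact qaddC : commutative qadd.
Proof.
by move=> x y; rewrite -[x]qclass_repr -[y]qclass_repr !qaddE addrC.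
Qed.
Fact qadd0 : left_id (qclass 0) qadd.
Proof. by move=> x; rewrite -[x]qclass_repr qaddE add0r. Qed.
Fact qaddN : left_inverse (qclass 0) qopp qadd.
Proof. by move=> x; rewrite -[x]qclass_repr qoppE qaddE addNr. Qed.

HB.instance Definition _ := GRing.isZmodule.Build quot qaddA qaddC qadd0 qaddN.

Lemma qclassD x y : qclass (x + y) = qclass x + qclass y.
Proof. by rewrite -qaddE. Qed.

Fact qscaleA (a b : K) (v : quot) : qscale a (qscale b v) = qscale (a * b) v.
Proof. by rewrite -[v]qclass_repr !qscaleE scalerA. Qed.
Fact qscale1 : left_id 1 qscale.
Proof. by move=> v; rewrite -[v]qclass_repr !qscaleE scale1r. Qed.
Fact qscaleDr : right_distributive qscale +%R.
Proof.
move=> a u v; rewrite -[u]qclass_repr -[v]qclass_repr.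
by rewrite -qclassD !qscaleE scalerDr qclassD.
Qed.
Fact qscaleDl (v : quot) : {morph qscale^~ v : a b / a + b}.
Proof. by move=> a b; rewrite -[v]qclass_repr !qscaleE scalerDl qclassD. Qed.

HB.instance Definition _ :=
  GRing.Zmodule_isLmodule.Build K quot qscaleA qscale1 qscaleDr qscaleDl.

Lemma qclassZ k x : qclass (k *: x) = k *: qclass x.
Proof. by rewrite -qscaleE. Qed.

Fact qclass_is_linear : linear qclass.
Proof. by move=> k x y; rewrite qclassD qclassZ. Qed.

HB.instance Definition _ :=
  GRing.isLinear.Build K V quot *:%R qclass qclass_is_linear.

End Quotient.

Section Presentation.
Variables (K : fieldType) (X : choiceType) (rel : set {malg K[X]}).

Definition presented : lmodType K := quot rel.

Definition pgen (x : X) : presented := qclass rel << x >>.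

Section Extension.
Variables (U : lmodType K) (f : X -> U).

Definition free_ext (m : {malg K[X]}) : U := \sum_(x <- msupp m) m@_x *: f x.

(* The linear map with [pgen x |-> f x]; meaningful when [free_ext]
   vanishes on the relations (see [pliftE]). *)
Definition plift (v : presented) : U := free_ext (repr v).

Lemma free_extEw (m : {malg K[X]}) (d : {fset X}) :
  (msupp m `<=` d)%fset -> free_ext m = \sum_(x <- d) m@_x *: f x.
Proof.
move=> le; rewrite /free_ext (big_fset_incl _ le) // => x _ /mcoeff_outdom ->.
by rewrite scale0r.
Qed.

Lemma free_ext_is_linear : linear free_ext.
Proof.
move=> k m1 m2.
pose d := (msupp (k *: m1 + m2) `|` (msupp m1 `|` msupp m2))%fset.
have l0 : (msupp (k *: m1 + m2) `<=` d)%fset by exact: fsubsetUl.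
have l1 : (msupp m1 `<=` d)%fset.
  by apply: fsubset_trans (fsubsetUl _ _) (fsubsetUr _ _).
have l2 : (msupp m2 `<=` d)%fset.
  by apply: fsubset_trans (fsubsetUr _ _) (fsubsetUr _ _).
rewrite (free_extEw l0) (free_extEw l1) (free_extEw l2).
rewrite scaler_sumr -big_split /=; apply: eq_bigr => x _.
by rewrite mcoeffD mcoeffZ scalerDl scalerA.
Qed.

HB.instance Definition _ :=
  GRing.isLinear.Build K {malg K[X]} U *:%R free_ext free_ext_is_linear.

Lemma free_extU x : free_ext << x >> = f x.
Proof.
rewrite (@free_extEw _ [fset x]%fset) ?msuppU_le // big_seq_fset1 mcoeffUU.
by rewrite scale1r.
Qed.

Hypothesis f_rel : forall m, rel m -> free_ext m = 0.

Lemma plift_class m : plift (qclass rel m) = free_ext m.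
Proof.
have sub : subspace [set m | free_ext m = 0].
  by split=> [|k x y /= hx hy]; rewrite /= ?linear0 // linearP /= hx hy scaler0 addr0.
have /= := @repr_qclass _ _ rel m _ (conj sub f_rel).
by rewrite linearB /= => /eqP; rewrite subr_eq0 => /eqP.
Qed.

Lemma pliftE x : plift (pgen x) = f x.
Proof. by rewrite /pgen plift_class free_extU. Qed.

Lemma plift_linear : linear plift.
Proof.
move=> k u v; rewrite -(qclass_repr u) -(qclass_repr v) -linearP /=.
by rewrite !plift_class linearP.
Qed.

End Extension.
End Presentation.

Section Tensor.
Variables (K : fieldType) (V W : lmodType K).

Inductive tens_rel : {malg K[(V * W)%type]} -> Prop :=
| TensRelL (k : K) (v v' : V) (w : W) :
    tens_rel (<< (k *: v + v', w) >> - (k *: << (v, w) >> + << (v', w) >>))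
| TensRelR (k : K) (v : V) (w w' : W) :
    tens_rel (<< (v, k *: w + w') >> - (k *: << (v, w) >> + << (v, w') >>)).

Definition tens : lmodType K := presented tens_rel.

Definition tpure (v : V) (w : W) : tens := pgen tens_rel (v, w).

Lemma tpure_linearl w : linear (tpure^~ w).
Proof.
move=> k v v'; rewrite /tpure /pgen -linearP /=; apply/qclass_eq.
by move=> U [_ relU]; apply: relU; exact: TensRelL.
Qed.

Lemma tpure_linearr v : linear (tpure v).
Proof.
move=> k w w'; rewrite /tpure /pgen -linearP /=; apply/qclass_eq.
by move=> U [_ relU]; apply: relU; exact: TensRelR.
Qed.

Definition tlift (U : lmodType K) (f : V -> W -> U) : tens -> U :=
  plift (fun p : (V * W)%type => f p.1 p.2).

Section Lift.
Variables (U : lmodType K) (f : V -> W -> U).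
Hypotheses (fl : forall w, linear (f^~ w)) (fr : forall v, linear (f v)).

Lemma tlift_rel m :
  tens_rel m -> free_ext (fun p : (V * W)%type => f p.1 p.2) m = 0.
Proof.
by case=> [k v v' w|k v w w']; rewrite linearB linearP /= !free_extU /= ?fl ?fr subrr.
Qed.

Lemma tlift_pure v w : tlift f (tpure v w) = f v w.
Proof. exact: (pliftE tlift_rel). Qed.

Lemma tlift_linear : linear (tlift f).
Proof. exact: plift_linear tlift_rel. Qed.

End Lift.
End Tensor.

Notation "v ⊗ w" := (tpure v w) (at level 40, left associativity) : ring_scope.

Section TensorMap.
Variables (K : fieldType) (V W V' W' : lmodType K).

Definition tmap (f : V -> V') (g : W -> W') : tens V W -> tens V' W' :=
  tlift (fun v w => f v ⊗ g w).

Lemma tmap_pure f g v w : linear f -> linear g -> tmap f g (v ⊗ w) = f v ⊗ g w.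
Proof.
move=> fL gL; apply: (@tlift_pure _ _ _ _ (fun v w => f v ⊗ g w)) => [z|z] k x y.
  by rewrite fL; exact: (tpure_linearl (g z)).
by rewrite gL; exact: tpure_linearr.
Qed.

End TensorMap.

(* [s = true]: symmetric form (Clifford case, anticommuting generators);
   [s = false]: antisymmetric form (Weyl case, commuting generators). *)
Record polspace (K : fieldType) (s : bool) := Polspace {
  pol_sort :> vectType K;
  pform : {biscalar pol_sort};
  pplus : {vspace pol_sort};
  pminus : {vspace pol_sort};
  pformC : forall x y, pform y x = - (-1) ^+ s * pform x y;
  pform_nondeg : forall x, (forall y, pform x y = 0) -> x = 0;
  pol_full : (pplus + pminus)%VS = fullv;
  pol_direct : (pplus :&: pminus)%VS = 0%VS;
  pplus_isotropic : {in pplus &, forall x y, pform x y = 0};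
  pminus_isotropic : {in pminus &, forall x y, pform x y = 0}
}.

Section Fock.
Variables (tw : bool) (K : fieldType) (s : bool) (A : polspace K s).

(* The letter [(a, n)] stands for a(n) if [tw], and for a(n + 1/2) otherwise. *)
Definition letter : choiceType := (A * int)%type.

Definition freq (n : int) : rat := n%:~R + (if tw then 0 else 1 / 2).

(* The generators of the annihilating isotropic subspace; [freq n = 0] is
   impossible when [tw = false]. *)
Definition annihilator (l : letter) : Prop :=
  0 < freq l.2 \/ freq l.2 = 0 /\ l.1 \in pplus A.

Definition lform (l l' : letter) : K :=
  if freq l.2 + freq l'.2 == 0 then pform A l.1 l'.1 else 0.

(* With U = Cliff or Weyl algebra and B = <u^+> the subalgebra generated by
   the annihilators, the module U (x)_B Cv is U / U u^+.  It is presented here as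
   T(u) modulo the two-sided ideal of the Clifford/Weyl relations and the
   left ideal T(u) u^+, where T(u) is spanned by words and the first family of
   relations makes letters linear in [a]. *)
Inductive fock_rel : {malg K[seq letter]} -> Prop :=
| FockLinear (w1 w2 : seq letter) (k : K) (a a' : A) (n : int) :
    fock_rel (<< w1 ++ (k *: a + a', n) :: w2 >>
              - (k *: << w1 ++ (a, n) :: w2 >> + << w1 ++ (a', n) :: w2 >>))
| FockCommute (w1 w2 : seq letter) (l l' : letter) :
    fock_rel (<< w1 ++ [:: l, l' & w2] >> - (-1) ^+ s *: << w1 ++ [:: l', l & w2] >>
              - lform l l' *: << w1 ++ w2 >>)
| FockAnnihilate (w : seq letter) (l : letter) :
    annihilator l -> fock_rel << rcons w l >>.

Definition fock : lmodType K := presented fock_rel.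

Definition fword (w : seq letter) : fock := pgen fock_rel w.

Definition fvac : fock := fword [::].

(* The action of the generator a(n), resp. a(n + 1/2). *)
Definition fmode (a : A) (n : int) : fock -> fock :=
  plift (fun w => fword ((a, n) :: w)).

(* g . a_1(r_1)...a_k(r_k) v = (g a_1)(r_1)...(g a_k)(r_k) v *)
Definition fact (g : A -> A) : fock -> fock :=
  plift (fun w => fword [seq (g l.1, l.2) | l <- w]).

Let fock_rel0 m : fock_rel m -> qclass fock_rel m = 0.
Proof.
move=> h; rewrite -(linear0 (qclass fock_rel)); apply/qclass_eq; rewrite subr0.
by move=> U [_ relU]; apply: relU.
Qed.

Lemma fword_linear w1 w2 k a a' n :
  fword (w1 ++ (k *: a + a', n) :: w2)
  = k *: fword (w1 ++ (a, n) :: w2) + fword (w1 ++ (a', n) :: w2).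
Proof.
apply/eqP; rewrite -subr_eq0; apply/eqP.
by have := fock_rel0 (FockLinear w1 w2 k a a' n); rewrite linearB linearP.
Qed.

Lemma fword_commute w1 w2 l l' :
  fword (w1 ++ [:: l, l' & w2])
  = (-1) ^+ s *: fword (w1 ++ [:: l', l & w2]) + lform l l' *: fword (w1 ++ w2).
Proof.
apply/eqP; rewrite -subr_eq0 opprD addrA; apply/eqP.
by have := fock_rel0 (FockCommute w1 w2 l l'); rewrite !linearB !linearZ.
Qed.

Lemma fword_annihilate w l : annihilator l -> fword (rcons w l) = 0.
Proof. by move=> hl; exact: fock_rel0 (FockAnnihilate w hl). Qed.

Lemma fmodeE a n w : fmode a n (fword w) = fword ((a, n) :: w).
Proof.
apply: pliftE => m; case=> [w1 w2 k b b' p|w1 w2 l l'|w1 l hl].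
- rewrite linearB linearP /= !free_extU -!cat_cons fword_linear.
  exact: subrr.
- rewrite !linearB !linearZ /= !free_extU -!cat_cons fword_commute.
  by rewrite !scalerN addrAC addrK subrr.
- by rewrite free_extU -rcons_cons fword_annihilate.
Qed.

Lemma factE (g : {linear A -> A}) w :
  (forall x y, pform A (g x) (g y) = pform A x y) ->
  (forall x, x \in pplus A -> g x \in pplus A) ->
  fact g (fword w) = fword [seq (g l.1, l.2) | l <- w].
Proof.
move=> gform gplus.
apply: (@pliftE _ _ _ _ (fun w => fword [seq (g l.1, l.2) | l <- w])) => m.
case=> [w1 w2 k b b' p|w1 w2 l l'|w1 l hl].
- rewrite linearB linearP /= !free_extU !map_cat /= linearP fword_linear.
  exact: subrr.
- rewrite !linearB !linearZ /= !free_extU !map_cat /= fword_commute.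
  by rewrite /lform /= gform !scalerN addrAC addrK subrr.
- rewrite free_extU map_rcons; apply: fword_annihilate.
  by case: hl => [h|[h1 h2]]; [left|right; split => //; apply: gplus].
Qed.

(* [fdeg] is the grading of the canonical involution and [fpar] the superspace
   structure: they differ in the Weyl case, where everything is even. *)
Definition fdeg (e : bool) : set fock :=
  lspan [set fword w | w in [set w : seq letter | odd (size w) == e]].
Definition fpar (e : bool) : set fock :=
  lspan [set fword w | w in [set w : seq letter | s && odd (size w) == e]].

End Fock.

(* [Y u r] is the coefficient of z^(- r - 1) in Y(u, z). *)
Definition modes (K : fieldType) (V M : lmodType K) := V -> rat -> M -> M.

Section VertexAlgebra.
Variable K : fieldType.

Definition gbinom (x : K) (j : nat) : K :=
  (\prod_(i < j) (x - i%:R)) / (j`!)%:R.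

Definition z2grading (V : lmodType K) (P : bool -> set V) : Prop :=
  [/\ forall b, subspace (P b),
      forall v, exists v0 v1, [/\ P false v0, P true v1 & v = v0 + v1]
    & forall v, P false v -> P true v -> v = 0].

Definition trivial_deg (V : lmodType K) (e : bool) : set V :=
  if e then [set 0] else setT.

Definition bilinear_modes (V M : lmodType K) (Y : modes V M) : Prop :=
  (forall r m, linear (fun u => Y u r m)) /\ (forall u r, linear (Y u r)).

(* The exponents r such that u_(r) may be nonzero, for u of degree [e]. *)
Definition exponent (e : bool) (r : rat) : Prop :=
  r - (e : nat)%:R / 2 \is a Num.int.

(* The Jacobi identity in Borcherds form; all sums are finite by truncation. *)
Definition jacobi (V M : lmodType K) (par deg : bool -> set V)
    (YV : modes V V) (YM : modes V M) : Prop :=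
  forall (p p' e e' : bool) (u v : V) (m : M) (l : int) (x y : rat),
    par p u -> deg e u -> par p' v -> deg e' v ->
    exponent e x -> exponent e' y ->
    \sum_(j \in [set: nat]) gbinom (ratr x) j *:
      YM (YV u (l%:~R + j%:R) v) (x + y - j%:R) m
    = \sum_(j \in [set: nat]) ((-1) ^+ j * gbinom l%:~R j) *:
      (YM u (x + l%:~R - j%:R) (YM v (y + j%:R) m)
       - ((-1) ^+ (p && p') * (-1) ^ l) *:
         YM v (y + l%:~R - j%:R) (YM u (x + j%:R) m)).

(* [M] is a module, with superspace structure [parM], over the super vertex
   algebra [(V, par, vac, YV)], twisted by the involution acting as
   (-1)^e on [deg e]. *)
Definition is_twisted_module (V : lmodType K) (par deg : bool -> set V) (vac : V)
    (YV : modes V V) (M : lmodType K) (parM : bool -> set M) (YM : modes V M) : Prop :=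
  [/\ bilinear_modes YM /\ z2grading parM,
      forall p p' u r m, par p u -> parM p' m -> parM (p (+) p') (YM u r m),
      forall e u r m, deg e u -> ~ exponent e r -> YM u r m = 0,
      forall u m, exists N : rat, forall r, N <= r -> YM u r m = 0
    & (forall r m, YM vac r m = if r == -1 then m else 0)
      /\ jacobi par deg YV YM].

(* A super vertex algebra is an untwisted module over itself whose vacuum
   has the creation property. *)
Definition is_super_vertex_algebra (V : lmodType K) (par : bool -> set V)
    (vac : V) (Y : modes V V) : Prop :=
  [/\ is_twisted_module par (@trivial_deg V) vac Y par Y,
      par false vac,
      forall u, Y u (-1) vac = u
    & forall u (n : nat), Y u n%:R vac = 0].

Definition tens_par (V W : lmodType K) (P : bool -> set V) (Q : bool -> set W)
    (c : bool) : set (tens V W) :=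
  lspan [set t | exists a b v w, [/\ P a v, Q b w, a (+) b = c & t = v ⊗ w]].

(* Y(u (x) v, z) (m (x) n) = (-1)^(|v||m|) Y(u, z) m (x) Y(v, z) n *)
Definition is_tensor_modes (V1 V2 M1 M2 : lmodType K)
    (par2 : bool -> set V2) (parM1 : bool -> set M1)
    (Y1 : modes V1 M1) (Y2 : modes V2 M2)
    (Y : modes (tens V1 V2) (tens M1 M2)) : Prop :=
  bilinear_modes Y /\
  forall (p p' : bool) u v m n (r : rat), par2 p v -> parM1 p' m ->
    Y (u ⊗ v) r (m ⊗ n)
    = (-1) ^+ (p && p') *: \sum_(i \in [set: rat]) (Y1 u i m ⊗ Y2 v (r - 1 - i) n).

End VertexAlgebra.

Section FockVertexAlgebra.
Variables (K : fieldType) (s : bool) (A : polspace K s).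

(* a(-1/2) v *)
Definition fgen (a : A) : fock false A := fword false [:: (a, -1)].

Definition is_fock_sva (Y : modes (fock false A) (fock false A)) : Prop :=
  is_super_vertex_algebra (@fpar false K s A) (fvac false A) Y /\
  forall (a : A) (n : int) x, Y (fgen a) n%:~R x = fmode a n x.

(* The canonical involution acts on a_1(r_1)...a_k(r_k) v as (-1)^k, in the
   Weyl case as well, where it is not the parity involution: this is what
   makes the exponents of Y_tw(a(-1/2) v, z) half-integral. *)
Definition is_fock_twisted (Y : modes (fock false A) (fock false A))
    (Ytw : modes (fock false A) (fock true A)) : Prop :=
  is_twisted_module (@fpar false K s A) (@fdeg false K s A) (fvac false A) Y
    (@fpar true K s A) Ytw /\
  forall (a : A) (n : int) x, Ytw (fgen a) (n%:~R - 1 / 2) x = fmode a n x.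

Definition dual_bases (n : nat) (ap am : n.-tuple A) : Prop :=
  [/\ basis_of (pplus A) ap, basis_of (pminus A) am,
      forall i j, pform A (tnth am i) (tnth ap j) = (i == j)%:R
    & forall i j, pform A (tnth ap i) (tnth am j) = - (-1) ^+ s * (i == j)%:R].

Definition jmath (n : nat) (ap am : n.-tuple A) : fock false A :=
  \sum_(i < n) fword false [:: (tnth ap i, -1); (tnth am i, -1)].

Definition omega (n : nat) (ap am : n.-tuple A) : fock false A :=
  2^-1 *: \sum_(i < n) (fword false [:: (tnth ap i, -2); (tnth am i, -1)]
                        - fword false [:: (tnth ap i, -1); (tnth am i, -2)]).

End FockVertexAlgebra.

Definition lftrace (K : fieldType) (U : vectType K) (f : 'End(U)) : K :=
  \sum_(i < \dim {:U}) coord (vbasis {:U}) i (f (vbasis {:U})`_i).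

(* A homomorphism [H -> GL(A^+)], with the induced maps (g, g') on A. *)
Record polrep (gT : finGroupType) (H : {group gT}) (K : fieldType) (s : bool)
    (A : polspace K s) := Polrep {
  rep_plus :> gT -> 'End(subvs_of (pplus A));
  rep_full : gT -> 'End(A);
  rep_plus1 : rep_plus 1%g = \1%VF;
  rep_plusM : {in H &, forall g h, rep_plus (g * h)%g = (rep_plus g \o rep_plus h)%VF};
  rep_full_plus : {in H, forall g x, rep_full g (vsval x) = vsval (rep_plus g x)};
  rep_full_minus : {in H, forall g x, x \in pminus A -> rep_full g x \in pminus A};
  rep_full_form : {in H, forall g x y, x \in pplus A -> y \in pminus A ->
    pform A (rep_full g x) (rep_full g y) = pform A x y}
}.

Section Niemeier.
Variable Q : 'M[int]_24.

(* The lattice is Z^24, as column vectors, with Gram matrix [Q]. *)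
Definition lat_form (x y : 'cV[int]_24) : int := (x^T *m Q *m y) 0 0.

Definition even_unimodular : Prop :=
  [/\ Q^T = Q, \det Q = 1, forall x, x != 0 -> 0 < lat_form x x
    & forall x, (2 %| lat_form x x)%Z].

Definition lat_root (x : 'cV[int]_24) : Prop := lat_form x x = 2.

(* The roots are the vectors [r k i j], i <> j, and have the inner products of the
   roots e_i - e_j of the k-th of 8 orthogonal copies of A_3. *)
Definition root_system_A3_8 : Prop :=
  exists r : 'I_8 -> 'I_4 -> 'I_4 -> 'cV[int]_24,
    (forall x, lat_root x <-> exists k i j, i != j /\ x = r k i j) /\
    (forall k k' i j i' j', lat_form (r k i j) (r k' i' j') =
       if k == k' then
         (i == i')%:R - (i == j')%:R - (j == i')%:R + (j == j')%:R
       else 0).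

Definition lat_aut (M : 'M[int]_24) : Prop :=
  M \in unitmx /\ M^T *m Q *m M = Q.

Definition reflection (r : 'cV[int]_24) : 'M[int]_24 := 1%:M - r *m r^T *m Q.

Definition lat_inn (M : 'M[int]_24) : Prop :=
  exists2 rs : seq 'cV[int]_24,
    (forall r, r \in rs -> lat_root r) &
    M = \big[mulmx/1%:M]_(r <- rs) reflection r.

(* [gT] is Aut(N)/Inn(N), with quotient map [pi]. *)
Definition is_umbral_group (gT : finGroupType) (pi : 'M[int]_24 -> gT) : Prop :=
  [/\ forall M M', lat_aut M -> lat_aut M' -> pi (M *m M') = (pi M * pi M')%g,
      forall g, exists2 M, lat_aut M & pi M = g
    & forall M, lat_aut M -> (pi M = 1%g <-> lat_inn M)].

End Niemeier.

Definition SL2_7 : {set {'GL_2(7)}} := [set x | \det (GLval x) == 1]%SET.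

Inductive cls336 :=
  | C1A | C2A | C4A | C3A | C6A | C8A | C8B | C7A | C7B | C14A | C14B.

Definition cls_order (c : cls336) : nat :=
  match c with
  | C1A => 1 | C2A => 2 | C4A => 4 | C3A => 3 | C6A => 6 | C8A | C8B => 8
  | C7A | C7B => 7 | C14A | C14B => 14
  end%N.

Definition class_names (gT : finGroupType) (H : {group gT}) (cl : gT -> cls336) : Prop :=
  {in H &, forall g h, cl g = cl h <-> h \in g ^: H}%g /\
  {in H, forall g, #[g]%g = cls_order (cl g)}.

Section Analysis.
Variable R : realType.
Local Notation C := R[i].
Local Open Scope complex_scope.

Definition cexp (z : C) : C := (expR (complex.Re z))%:C * (cos (complex.Im z) +i* sin (complex.Im z)).

(* x |-> e^(2 pi i x) *)
Definition e2pi (x : C) : C := cexp (2 * (pi : R)%:C * 'i * x).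

Definition infprod (f : nat -> C) : C :=
  limn (fun N => \prod_(1 <= n < N.+1) f n : C^o).

Definition eta (tau : C) : C :=
  e2pi (tau / 24%:R) * infprod (fun n => 1 - e2pi tau ^+ n).

Definition theta1 (tau z : C) : C :=
  let q := e2pi tau in let y := e2pi z in
  - 'i * e2pi (tau / 8%:R) * e2pi (z / 2) *
  infprod (fun n => (1 - y^-1 * q ^+ n.-1) * (1 - y * q ^+ n) * (1 - q ^+ n)).

Definition theta2 (tau z : C) : C :=
  let q := e2pi tau in let y := e2pi z in
  e2pi (tau / 8%:R) * e2pi (z / 2) *
  infprod (fun n => (1 + y^-1 * q ^+ n.-1) * (1 + y * q ^+ n) * (1 - q ^+ n)).

Definition b7 : C := (- (1 / 2)) +i* (Num.sqrt 7%:R / 2).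
Definition b7bar : C := (- (1 / 2)) -i* (Num.sqrt 7%:R / 2).

Definition chi2 (c : cls336) : C :=
  match c with
  | C1A | C2A => 3%:R | C4A => -1 | C3A | C6A => 0 | C8A | C8B => 1
  | C7A | C14A => b7 | C7B | C14B => b7bar
  end.

Definition chi8 (c : cls336) : C :=
  match c with
  | C1A => 4%:R | C2A => - 4%:R | C4A => 0 | C3A => 1 | C6A => -1 | C8A | C8B => 0
  | C7A => - b7bar | C7B => - b7 | C14A => b7bar | C14B => b7
  end.

Definition psi4 (c : cls336) (tau z : C) : C :=
  let k7 (k : nat) : C := k%:R / 7%:R in
  match c with
  | C1A => 2 * 'i * eta tau ^+ 3 * theta1 tau (2 * z) ^+ 3 / theta1 tau z ^+ 4
  | C2A => 2 * 'i * eta tau ^+ 3 * theta1 tau (2 * z) ^+ 3 / theta2 tau z ^+ 4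
  | C4A => - 2 * 'i *
      (eta (2 * tau) ^+ 2 * theta1 tau (2 * z) * theta2 tau (2 * z) ^+ 2
       / (eta tau * theta2 (2 * tau) (2 * z) ^+ 2))
  | C3A => 2 * 'i *
      (eta tau ^+ 3 * theta1 (3%:R * tau) (6%:R * z)
       / (theta1 tau z * theta1 (3%:R * tau) (3%:R * z)))
  | C6A => - 2 * 'i *
      (eta tau ^+ 3 * theta1 (3%:R * tau) (6%:R * z)
       / (theta2 tau z * theta2 (3%:R * tau) (3%:R * z)))
  | C8A | C8B => - 2 * 'i *
      (eta tau * eta (4%:R * tau) * theta1 tau (2 * z) * theta2 (2 * tau) (4%:R * z)
       / (eta (2 * tau) * theta2 (4%:R * tau) (4%:R * z)))
  | C7A | C7B => - 'i *
      (eta (7%:R * tau) / (eta tau ^+ 4 * theta1 (7%:R * tau) (7%:R * z))) *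
      (\prod_(k <- [:: 1; 2; 4]%N)
          (theta1 tau (2 * z + k7 k) * theta1 tau (z - k7 k))
       + \prod_(k <- [:: 1; 2; 4]%N)
          (theta1 tau (2 * z - k7 k) * theta1 tau (z + k7 k)))
  | C14A | C14B => 'i *
      (eta (7%:R * tau) / (eta tau ^+ 4 * theta2 (7%:R * tau) (7%:R * z))) *
      (\prod_(k <- [:: 1; 2; 4]%N)
          (theta1 tau (2 * z + k7 k) * theta2 tau (z - k7 k))
       + \prod_(k <- [:: 1; 2; 4]%N)
          (theta1 tau (2 * z - k7 k) * theta2 tau (z + k7 k)))
  end.

Section Trace.
Variable W : lmodType C.

Definition eigenspace2 (J L : W -> W) (m n : C) : set W :=
  [set w | J w = m *: w /\ L w = n *: w].

(* [E] is finite dimensional, stable under [T], and [t] is the trace of [T] on [E]. *)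
Definition is_trace_on (E : set W) (T : W -> W) (t : C) : Prop :=
  exists (k : nat) (b : 'I_k -> W) (M : 'M[C]_k),
    [/\ forall w, E w <-> exists x : 'I_k -> C, w = \sum_i x i *: b i,
        forall x : 'I_k -> C, \sum_i x i *: b i = 0 -> forall i, x i = 0,
        forall j, T (b j) = \sum_i M i j *: b i
      & t = \tr M].

(* tr(T y^J q^L | W) is the formal series sum_(m, n) c m n y^m q^n: W is the
   sum of the joint eigenspaces of J and L, each of them is finite
   dimensional, and c m n is the trace of T on the one for (m, n). *)
Definition is_graded_trace (J L T : W -> W) (c : C -> C -> C) : Prop :=
  lspan [set w | exists m n, eigenspace2 J L m n w] = setT /\
  forall m n, is_trace_on (eigenspace2 J L m n) T (c m n).

End Trace.

(* The formal series sum_(m, n) c m n y^m q^n converges (unconditionally, hence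
   absolutely) to [l] at y = e^(2 pi i z), q = e^(2 pi i tau). *)
Definition series_converges (c : C -> C -> C) (tau z l : C) : Prop :=
  partial_sum (fun mn : (C * C)%type =>
    c mn.1 mn.2 * e2pi (mn.1 * z) * e2pi (mn.2 * tau) : C^o) @ totally --> (l : C^o).

End Analysis.

Section W4.
Variables (K : fieldType) (e a : polspace K true) (b : polspace K false).

Definition W4 : lmodType K := tens (tens (fock false e) (fock false a)) (fock false b).
Definition W4tw : lmodType K := tens (tens (fock true e) (fock true a)) (fock true b).

Section Elements.
Variables (ne na nb : nat).
Variables (ep em : ne.-tuple e) (ap am : na.-tuple a) (bp bm : nb.-tuple b).

Definition jmath_e4 : W4 := jmath ep em ⊗ fvac false a ⊗ fvac false b.
Definition jmath4 : W4 :=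
  2 *: (fvac false e ⊗ jmath ap am ⊗ fvac false b)
  + fvac false e ⊗ fvac false a ⊗ jmath bp bm.
Definition omega4 : W4 :=
  omega ep em ⊗ fvac false a ⊗ fvac false b
  + fvac false e ⊗ omega ap am ⊗ fvac false b
  + fvac false e ⊗ fvac false a ⊗ omega bp bm.

End Elements.

(* (-1)^F = (-I) (x) (-I) (x) I; the element -I of GL(e^+) acts on e as -1 *)
Definition sgnF : W4tw -> W4tw :=
  tmap (tmap (@fact true K true e -%R) (@fact true K true a -%R)) id.

Definition rep_act (gT : finGroupType) (H : {group gT})
    (rho_a : polrep H a) (rho_b : polrep H b) (g : gT) : W4tw -> W4tw :=
  tmap (tmap id (@fact true K true a (rep_full rho_a g)))
       (@fact true K false b (rep_full rho_b g)).

(* The mode families [Yw] on W^(4)_tw of the tensor product of the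
   canonically twisted modules of the three factors. *)
Definition is_W4_twisted
    (Ye : modes (fock false e) (fock true e))
    (Ya : modes (fock false a) (fock true a))
    (Yb : modes (fock false b) (fock true b))
    (Yw : modes W4 W4tw) : Prop :=
  exists Yea : modes (tens (fock false e) (fock false a))
                     (tens (fock true e) (fock true a)),
    is_tensor_modes (@fpar false K true a) (@fpar true K true e) Ye Ya Yea /\
    is_tensor_modes (@fpar false K false b)
      (tens_par (@fpar true K true e) (@fpar true K true a)) Yea Yb Yw.

End W4.

(* Main.v *)
Require Import Defs.
From HB Require Import structures.
From mathcomp Require Import all_boot all_order all_algebra all_fingroup.
From mathcomp Require Import generic_quotient finmap monalg.
From mathcomp Require Import all_classical all_reals all_analysis.
From mathcomp Require Import separable cyclotomic mxpoly cyclic.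
From mathcomp Require Import zify ring lra.

Set Implicit Arguments.
Unset Strict Implicit.
Unset Printing Implicit Defensive.

(** All operators in the trace are diagonal in one basis of the twisted module.
The trace is therefore a generating function of occupation numbers, which is an
infinite product, and the theorem becomes an identity of infinite products.

The basis.  In a twisted Fock module the negative modes, and the zero modes of
the minus summand, create; their duals annihilate.  Products of creation
operators applied to the vacuum form a basis indexed by occupation numbers
([osc_basis], [fock_basis]).  They span because of the commutation relations.
They are independent because the annihilation operators lower the occupation
numbers and the vacuum is not zero: Wick's formula defines a linear functional
[vev] on the module that takes the value 1 at the vacuum.

The eigenvalues.  The Borcherds identity turns J(0) and L(0) into normally
ordered sums ([twisted_charge], [twisted_energy]) that commute with a creation
operator up to a multiple of it, and their values on the vacuum come from the
binomial coefficients in that identity.  An element [g] of finite order acts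
diagonalizably, and [g^-1] has the same eigenvectors, so the basis can be built
on eigenvectors of [g] ([rep_eigenbasis], [w4_basis], [w4_modes]).

The sum.  A mode of weight [x] contributes [1 + x] to a Clifford module and
[1 / (1 - x)] to a Weyl module, and (-1)^F replaces [x] by [- x] in the former.
The zero mode of [e] has weight -1, so its two occupations cancel except where
J_e(0) tells them apart; what is left of that factor is the square of the
product of the [1 - q^n].  The vacuum charges add up to 1 and the vacuum
energies to 0.  If [l_j] and [m_j] denote the eigenvalues of [g] on the plus
summands of [a] and [b], the part of the trace that belongs to [g] is
<<
  y prod (1 - q^n)^2 (1 - l_j^-1 y^-2 q^(n-1)) (1 - l_j y^2 q^n)
    / prod (1 - m_j^-1 y^-1 q^(n-1)) (1 - m_j y q^n)
>>
which is [w4_limit].  All of this converges absolutely when [y^-1] and [y q]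
have modulus less than 1, that is, in the domain of the theorem, so the terms
may be collected by charge and energy ([w4_sum_limit], [w4_sum_bound],
[series_converges_regroup]).

The identification.  The products depend only on the characteristic
polynomials of [g] on the two plus summands.  Newton's identities compute these
from the characters of the powers of [g], and the orders of the powers are
enough to know the characters up to complex conjugation ([class_factors]).  The
conjugation that remains undetermined in the orders 7 and 14 exchanges [g] and
[g^-1], which both occur in the trace.  Eta and theta functions are monomials
in e(tau / 24) and e(z / 2) times products of the same kind, hence each class
amounts to an identity of rational expressions in finitely many values of one
infinite product ([theta_1A] to [theta_14A], [psi4_limit]). *)

Import Order.TTheory GRing.Theory Num.Theory.
Import numFieldNormedType.Exports.

Local Open Scope classical_set_scope.
Local Open Scope ring_scope.

Local Notation subspace := Defs.subspace.

(** * Linear spans and the mode operators of a Fock module *)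

Section SpanTheory.
Variables (K : fieldType) (V : lmodType K).
Implicit Types (S U : set V).

Lemma lspan_ext S : S `<=` lspan S.
Proof. by move=> x Sx U [_ SU]; apply: SU. Qed.

Lemma lspan_min S U : subspace U -> S `<=` U -> lspan S `<=` U.
Proof. by move=> sU SU x Sx; apply: (Sx U); split. Qed.

Lemma subspaceZ U (k : K) (x : V) : subspace U -> U x -> U (k *: x).
Proof. by move=> [U0 UL] Ux; rewrite -[k *: x]addr0; apply: UL. Qed.

Lemma subspaceD U (x y : V) : subspace U -> U x -> U y -> U (x + y).
Proof. by move=> [U0 UL] Ux Uy; rewrite -[x]scale1r; apply: UL. Qed.

Lemma subspace_sum U (I : Type) (r : seq I) (P : pred I) (F : I -> V) :
  subspace U -> (forall i, P i -> U (F i)) -> U (\sum_(i <- r | P i) F i).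
Proof.
move=> sU UF; apply: (big_ind U) => //; first exact: sU.1.
by move=> x y; apply: subspaceD.
Qed.

Lemma linear_fun0 (W : lmodType K) (f : V -> W) : linear f -> f 0 = 0.
Proof.
by move=> fl; have := fl (-1) 0 0; rewrite scaler0 addr0 scaleN1r addNr.
Qed.

Lemma linear_funD (W : lmodType K) (f : V -> W) x y :
  linear f -> f (x + y) = f x + f y.
Proof. by move=> fl; have := fl 1 x y; rewrite !scale1r. Qed.

Lemma linear_funZ (W : lmodType K) (f : V -> W) k x :
  linear f -> f (k *: x) = k *: f x.
Proof.
by move=> fl; have := fl k x 0; rewrite (linear_fun0 fl) !addr0.
Qed.

Lemma linear_fun_sum (W : lmodType K) (f : V -> W) (I : Type) (r : seq I)
    (P : pred I) (F : I -> V) :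
  linear f -> f (\sum_(i <- r | P i) F i) = \sum_(i <- r | P i) f (F i).
Proof.
move=> fl; apply: (big_morph f); last exact: linear_fun0.
by move=> x y; apply: linear_funD.
Qed.

Lemma subspace_eq (W : lmodType K) (f g : V -> W) :
  linear f -> linear g -> subspace [set x | f x = g x].
Proof.
move=> fl gl; split=> [|k x y /= fx fy]; first by rewrite /= !linear_fun0.
by rewrite fl gl fx fy.
Qed.

End SpanTheory.

Lemma presented_ind (K : fieldType) (X : choiceType) (rel : set {malg K[X]})
    (U : set (presented rel)) :
  subspace U -> (forall x, U (pgen rel x)) -> forall v, U v.
Proof.
move=> sU Ug v; rewrite -[v]qclass_repr [repr v]monalgE linear_sum.
apply: subspace_sum => // x _.
suff -> : << (repr v)@_x *g x >> = (repr v)@_x *: << x >> :> {malg K[X]}.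
  by rewrite linearZ; apply: subspaceZ => //; exact: Ug.
by apply/malgP => y; rewrite mcoeffZ !mcoeffU mulrnAr mulr1.
Qed.

Lemma linear_combA (K : comPzRingType) (V : lmodType K) (c k : K) (u v u' v' : V) :
  c *: (k *: u + v) + (k *: u' + v') = k *: (c *: u + u') + (c *: v + v').
Proof. by rewrite !scalerDr addrACA !scalerA [c * k]mulrC. Qed.

Lemma linear_combA2 (K : comPzRingType) (V : lmodType K) (c k m : K) (u v u' v' : V) :
  c *: (k *: u + m *: v) + (k *: u' + m *: v')
  = k *: (c *: u + u') + m *: (c *: v + v').
Proof. by rewrite linear_combA; congr (_ + _); rewrite scalerDr !scalerA [c * m]mulrC. Qed.

Opaque presented fock fword fmode fact.

Section FockTheory.
Variables (tw : bool) (K : fieldType) (s : bool) (A : polspace K s).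
Local Notation fock := (@fock tw K s A).
Local Notation fword := (@fword tw K s A).
Local Notation letter := (letter A).
Local Notation lform := (@lform tw K s A).
Local Notation sgn := ((-1) ^+ s : K).

Lemma fock_ind (U : set fock) :
  subspace U -> (forall w, U (fword w)) -> forall v, U v.
Proof. exact: presented_ind. Qed.

Fact fmode_linear (a : A) n : linear (@fmode tw K s A a n).
Proof.
apply: plift_linear => m; case=> [w1 w2 k b b' p|w1 w2 l l'|w1 l hl].
- by rewrite linearB linearP /= !free_extU -!cat_cons fword_linear subrr.
- rewrite !linearB !linearZ /= !free_extU -!cat_cons fword_commute.
  by rewrite !scalerN addrAC addrK subrr.
- by rewrite free_extU -rcons_cons fword_annihilate.
Qed.
HB.instance Definition _ a n :=
  GRing.isLinear.Build K fock fock *:%R (@fmode tw K s A a n) (fmode_linear a n).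

Lemma fmode_lineara k (a b : A) n x :
  fmode (k *: a + b) n x = k *: fmode a n x + fmode b n x :> fock.
Proof.
move: x; apply: fock_ind => [|w]; last by rewrite !fmodeE (@fword_linear tw K s A [::] w).
split=> [|c x y /= hx hy]; first by rewrite /= !linear0 ?scaler0 ?addr0.
rewrite (fmode_linear (k *: a + b)) (fmode_linear a) (fmode_linear b) hx hy.
exact: linear_combA.
Qed.

Lemma fmodeC (l l' : letter) x :
  fmode l.1 l.2 (fmode l'.1 l'.2 x)
  = sgn *: fmode l'.1 l'.2 (fmode l.1 l.2 x) + lform l l' *: x :> fock.
Proof.
move: x; apply: fock_ind => [|w].
  split=> [|c x y /= hx hy]; first by rewrite /= !linear0 ?scaler0 ?addr0.
  rewrite (fmode_linear l'.1) (fmode_linear l.1) (fmode_linear l.1) hx.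
  rewrite hy (fmode_linear l'.1).
  exact: linear_combA2.
by case: l l' => [a m] [b n]; rewrite /= !fmodeE (@fword_commute tw K s A [::]).
Qed.

Lemma fmode_vac (l : letter) : annihilator tw l -> fmode l.1 l.2 (fvac tw A) = 0.
Proof. by move=> hl; rewrite fmodeE -[_ :: _]/(rcons [::] (_, _)) -surjective_pairing fword_annihilate. Qed.

Section Action.
Variable g : {linear A -> A}.
Hypotheses (gform : forall x y, pform A (g x) (g y) = pform A x y)
  (gplus : forall x, x \in pplus A -> g x \in pplus A).

Lemma fact_linear : linear (@fact tw K s A g).
Proof.
apply: plift_linear => m; case=> [w1 w2 k b b' p|w1 w2 l l'|w1 l hl].
- rewrite linearB linearP /= !free_extU !map_cat /= linearP fword_linear.
  exact: subrr.
- rewrite !linearB !linearZ /= !free_extU !map_cat /= fword_commute.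
  by rewrite /lform /= gform !scalerN addrAC addrK subrr.
- rewrite free_extU map_rcons; apply: fword_annihilate.
  by case: hl => [h|[h1 h2]]; [left|right; split => //; apply: gplus].
Qed.

Lemma fact_fmode a n x : fact g (fmode a n x) = fmode (g a) n (fact g x) :> fock.
Proof.
move: x; apply: fock_ind => [|w]; last by rewrite fmodeE !Defs.factE // fmodeE.
split=> [|c y z /= hy hz].
  have f0 := linear_fun0 fact_linear.
  by rewrite /= f0 !linear0 f0.
by rewrite !(fmode_linear, fact_linear) hy hz.
Qed.

Lemma fact_vac : fact g (fvac tw A) = fvac tw A.
Proof. by rewrite Defs.factE. Qed.

End Action.
End FockTheory.

(** * Wick's formula and the vacuum functional *)

Section Wick.
Variables (K : fieldType) (s : bool) (A : polspace K s).
Local Notation letter := (letter A).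
Local Notation lform := (@lform true K s A).
Local Notation sgn := ((-1) ^+ s : K).

Definition polproj : A -> A := daddv_pi (pplus A) (pminus A).

Lemma polproj_linear : linear polproj.
Proof. exact: linearP. Qed.

Lemma polproj_plus x : polproj x \in pplus A.
Proof. exact: memv_pi. Qed.

Lemma polproj_minus x : x - polproj x \in pminus A.
Proof.
have h : polproj x + daddv_pi (pminus A) (pplus A) x = x.
  by apply: daddv_pi_add; [exact: pol_direct | rewrite pol_full memvf].
by rewrite -{1}h addrC addKr memv_pi.
Qed.

Lemma polproj_ann x : x \in pminus A -> polproj x = 0.
Proof.
move=> xm; have : polproj x \in (pplus A :&: pminus A)%VS.
  rewrite memv_cap polproj_plus /=.
  by rewrite -[polproj x](subKr x) rpredB // polproj_minus.
by rewrite pol_direct memv0 => /eqP.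
Qed.

(** The two-point function of [l] and [l'].  Two zero modes contract through the
component of the first in [pplus A], which is the one that kills the vacuum. *)
Definition contraction (l l' : letter) : K :=
  if l.2 + l'.2 == 0 then
    if 0 < l.2 then pform A l.1 l'.1
    else if l.2 == 0 then pform A (polproj l.1) l'.1 else 0
  else 0.

Lemma contraction_linearl k a a' n l :
  contraction (k *: a + a', n) l = k * contraction (a, n) l + contraction (a', n) l.
Proof.
rewrite /contraction /=; case: ifP => _; last by rewrite mulr0 addr0.
case: ifP => _; first by rewrite linearPl.
by case: ifP => _; rewrite ?mulr0 ?addr0 // polproj_linear linearPl.
Qed.

Lemma contraction_linearr k a a' n l :
  contraction l (k *: a + a', n) = k * contraction l (a, n) + contraction l (a', n).
Proof.
rewrite /contraction /=; case: ifP => _; last by rewrite mulr0 addr0.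
case: ifP => _; first by rewrite linearPr.
by case: ifP => _; rewrite ?mulr0 ?addr0 // linearPr.
Qed.

Lemma freq_tw n : freq true n = n%:~R.
Proof. by rewrite /freq addr0. Qed.

Lemma lform_tw (l l' : letter) :
  lform l l' = if l.2 + l'.2 == 0 then pform A l.1 l'.1 else 0.
Proof. by rewrite /Defs.lform !freq_tw -intrD intr_eq0. Qed.

(** This is what makes the Wick expansion compatible with the defining relations
of the algebra. *)
Lemma contractionC l l' :
  contraction l l' - sgn * contraction l' l = lform l l'.
Proof.
have sg2 : sgn * sgn = 1 by rewrite -expr2 sqrr_sign.
have symm x y : pform A x y = - sgn * pform A y x by rewrite -pformC.
rewrite lform_tw /contraction [l'.2 + l.2]addrC.
case: ifP => [/eqP e|_]; last by rewrite mulr0 subr0.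
have -> : l'.2 = - l.2 by apply/eqP; rewrite -addr_eq0 addrC e.
rewrite oppr_gt0 oppr_eq0; case: (ltgtP 0 l.2) => h.
- by rewrite mulr0 subr0.
- by rewrite sub0r (symm l.1) mulNr.
- rewrite [pform A l.1 _](_ : _ = pform A (polproj l.1) l'.1
      + pform A (l.1 - polproj l.1) l'.1); last by rewrite -linearDl /= addrC subrK.
  congr (_ + _).
  rewrite -[l'.1 in RHS](subrK (polproj l'.1)) linearDr /=.
  rewrite (pminus_isotropic (polproj_minus _) (polproj_minus _)) add0r.
  rewrite -mulNr -symm -{1}[l.1](subrK (polproj l.1)) linearDl /=.
  by rewrite (pplus_isotropic (polproj_plus _) (polproj_plus _)) addr0.
Qed.

Lemma contraction_annr l l' : annihilator true l' -> contraction l l' = 0.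
Proof.
rewrite /annihilator freq_tw /contraction => -[|[]].
  rewrite ltr0z => h; case: ifP => // /eqP e.
  have -> : l.2 = - l'.2 by apply/eqP; rewrite -addr_eq0 e.
  by rewrite oppr_gt0 ltNge ltW //= oppr_eq0 gt_eqF.
move/eqP; rewrite intr_eq0 => /eqP-> l'p; rewrite addr0; case: ifP => // /eqP->.
by rewrite ltxx eqxx (pplus_isotropic (polproj_plus _) l'p).
Qed.

Lemma contraction_crel l l' :
  l.2 < 0 \/ l.2 = 0 /\ l.1 \in pminus A -> contraction l l' = 0.
Proof.
rewrite /contraction => -[h|[-> h]]; case: ifP => // _.
  by rewrite ltNge ltW //= lt_eqF.
by rewrite polproj_ann // linear0l.
Qed.

(** Passing the evaluation [F] of the remaining word as a continuation makes
Wick's expansion structurally recursive in [w]. *)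
Fixpoint wick_step (l : letter) (F : seq letter -> K) (w : seq letter) : K :=
  if w is x :: w' then
    contraction l x * F w' + sgn * wick_step l (fun v => F (x :: v)) w'
  else 0.

Definition wick_op (F : seq letter -> K) (w : seq letter) : K :=
  if w is l :: w' then wick_step l F w' else 1.

Lemma wick_step_ext l F G w :
  (forall v, (size v < size w)%N -> F v = G v) -> wick_step l F w = wick_step l G w.
Proof.
elim: w F G => //= x w IH F G FG; rewrite FG //; congr (_ + _ * _).
by apply: IH => v hv; apply: FG.
Qed.

Lemma wick_step_lin l k F G H w : (forall v, F v = k * G v + H v) ->
  wick_step l F w = k * wick_step l G w + wick_step l H w.
Proof.
elim: w F G H => [|x w IH] F G H h /=; first by rewrite mulr0 addr0.
by rewrite h (IH _ (fun v => G (x :: v)) (fun v => H (x :: v))) //; ring.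
Qed.

Lemma wick_stepZ l k F w :
  wick_step l (fun v => k * F v) w = k * wick_step l F w.
Proof.
by elim: w F => [|x w IH] F /=; rewrite ?mulr0 // (IH (fun v => F (x :: v))); ring.
Qed.

(** Two contractions are independent of each other; only the sign records their
order. *)
Lemma wick_stepC l l' G w :
  wick_step l (wick_step l' G) w = sgn * wick_step l' (wick_step l G) w.
Proof.
have sg2 : sgn * sgn = 1 by rewrite -expr2 sqrr_sign.
elim: w G => [|x w IH] G /=; first by rewrite mulr0.
have e y y' : wick_step y (fun v => contraction y' x * G v
      + sgn * wick_step y' (fun u => G (x :: u)) v) w
    = contraction y' x * wick_step y G w
      + sgn * wick_step y (wick_step y' (fun u => G (x :: u))) w.
  rewrite (@wick_step_lin y (contraction y' x) _ G
    (fun v => sgn * wick_step y' (fun u => G (x :: u)) v)) //; congr (_ + _).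
  exact: wick_stepZ.
by rewrite !e IH; ring: sg2.
Qed.

Definition wick_linear (F : seq letter -> K) : Prop := forall w1 w2 k a a' n,
  F (w1 ++ (k *: a + a', n) :: w2) = k * F (w1 ++ (a, n) :: w2) + F (w1 ++ (a', n) :: w2).

Lemma wick_step_linear l F : wick_linear F -> wick_linear (wick_step l F).
Proof.
move=> Fl w1 w2 k a a' n; elim: w1 F Fl => [|x w1 IH] F Fl /=.
  rewrite contraction_linearr (@wick_step_lin l k _ (fun v => F ((a, n) :: v))
    (fun v => F ((a', n) :: v))) => [|v]; last exact: (Fl [::]).
  ring.
rewrite Fl (IH (fun v => F (x :: v))); first by ring.
by move=> v1 v2 k' b b' m; rewrite -!cat_cons Fl.
Qed.

Lemma wick_op_linear F : wick_linear F -> wick_linear (wick_op F).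
Proof.
move=> Fl [|x w1] w2 k a a' n /=; last exact: wick_step_linear.
elim: w2 F Fl => [|x w IH] F Fl /=; first by rewrite mulr0 addr0.
rewrite contraction_linearl (IH (fun v => F (x :: v))); first by ring.
by move=> v1 v2 k' b b' m; rewrite -!cat_cons Fl.
Qed.

Definition wick_comm (F G : seq letter -> K) : Prop := forall w1 w2 l l',
  F (w1 ++ [:: l, l' & w2]) = sgn * F (w1 ++ [:: l', l & w2]) + lform l l' * G (w1 ++ w2).

Lemma wick_step_comm y F G : wick_comm F G -> wick_comm (wick_step y F) (wick_step y G).
Proof.
have sg2 : sgn * sgn = 1 by rewrite -expr2 sqrr_sign.
move=> FG w1 w2 l l'; elim: w1 F G FG => [|x w1 IH] F G FG /=.
  rewrite (@wick_step_lin y sgn (fun v => F [:: l, l' & v]) (fun v => F [:: l', l & v])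
    (fun v => lform l l' * G v)) => [|v]; last exact: (FG [::]).
  by rewrite wick_stepZ; ring: sg2.
rewrite FG (IH (fun v => F (x :: v)) (fun v => G (x :: v))); first by ring.
by move=> v1 v2 z z'; rewrite -!cat_cons FG.
Qed.

(** The expansion removes two letters at a time, which is not a structural
recursion on words; [n] bounds its depth, and any [n] above the length of the
word gives the same value. *)
Fixpoint wickn (n : nat) : seq letter -> K :=
  if n is n'.+1 then wick_op (wickn n') else fun=> 0.

Lemma wickn_linear n : wick_linear (wickn n).
Proof.
elim: n => [|n IH]; last exact: wick_op_linear.
by move=> *; rewrite /= mulr0 addr0.
Qed.

Lemma wickn_comm n : wick_comm (wickn n.+1) (wickn n).
Proof.
elim: n => [|n IH].
  have w0 l v : wick_step l (fun=> 0) v = 0.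
    by elim: v => //= z v ->; rewrite !mulr0 addr0.
  by move=> [|x w1] w2 l l'; rewrite /= !w0 ?mulr0 ?addr0 ?mulr0.
move=> [|x w1] w2 l l'; last exact: (wick_step_comm x IH).
rewrite !cat0s -[wickn n.+2]/(wick_op (wick_op (wickn n))) /= (wick_stepC l).
rewrite -contractionC; set X := wick_step l' _ _; set Y := wick_op _ _.
by ring.
Qed.

Lemma wickn_ann n w l : annihilator true l -> wickn n (rcons w l) = 0.
Proof.
move=> hl; elim: n w => // n IH [|x w] //=.
have F0 v : wickn n (rcons v l) = 0 := IH v.
elim: w (wickn n) F0 => [|y w IHw] F F0 /=.
  by rewrite contraction_annr // mul0r mulr0 addr0.
by rewrite F0 mulr0 add0r IHw ?mulr0 // => v; rewrite -rcons_cons F0.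
Qed.

Lemma wickn_stable n m w :
  (size w < n)%N -> (size w < m)%N -> wickn n w = wickn m w.
Proof.
elim: n m w => // n IH [|m] [|x w] //; rewrite !ltnS => hn hm /=.
by apply: wick_step_ext => v hv; apply: IH; apply: ltn_trans hv _.
Qed.

Definition wick (w : seq letter) : K := wickn (size w).+1 w.

Lemma wickE n w : (size w < n)%N -> wick w = wickn n w.
Proof. exact: wickn_stable. Qed.

(** Since this functional exists and takes the value 1 at the vacuum, the quotient
that defines the Fock module is not zero. *)
Definition vev : fock true A -> K := plift (U := K^o) wick.

Lemma wick_rel m : @fock_rel true K s A m -> free_ext (U := K^o) wick m = 0.
Proof.
case=> [w1 w2 k b b' p|w1 w2 l l'|w l hl].
- have [N hN] : exists N, (size w1 + size w2 + 2 < N)%N by eexists; exact: ltnSn.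
  rewrite linearB linearP /= !free_extU.
  by rewrite !(wickE (n := N)) ?wickn_linear ?subrr //;
    apply: leq_ltn_trans hN; rewrite size_cat -addnA leq_add2l /= addn2.
- have [N hN] : exists N, (size w1 + size w2 + 2 < N)%N by eexists; exact: ltnSn.
  rewrite !linearB !linearZ /= !free_extU.
  rewrite (wickE (n := N) (w := w1 ++ w2)); last first.
    by apply: leq_ltn_trans hN; rewrite size_cat leq_addr.
  rewrite !(wickE (n := N.+1)); try by
    apply: ltnW; apply: leq_ltn_trans hN; rewrite size_cat -addnA leq_add2l /= addn2.
  by rewrite wickn_comm /GRing.scale /= !mulrN -addrA -opprD subrr.
- by rewrite free_extU /wick wickn_ann.
Qed.

Lemma vev_linear : linear (vev : fock true A -> K^o).
Proof. exact: plift_linear wick_rel. Qed.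

Lemma vev_vac : vev (fvac true A) = 1.
Proof. exact: (pliftE wick_rel). Qed.

(** A creation operator in front contracts with nothing to its right. *)
Lemma vev_creation (l : letter) x :
  l.2 < 0 \/ l.2 = 0 /\ l.1 \in pminus A -> vev (fmode l.1 l.2 x) = 0.
Proof.
move=> hl; move: x; apply: fock_ind => [|w].
  split=> [|k x y /= hx hy]; first by rewrite /= linear0; exact: linear_fun0 vev_linear.
  by rewrite /= fmode_linear vev_linear hx hy scaler0 addr0.
rewrite fmodeE; have -> : vev (fword true ((l.1, l.2) :: w)) = wick ((l.1, l.2) :: w).
  exact: (pliftE wick_rel).
rewrite /wick /=; elim: w (wick_op _) => //= y w IH F.
by rewrite IH mulr0 addr0 contraction_crel ?mul0r // -surjective_pairing.
Qed.

End Wick.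

(** * Occupation bases for systems of oscillators *)

(** A basis is given with its dual functionals, since independence is always
proved, and coordinates always computed, through them. *)
Definition coordinate_basis (K : fieldType) (V : lmodType K) (I : choiceType)
    (P : pred I) (b : I -> V) (f : I -> V -> K) : Prop :=
  [/\ forall i, linear (f i : V -> K^o),
      forall i j, P i -> P j -> f i (b j) = (i == j)%:R
    & lspan [set b i | i in [set i | P i]] = setT].

Section Oscillators.
Variables (K : numFieldType) (V : lmodType K) (s : bool).
Variables (c d : nat -> V -> V) (vac : V) (phi : V -> K).
Local Notation sgn := ((-1) ^+ s : K).
Hypotheses (c_lin : forall m, linear (c m)) (d_lin : forall m, linear (d m)).
Hypotheses (cC : forall i j x, c i (c j x) = sgn *: c j (c i x))
  (dC : forall i j x, d i (c j x) = sgn *: c j (d i x) + (i == j)%:R *: x).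
Hypothesis d_vac : forall i, d i vac = 0.
Hypotheses (phi_lin : linear (phi : V -> K^o)) (phi_vac : phi vac = 1)
  (phi_c : forall i x, phi (c i x) = 0).
Hypothesis osc_span : forall U : set V, subspace U -> U vac ->
  (forall i x, U x -> U (c i x)) -> (forall i x, U x -> U (d i x)) -> forall x, U x.

Let cZ i k x : c i (k *: x) = k *: c i x. Proof. exact: linear_funZ. Qed.
Let c0 i : c i 0 = 0. Proof. exact: linear_fun0. Qed.
Let d0 i : d i 0 = 0. Proof. exact: linear_fun0. Qed.
Let dZ i k x : d i (k *: x) = k *: d i x. Proof. exact: linear_funZ. Qed.

Lemma iterZ (f : V -> V) n k x : (forall k x, f (k *: x) = k *: f x) ->
  iter n f (k *: x) = k *: iter n f x.
Proof. by move=> fZ; elim: n => //= n ->. Qed.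

Lemma iter0 (f : V -> V) n : f 0 = 0 -> iter n f 0 = 0.
Proof. by move=> f0; elim: n => //= n ->. Qed.

Lemma c_iter i j n x : c i (iter n (c j) x) = sgn ^+ n *: iter n (c j) (c i x).
Proof.
elim: n => [|n IH] /=; first by rewrite scale1r.
by rewrite cC IH cZ scalerA exprS.
Qed.

Lemma d_iter_out i j n x :
  i != j -> d i (iter n (c j) x) = sgn ^+ n *: iter n (c j) (d i x).
Proof.
move=> /negPf ij; elim: n => [|n IH] /=; first by rewrite scale1r.
by rewrite dC ij scale0r addr0 IH cZ scalerA exprS.
Qed.

(** This is [n] for commuting and the parity of [n] for anticommuting oscillators. *)
Definition osc_coef (n : nat) : K := \sum_(i < n) sgn ^+ i.

Lemma osc_coefS n : osc_coef n.+1 = sgn * osc_coef n + 1.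
Proof.
rewrite /osc_coef big_ord_recl expr0 addrC mulr_sumr; congr (_ + _).
by apply: eq_bigr => i _; rewrite exprS.
Qed.

Lemma d_iter i n x : d i (iter n (c i) x)
  = osc_coef n *: iter n.-1 (c i) x + sgn ^+ n *: iter n (c i) (d i x).
Proof.
elim: n => [|n IH] /=; first by rewrite /osc_coef big_ord0 scale0r add0r scale1r.
rewrite dC eqxx scale1r IH (linear_funD _ _ (c_lin i)) !cZ scalerDr !scalerA.
rewrite -exprS addrAC osc_coefS scalerDl scale1r; congr (_ + _ + _).
by case: n {IH} => //=; rewrite /osc_coef big_ord0 mulr0 !scale0r.
Qed.

Definition mon (k : nat -> nat) (ms : seq nat) (x : V) : V :=
  foldr (fun m y => iter (k m) (c m) y) x ms.

Lemma mon_ext k k' ms x : {in ms, k =1 k'} -> mon k ms x = mon k' ms x.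
Proof.
elim: ms => //= m ms IH kk; rewrite kk ?mem_head // IH // => i ims.
by apply: kk; rewrite inE ims orbT.
Qed.

Lemma mon_cat k ms ms' x : mon k (ms ++ ms') x = mon k ms (mon k ms' x).
Proof. exact: foldr_cat. Qed.

Lemma mon0 k ms x : {in ms, forall i, k i = 0%N} -> mon k ms x = x.
Proof.
elim: ms => //= m ms IH kk; rewrite kk ?mem_head //= IH // => i ims.
by apply: kk; rewrite inE ims orbT.
Qed.

Lemma d_mon_out k ms m x : m \notin ms -> d m x = 0 -> d m (mon k ms x) = 0.
Proof.
move=> + dx; elim: ms => //= m' ms IH; rewrite inE negb_or => /andP[mm' mms].
by rewrite d_iter_out // IH // iter0 ?scaler0.
Qed.

Lemma c_mon k ms m : uniq ms -> m \in ms ->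
  exists e : K, c m (mon k ms vac) = e *: mon (fun i => k i + (i == m))%N ms vac.
Proof.
elim: ms => //= m' ms IH /andP[m'ms ums]; rewrite inE.
have [-> _|mm' /= mms] := eqVneq m m'.
  exists 1; rewrite scale1r addn1 /=; congr (c _ (iter _ _ _)).
  apply: mon_ext => i ims; case: eqP => [e|_]; last by rewrite addn0.
  by rewrite -e ims in m'ms.
have [e he] := IH ums mms; exists (sgn ^+ k m' * e).
rewrite c_iter he iterZ; last exact: cZ.
by rewrite scalerA addn0.
Qed.

Lemma d_mon k ms m : uniq ms -> m \in ms ->
  exists e : K, d m (mon k ms vac) = e *: mon (fun i => k i - (i == m))%N ms vac.
Proof.
elim: ms => //= m' ms IH /andP[m'ms ums]; rewrite inE.
have [-> _|mm' /= mms] := eqVneq m m'.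
  exists (osc_coef (k m')); rewrite d_iter (d_mon_out _ m'ms) // iter0 //.
  rewrite scaler0 addr0 subn1; congr (_ *: iter _ _ _).
  apply: mon_ext => i ims; case: eqP => [e|_]; last by rewrite subn0.
  by rewrite -e ims in m'ms.
have [e he] := IH ums mms; exists (sgn ^+ k m' * e).
rewrite d_iter_out // he iterZ; last exact: cZ.
by rewrite scalerA subn0.
Qed.

(** Pauli exclusion: anticommuting operators square to zero. *)
Lemma mon_exclusion k ms m x : s -> m \in ms -> (1 < k m)%N -> mon k ms x = 0.
Proof.
move=> hs + hk; elim: ms => //= m' ms IH; rewrite inE => /predU1P[<-|mms].
  case: (k m) hk => [|[|n]] // _; rewrite -add2n iterD /=.
  have cc y : c m (c m y) = 0.
    have := cC m m y; rewrite hs expr1 scaleN1r => /eqP.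
    by rewrite -addr_eq0 -mulr2n -scaler_nat scaler_eq0 pnatr_eq0 /= => /eqP.
  exact: cc.
by rewrite IH // iter0.
Qed.

(** Occupation numbers are finitely supported sequences of naturals, that is,
polynomials over the semiring of naturals. *)
Definition occ_valid : pred {poly nat} := fun k => s ==> all (fun j => j <= 1)%N k.

Definition osc_state (k : {poly nat}) : V :=
  mon (fun i => k`_i) (iota 0 (size k)) vac.

Lemma osc_state_mon N (k : {poly nat}) : (size k <= N)%N ->
  osc_state k = mon (fun i => k`_i) (iota 0 N) vac.
Proof.
move=> kN; rewrite -(subnKC kN) iotaD mon_cat [mon _ (iota (0 + _) _) _]mon0 //.
by move=> i; rewrite mem_iota => /andP[hi _]; rewrite nth_default.
Qed.

Lemma occ_validP (k : {poly nat}) i : occ_valid k -> s -> ((k`_i)%R <= 1)%N.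
Proof.
move=> /implyP h /h /allP h'; have [ki|ki] := ltnP i (size k).
  by apply: h'; apply: mem_nth.
by rewrite nth_default.
Qed.

Lemma mon_span f N :
  lspan [set osc_state k | k in [set k | occ_valid k]] (mon f (iota 0 N) vac).
Proof.
pose p : {poly nat} := \poly_(i < N) f i.
have pE : osc_state p = mon f (iota 0 N) vac.
  rewrite (@osc_state_mon N) ?size_poly //; apply: mon_ext => i.
  by rewrite mem_iota coef_poly /= add0n => ->.
have [pv|/negP] := boolP (occ_valid p).
  by rewrite -pE; apply: lspan_ext; exists p.
rewrite -pE /occ_valid => /negP; rewrite negb_imply => /andP[hs /allPn[j]].
case/(nthP 0) => i ip <-; rewrite -ltnNge => h.
rewrite /osc_state (@mon_exclusion _ _ i) ?mem_iota //.
exact: (lspan_subspace _).1.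
Qed.

(** The span of the occupied states contains the vacuum and is stable under all
creation and annihilation operators, because [c_mon] and [d_mon] map an occupied
state to a multiple of another. *)
Lemma osc_state_span :
  lspan [set osc_state k | k in [set k | occ_valid k]] = setT.
Proof.
rewrite -subTset => x _; set S := lspan _; have sS : subspace S := lspan_subspace _.
have pre (f : V -> V) : linear f ->
    (forall k, S (f (osc_state k))) -> forall y, S y -> S (f y).
  move=> fl fS y; apply: (lspan_min (U := [set y | S (f y)])).
    split=> [|a u v /= hu hv]; first by rewrite /= linear_fun0 //; exact: sS.1.
    by rewrite fl; apply: sS.2.
  by move=> _ [k _ <-]; apply: fS.
apply: osc_span x => //.
- have := mon_span (fun=> 0%N) 0; exact.
- move=> i; apply: pre => // k.
  rewrite (@osc_state_mon (maxn (size k) i.+1)) ?leq_maxl //.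
  have [||e ->] := @c_mon (fun i => k`_i) (iota 0 (maxn (size k) i.+1)) i.
  + exact: iota_uniq.
  + by rewrite mem_iota /= add0n leq_max ltnSn orbT.
  exact: (subspaceZ _ sS (mon_span _ _)).
- move=> i; apply: pre => // k.
  rewrite (@osc_state_mon (maxn (size k) i.+1)) ?leq_maxl //.
  have [||e ->] := @d_mon (fun i => k`_i) (iota 0 (maxn (size k) i.+1)) i.
  + exact: iota_uniq.
  + by rewrite mem_iota /= add0n leq_max ltnSn orbT.
  exact: (subspaceZ _ sS (mon_span _ _)).
Qed.

Definition dmon (k : nat -> nat) (ms : seq nat) (x : V) : V :=
  foldl (fun y m => iter (k m) (d m) y) x ms.

Lemma dmon_linear k ms : linear (dmon k ms).
Proof.
move=> a; elim: ms => //= m ms IH x y.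
rewrite -/(dmon k ms _) -IH; apply: (congr1 (dmon k ms)).
by elim: (k m) => //= n ->; rewrite d_lin.
Qed.

Lemma phi_dmon_c k ms m x : m \notin ms -> phi (dmon k ms (c m x)) = 0.
Proof.
elim: ms x => [|m' ms IH] x /=; first by rewrite phi_c.
rewrite inE negb_or => /andP[mm' mms].
suff -> : iter (k m') (d m') (c m x) = sgn ^+ k m' *: c m (iter (k m') (d m') x).
  rewrite (linear_funZ _ _ (dmon_linear _ _)) (linear_funZ _ _ phi_lin).
  by rewrite IH // scaler0.
elim: (k m') => [|n IHn] /=; first by rewrite scale1r.
by rewrite IHn dZ dC eq_sym (negPf mm') scale0r addr0 scalerA -exprSr.
Qed.

Lemma d_pow_c_pow j r m y : d m y = 0 ->
  iter j (d m) (iter (j + r) (c m) y)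
  = (\prod_(i < j) osc_coef (i + r).+1) *: iter r (c m) y.
Proof.
move=> dy; elim: j => [|j IH]; first by rewrite big_ord0 scale1r.
rewrite iterSr addSn d_iter dy iter0 // scaler0 addr0 iterZ //= IH scalerA.
by rewrite big_ord_recr mulrC.
Qed.

Definition mon_norm (k : nat -> nat) (ms : seq nat) : K :=
  \prod_(m <- ms) \prod_(i < k m) osc_coef i.+1.

(** Removing [k m] quanta from each mode [m] and testing against the vacuum
detects the occupation numbers [k]: with too few quanta present an annihilation
operator reaches [y], with too many a creation operator reaches [phi]. *)
Lemma mon_dual k k' ms y : uniq ms -> {in ms, forall m, d m y = 0} ->
  phi (dmon k ms (mon k' ms y))
  = if all (fun m => k m == k' m) ms then mon_norm k ms * phi y else 0.
Proof.
rewrite /mon_norm; elim: ms => [|m ms IH] /=; first by rewrite big_nil mul1r.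
move=> /andP[mms ums] dy.
have dz : d m (mon k' ms y) = 0 by apply: d_mon_out => //; apply: dy; rewrite mem_head.
have {}IH := IH ums (fun i ims => dy i (mem_behead (s := m :: ms) ims)).
have lZ a x : phi (dmon k ms (a *: x)) = a * phi (dmon k ms x).
  by rewrite (linear_funZ _ _ (dmon_linear _ _)) (linear_funZ _ _ phi_lin).
case: (ltngtP (k m) (k' m)) => h /=.
- rewrite -(subnKC h) addSnnS d_pow_c_pow // lZ /= phi_dmon_c //.
  by rewrite mulr0.
- have [r ->] : exists r, k m = (r.+1 + k' m)%N.
    by exists (k m - k' m).-1; rewrite -subnS addSnnS subnK.
  have e := @d_pow_c_pow (k' m) 0 m _ dz; rewrite addn0 in e.
  by rewrite iterD e iterSr dZ dz scaler0 iter0 // -(scale0r 0) lZ mul0r.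
- have e := @d_pow_c_pow (k m) 0 m _ dz; rewrite addn0 in e.
  rewrite -h e lZ IH big_cons; case: ifP => _; last by rewrite mulr0.
  by rewrite mulrA; congr (_ * _ * _); apply: eq_bigr => i _; rewrite addn0.
Qed.

Lemma phi_mon_eq0 k ms m : m \in ms -> k m != 0%N -> phi (mon k ms vac) = 0.
Proof.
move=> + km; elim: ms => //= m' ms IH; rewrite inE => /predU1P[<-|/IH h].
  by case: (k m) km => //= n _; rewrite phi_c.
by case: (k m') => [|n] //=; rewrite phi_c.
Qed.

(** In characteristic zero, and with occupations at most 1 in the anticommuting
case, no factor [osc_coef i.+1] vanishes. *)
Lemma mon_norm_neq0 (k : {poly nat}) ms :
  occ_valid k -> mon_norm (fun i => k`_i) ms != 0.
Proof.
move=> kv; rewrite /mon_norm prodf_seq_neq0; apply/allP => m _ /=.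
apply/prodf_neq0 => i _.
rewrite /osc_coef; case: (boolP s) => [hs|/negPf hs].
  have := occ_validP m kv hs; have := ltn_ord i; case: (nat_of_ord i) => [_ _|n].
    by rewrite big_ord1 expr0 oner_neq0.
  by case: k`_m => [|[]].
under eq_bigr do rewrite expr0 expr1n.
by rewrite sumr_const card_ord pnatr_eq0.
Qed.

Definition osc_coord (k : {poly nat}) (x : V) : K :=
  (mon_norm (fun i => k`_i) (iota 0 (size k)))^-1
  * phi (dmon (fun i => k`_i) (iota 0 (size k)) x).

Lemma osc_coord_dual k k' : occ_valid k -> osc_coord k (osc_state k') = (k == k')%:R.
Proof.
move=> kv; rewrite /osc_coord.
have [k'k|kk'] := leqP (size k') (size k).
  rewrite (osc_state_mon k'k) mon_dual ?iota_uniq // phi_vac mulr1.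
  case: ifP => [/allP h|h].
    suff <- : k = k' by rewrite eqxx mulVf // mon_norm_neq0.
    apply/polyP => i; have [ik|ik] := ltnP i (size k).
      by apply/eqP/h; rewrite mem_iota.
    by rewrite !nth_default // (leq_trans k'k).
  case: eqP => [e|_]; last by rewrite mulr0.
  by rewrite -e in h; move/allPn: (negbT h) => [m _ /eqP].
rewrite /osc_state -(subnKC (ltnW kk')) iotaD mon_cat.
rewrite mon_dual ?iota_uniq //; last first.
  move=> m; rewrite mem_iota add0n => /andP[_ mk]; apply: d_mon_out => //.
  by rewrite mem_iota leqNgt mk.
rewrite (@phi_mon_eq0 _ _ (size k').-1).
- rewrite mulr0 if_same mulr0; case: eqP => // e.
  by rewrite e ltnn in kk'.
- rewrite mem_iota add0n subnKC ?(ltnW kk') //.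
  by case: (size k') kk' => // n; rewrite ltnS /= => -> /=.
- have k'0 : k' != 0 by rewrite -size_poly_gt0 (leq_ltn_trans _ kk').
  by rewrite -[_`_ _]/(lead_coef k') lead_coef_eq0.
Qed.

Lemma osc_basis : coordinate_basis occ_valid osc_state osc_coord.
Proof.
split=> [k a x y|k k' kv _|]; [|exact: osc_coord_dual|exact: osc_state_span].
by rewrite /osc_coord dmon_linear phi_lin mulrDr mulrCA.
Qed.

Lemma osc_state_ind (P : V -> Prop) :
  P vac -> (forall i x, P x -> P (c i x)) -> forall k, P (osc_state k).
Proof.
move=> P0 Pc k; rewrite /osc_state; elim: (iota _ _) => //= m ms IH.
by elim: k`_m => //= n; apply: Pc.
Qed.

(** Charge and energy are of this kind; the next lemma serves the group elements. *)
Lemma osc_state_additive (O : V -> V) (o0 : K) (o : nat -> K) :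
  O vac = o0 *: vac -> (forall i x, O (c i x) = c i (O x) + o i *: c i x) ->
  forall k, O (osc_state k) = (o0 + \sum_(i < size k) o i *+ (k`_i)%R) *: osc_state k.
Proof.
move=> O0 Oc k; rewrite /osc_state -(big_mkord predT (fun i => o i *+ (k`_i)%R)).
rewrite /index_iota subn0; elim: (iota _ _) => [|m ms IH] /=.
  by rewrite big_nil addr0.
rewrite big_cons addrCA.
elim: (k`_m)%R => [|n IHn] /=; first by rewrite mulr0n add0r IH.
rewrite Oc IHn cZ -scalerDl mulrS; congr (_ *: _).
by rewrite [LHS]addrC !addrA.
Qed.

Lemma osc_state_multiplicative (O : V -> V) (l : nat -> K) :
  (forall k x, O (k *: x) = k *: O x) ->
  O vac = vac -> (forall i x, O (c i x) = l i *: c i (O x)) ->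
  forall k, O (osc_state k) = (\prod_(i < size k) l i ^+ (k`_i)%R) *: osc_state k.
Proof.
move=> OZ O0 Oc k; rewrite /osc_state -(big_mkord predT (fun i => l i ^+ (k`_i)%R)).
rewrite /index_iota subn0; elim: (iota _ _) => [|m ms IH] /=.
  by rewrite big_nil scale1r.
rewrite big_cons; elim: (k`_m)%R => [|n IHn] /=; first by rewrite expr0 mul1r IH.
by rewrite Oc IHn cZ scalerA exprS mulrA.
Qed.

End Oscillators.

(** * Two cases of the Borcherds identity *)

Lemma fsum_nat (V : zmodType) (F : nat -> V) N :
  (forall j, (N <= j)%N -> F j = 0) -> \sum_(j \in [set: nat]) F j = \sum_(j < N) F j.
Proof.
move=> FN; rewrite fsbig_ord; apply/esym/fsbig_widen => //.
by move=> j [_ /= /negP]; rewrite -leqNgt => /FN.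
Qed.

Lemma gbinom0 (K : fieldType) (x : K) : gbinom x 0 = 1.
Proof. by rewrite /gbinom big_ord0 divr1. Qed.

Lemma gbinom1 (K : fieldType) (x : K) : gbinom x 1 = x.
Proof. by rewrite /gbinom big_ord1 subr0 divr1. Qed.

Lemma gbinomN1 (K : numFieldType) j : (-1) ^+ j * gbinom (-1 : K) j = 1.
Proof.
rewrite /gbinom; suff -> : \prod_(i < j) (-1 - i%:R : K) = (-1) ^+ j * (j`!)%:R.
  by rewrite -mulrA divff ?mulr1 -?exprMn ?mulrNN ?mulr1 ?expr1n // pnatr_eq0 -lt0n fact_gt0.
elim: j => [|j IH]; first by rewrite big_ord0 mul1r.
by rewrite big_ord_recr IH factS natrM exprS -natr1 /=; ring.
Qed.

Lemma gbinomN2 (K : numFieldType) j : (-1) ^+ j * gbinom (-2 : K) j = (j.+1)%:R.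
Proof.
rewrite /gbinom; suff -> : \prod_(i < j) (-2 - i%:R : K) = (-1) ^+ j * (j.+1`!)%:R.
  rewrite factS natrM -mulrA mulfK; last by rewrite pnatr_eq0 -lt0n fact_gt0.
  by rewrite mulrA -exprMn mulrNN mulr1 expr1n mul1r.
elim: j => [|j IH]; first by rewrite big_ord0 mul1r.
by rewrite big_ord_recr IH [(j.+2)`!]factS natrM exprS -!natr1 /=; ring.
Qed.

Section Borcherds.
Variables (K : numFieldType) (V M : lmodType K).
Variables (par deg : bool -> set V) (YV : modes V V) (YM : modes V M).
Hypotheses (J : jacobi par deg YV YM) (YM_bil : bilinear_modes YM).
Variables (vac : V) (p : bool) (u v : V) (k : K) (a b : int -> M -> M) (m : M) (N : nat).
Hypotheses (YM_vac : forall r x, YM vac r x = if r == -1 then x else 0).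
Hypotheses (pu : par p u) (pv : par p v) (du : deg true u) (dv : deg true v).
Hypotheses (YMu : forall n x, YM u (n%:~R - 1 / 2) x = a n x)
  (YMv : forall n x, YM v (n%:~R - 1 / 2) x = b n x).
Hypotheses (YVuv0 : YV u 0 v = k *: vac) (YVuv : forall j : nat, YV u (j.+1)%:R v = 0).
Hypotheses (aN : forall n : int, N%:Z <= n -> a n m = 0)
  (bN : forall n : int, N%:Z <= n -> b n m = 0).
Local Notation sgn := ((-1) ^+ p : K).

Let YM0l r x : YM 0 r x = 0.
Proof. exact: (linear_fun0 (YM_bil.1 r x)). Qed.

Let YM0r w r : YM w r 0 = 0.
Proof. exact: (linear_fun0 (YM_bil.2 w r)). Qed.

Let YMZ c w r x : YM (c *: w) r x = c *: YM w r x.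
Proof. exact: (linear_funZ c w (YM_bil.1 r x)). Qed.

Let half_exp (n : int) : exponent true (n%:~R + 1 / 2 : rat).
Proof. by rewrite /exponent /= mul1r addrK; exact: intr_int. Qed.

Let YMu' r n x : r = n%:~R - 1 / 2 -> YM u r x = a n x.
Proof. by move=> ->. Qed.
Let YMv' r n x : r = n%:~R - 1 / 2 -> YM v r x = b n x.
Proof. by move=> ->. Qed.

Let ratr_half : ratr (1 / 2) = 1 / 2 :> K.
Proof. by rewrite fmorph_div rmorph1 rmorph_nat. Qed.

Let a0 n : a n 0 = 0. Proof. by rewrite -YMu YM0r. Qed.
Let b0 n : b n 0 = 0. Proof. by rewrite -YMv YM0r. Qed.

(** The Borcherds identity at [-1].  The only non-negative product of [u] and [v]
is the zeroth, so its left side consists of the mode of [u_(-1) v] and of the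
vacuum term, whose coefficient is the binomial of 1/2 over 1. *)
Lemma borcherdsN1 : YM (YV u (-1) v) 0 m
  = \sum_(j < N) (a (- j%:Z) (b j%:Z m) + sgn *: b (- (1 + j%:Z)) (a (1 + j%:Z) m))
    - (k / 2) *: m.
Proof.
have := J m (-1) pu du pv dv (half_exp 0) (half_exp (-1)).
rewrite (@fsum_nat _ _ 2); last first.
  move=> [|[|j]] // _; rewrite (_ : (-1)%:~R + _ = j.+1%:R); last first.
    by rewrite -[j.+2%:R]natr1 mulrN1z addrC addrK.
  by rewrite YVuv YM0l scaler0.
rewrite 2!big_ord_recl big_ord0 addr0 /= /bump /= gbinom0 gbinom1 scale1r.
rewrite mulrN1z !addr0 !mulr0z !add0r addNr YVuv0 YMZ YM_vac.
rewrite (_ : _ == -1); last by apply/eqP; field.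
rewrite (_ : _ + (-1 + _) = 0); last by field.
rewrite scalerA => e.
have {}e := canRL (addrK _) e; rewrite e (@fsum_nat _ _ N).
  congr (_ - _ *: _); last by rewrite ratr_half mulrC mul1r.
  apply: eq_bigr => j _; rewrite mulrN1z gbinomN1 scale1r.
  rewrite (@YMu' _ (- j%:Z)); last by rewrite mulrNz; field.
  rewrite (@YMv' _ j%:Z); last by field.
  rewrite (@YMv' _ (- (1 + j%:Z))); last by rewrite mulrNz intrD; field.
  rewrite (@YMu' _ (1 + j%:Z)); last by rewrite intrD; field.
  by rewrite andbb exprN1 invrN invr1 mulrN1 scaleNr opprK.
move=> j jN; rewrite (@YMv' (-1 + 1 / 2 + j%:R) j%:Z); last by field.
rewrite (@YMu' (1 / 2 + j%:R) (1 + j%:Z)); last by rewrite intrD; field.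
by rewrite bN ?aN ?YM0r ?scaler0 ?subr0 ?scaler0 // ler_wpDl.
Qed.

(** The Borcherds identity at [-2].  Its left side has one more term, the mode of
[u_(-1) v] with coefficient 1/2, and the vacuum term now carries the binomial of
1/2 over 2, which is -1/8. *)
Lemma borcherdsN2 : YM (YV u (-2) v) 1 m
  = \sum_(j < N) (j.+1)%:R *: (a (- (1 + j%:Z)) (b (1 + j%:Z) m)
                               - sgn *: b (- (1 + j%:Z)) (a (1 + j%:Z) m))
    - 2^-1 *: YM (YV u (-1) v) 0 m + (k / 8%:R) *: m.
Proof.
have := J m (-2) pu du pv dv (half_exp 0) (half_exp 0).
rewrite !mulr0z !add0r (@fsum_nat _ _ 3); last first.
  move=> [|[|[|j]]] // _; rewrite (_ : (-2)%:~R + _ = j.+1%:R); last first.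
    by rewrite -[j.+3%:R]natr1 -[j.+2%:R]natr1 -addrA addrC; ring.
  by rewrite YVuv YM0l scaler0.
rewrite 3!big_ord_recl big_ord0 addr0 /= /bump /= gbinom0 gbinom1 scale1r.
rewrite (_ : gbinom _ 2 = - (8%:R)^-1); last first.
  rewrite /gbinom 2!big_ord_recl big_ord0 /= /bump /= ratr_half.
  by rewrite -[2`!]/2%N; field.
rewrite (_ : (-2)%:~R + (1 + 0)%:R = -1 :> rat); last by apply/eqP.
rewrite (_ : (-2)%:~R + (1 + (1 + 0))%:R = 0 :> rat); last by apply/eqP.
rewrite (_ : 1 / 2 + 1 / 2 - 0 = 1 :> rat); last by apply/eqP.
rewrite (_ : 1 / 2 + 1 / 2 - (1 + 0)%:R = 0 :> rat); last by apply/eqP.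
rewrite (_ : 1 / 2 + 1 / 2 - (1 + (1 + 0))%:R = -1 :> rat); last by apply/eqP.
rewrite (_ : (-2)%:~R = -2 :> rat); last by apply/eqP.
rewrite addr0 ratr_half div1r YVuv0 YMZ YM_vac eqxx scalerA => e.
have {}e := canRL (addrK _) e; rewrite {}e (@fsum_nat _ _ N).
  rewrite mulNr scaleNr [8^-1 * k]mulrC opprB [LHS]addrA [LHS]addrAC.
  congr (_ - _ + _).
  apply: eq_bigr => j _; rewrite gbinomN2.
  rewrite (@YMu' _ (- (1 + j%:Z))); last by rewrite mulrNz intrD; field.
  rewrite (@YMv' _ (1 + j%:Z)); last by rewrite intrD; field.
  rewrite (@YMv' _ (- (1 + j%:Z))); last by rewrite mulrNz intrD; field.
  rewrite (@YMu' _ (1 + j%:Z)); last by rewrite intrD; field.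
  rewrite andbb (_ : (-1) ^ (-2) = ((-1) ^+ 2)^-1 :> K) //.
  by rewrite sqrrN expr1n invr1 mulr1.
move=> j jN; rewrite (@YMv' (1 / 2 + j%:R) (1 + j%:Z)); last by rewrite intrD; field.
rewrite (@YMu' (1 / 2 + j%:R) (1 + j%:Z)); last by rewrite intrD; field.
by rewrite bN ?aN ?YM0r ?scaler0 ?subr0 ?scaler0 // ler_wpDl.
Qed.

End Borcherds.

(** * Commutators of normally ordered quadratic operators *)

Section CurrentOperators.
Variables (K : numFieldType) (s : bool) (A : polspace K s) (M : lmodType K).
Variables (fm : A -> int -> M -> M) (vac : M).
Local Notation sgn := ((-1) ^+ s : K).
Hypotheses (fm_lin : forall a n, linear (fm a n))
  (fm_lina : forall k a b n x, fm (k *: a + b) n x = k *: fm a n x + fm b n x).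
Hypothesis fmC : forall a m b n x, fm a m (fm b n x)
  = sgn *: fm b n (fm a m x) + (if m + n == 0 then pform A a b else 0) *: x.
Hypothesis fm_vac : forall a n, 0 < n \/ n = 0 /\ a \in pplus A -> fm a n vac = 0.
Variables (n : nat) (ap am : n.-tuple A).
Hypothesis duals : dual_bases ap am.
Local Notation u i := (tnth ap i).
Local Notation w i := (tnth am i).

Let sgn2 : sgn * sgn = 1. Proof. by rewrite -expr2 sqrr_sign. Qed.

Let fmZ a m k x : fm a m (k *: x) = k *: fm a m x. Proof. exact: linear_funZ. Qed.
Let fmD a m x y : fm a m (x + y) = fm a m x + fm a m y.
Proof. exact: linear_funD. Qed.
Let fm0 a m : fm a m 0 = 0. Proof. exact: linear_fun0. Qed.
Let fmS a m (I : Type) (r : seq I) (P : pred I) (F : I -> M) :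
  fm a m (\sum_(i <- r | P i) F i) = \sum_(i <- r | P i) fm a m (F i).
Proof. exact: linear_fun_sum. Qed.

(** These are the normally ordered expressions of J(0) and, below, of L(0), cut off
at [N].  On a vector killed by all modes of index at least [N] the omitted terms
vanish. *)
Definition charge_op (N : nat) (x : M) : M := \sum_(i < n) \sum_(j < N)
  (fm (u i) (- j%:Z) (fm (w i) j%:Z x)
   + sgn *: fm (w i) (- (1 + j%:Z)) (fm (u i) (1 + j%:Z) x)).

Definition energy_op (N : nat) (x : M) : M := \sum_(i < n) \sum_(j < N)
  (j.+1)%:R *: (fm (u i) (- (1 + j%:Z)) (fm (w i) (1 + j%:Z) x)
                - sgn *: fm (w i) (- (1 + j%:Z)) (fm (u i) (1 + j%:Z) x)).

Let ind (m m' : int) : K := (m == m')%:R.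

Lemma fm_delta (m m' : int) k y x :
  (if m == m' then k else 0) *: fm y m' x = (ind m m' * k) *: fm y m x.
Proof. by rewrite /ind; case: eqP => [->|_]; rewrite ?mul1r // mul0r !scale0r. Qed.

(** Moving a mode past a pair of modes exchanges it twice, so that the signs cancel
and an ordinary commutator remains. *)
Lemma normal_comm a b p c m x : fm a (- p) (fm b p (fm c m x))
  = fm c m (fm a (- p) (fm b p x))
    + ((ind m p * (sgn * pform A a c)) *: fm b m x
       + (ind m (- p) * pform A b c) *: fm a m x).
Proof.
rewrite (fmC b) fm_lin fmZ (fmC a) scalerDr !scalerA sgn2 scale1r -addrA.
congr (_ + _); rewrite -!fm_delta; congr (_ *: _ + _ *: _).
  rewrite (_ : (- p + m == 0) = (m == p)); last by rewrite addrC subr_eq0.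
  by case: ifP; rewrite ?mulr0.
by rewrite (_ : (p + m == 0) = (m == - p)) // addrC addr_eq0.
Qed.

Lemma sum_delta N k (F : nat -> K) : (k < N)%N ->
  \sum_(j < N) (j == k :> nat)%:R * F j = F k.
Proof.
move=> kN; rewrite (bigD1 (Ordinal kN)) //= eqxx mul1r big1 ?addr0 // => j.
by rewrite -val_eqE /= => /negPf ->; rewrite mul0r.
Qed.

(** Every integer is exactly one of the [- j] and [1 + j] with [0 <= j], so that each
mode is met by exactly one term of the normally ordered sum. *)
Lemma charge_indicator (m : int) N : (`|m| < N)%N ->
  \sum_(j < N) (ind m (- j%:Z) + ind m (1 + j%:Z)) = 1.
Proof.
rewrite /ind; case: m => [[|k]|k] /= kN.
- rewrite -[RHS](@sum_delta N 0 (fun=> 1)) //; apply: eq_bigr => j _.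
  rewrite addr0 mulr1.
  by congr (_%:R); apply/eqP/eqP; lia.
- rewrite -[RHS](@sum_delta N k (fun=> 1)); last by move: kN; lia.
  apply: eq_bigr => j _.
  rewrite (_ : (k.+1%:Z == - j%:Z) = false) ?add0r ?mulr1; last by apply/eqP; lia.
  by congr (_%:R); apply/eqP/eqP; lia.
- rewrite -[RHS](@sum_delta N k.+1 (fun=> 1)) //; apply: eq_bigr => j _.
  rewrite addr0 mulr1.
  by congr (_%:R); apply/eqP/eqP; lia.
Qed.

Lemma energy_indicator (m : int) N : m <= 0 -> (`|m| < N)%N ->
  \sum_(j < N) ind m (- (1 + j%:Z)) * (j.+1)%:R = (- m)%:~R.
Proof.
rewrite /ind; case: m => [[|//]|k] _ kN.
  rewrite big1 // => j _.
  have /negPf -> : 0%:Z != - (1 + j%:Z) by rewrite eq_sym oppr_eq0; lia.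
  by rewrite mul0r.
rewrite (_ : (- Negz k)%:~R = k.+1%:R :> K) //.
rewrite -[RHS](@sum_delta N k (fun j => j.+1%:R)); last by move: kN => /=; lia.
apply: eq_bigr => j _; congr (_%:R * _).
by apply/eqP/eqP; lia.
Qed.

Let fm_sum (I : finType) (F : I -> A) m x :
  fm (\sum_i F i) m x = \sum_i fm (F i) m x.
Proof.
by apply: (@linear_fun_sum K A M (fun a => fm a m x)) => k a b; apply: fm_lina.
Qed.

Let fm_comb k a k' b m x :
  fm (k *: a + k' *: b) m x = k *: fm a m x + k' *: fm b m x.
Proof.
rewrite fm_lina; congr (_ + _).
by apply: (@linear_funZ K A M (fun a => fm a m x)) => l c d; apply: fm_lina.
Qed.

Lemma charge_op_comm N c m x : (`|m| < N)%N ->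
  charge_op N (fm c m x) = fm c m (charge_op N x)
   + fm (\sum_(i < n) (pform A (w i) c *: u i + (sgn * pform A (u i) c) *: w i)) m x.
Proof.
move=> mN; rewrite /charge_op fmS fm_sum -big_split /=.
apply: eq_bigr => i _; rewrite fmS fm_comb.
have mN' : (`|(- m)%R| < N)%N by rewrite abszN.
have e1 y : pform A (w i) c *: y
    = \sum_(j < N) ((ind m (- j%:Z) + ind m (1 + j%:Z)) * pform A (w i) c) *: y.
  by rewrite -scaler_suml -mulr_suml charge_indicator // mul1r.
have e2 y : (sgn * pform A (u i) c) *: y
    = \sum_(j < N) ((ind (- m) (- j%:Z) + ind (- m) (1 + j%:Z)) * (sgn * pform A (u i) c)) *: y.
  by rewrite -scaler_suml -mulr_suml charge_indicator // mul1r.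
rewrite e1 e2 -!big_split /=; apply: eq_bigr => j _.
rewrite !normal_comm fmD fmZ.
have iN k : ind (- m) k = ind m (- k) by rewrite /ind eqr_oppLR.
rewrite !iN !opprK !mulrDl !scalerDl !scalerDr !scalerA.
rewrite (_ : sgn * (ind m (1 + j%:Z) * (sgn * pform A (w i) c))
  = ind m (1 + j%:Z) * pform A (w i) c); last by ring: sgn2.
rewrite (_ : sgn * (ind m (- (1 + j%:Z)) * pform A (u i) c)
  = ind m (- (1 + j%:Z)) * (sgn * pform A (u i) c)); last by ring.
rewrite addrACA; congr (_ + _).
rewrite [X in X + _]addrC addrACA [X in _ + X]addrC.
by congr (_ + _); rewrite addrC.
Qed.

Lemma energy_op_comm N c m x : m <= 0 -> (`|m| < N)%N ->
  energy_op N (fm c m x) = fm c m (energy_op N x) + (- m)%:~R *: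
   fm (\sum_(i < n) (pform A (w i) c *: u i + (- (sgn * pform A (u i) c)) *: w i)) m x.
Proof.
move=> m0 mN; rewrite /energy_op fmS fm_sum scaler_sumr -big_split /=.
apply: eq_bigr => i _; rewrite fmS fm_comb -(energy_indicator m0 mN).
rewrite scaler_suml -big_split /=; apply: eq_bigr => j _.
have i0 : ind m (1 + j%:Z) = 0 by rewrite /ind (_ : (_ == _) = false) //; apply/eqP; lia.
rewrite !normal_comm -!scaleNr fmZ fmD fmZ i0 !mul0r !scale0r !add0r.
rewrite !scalerDr !scalerA addrACA; congr (_ + _).
by congr (_ *: _ + _ *: _); rewrite /GRing.scale /=; ring.
Qed.

(** A vector of [pplus A] is seen by one half of each dual pair only; the signs
of charge and energy agree on this half and differ on the other. *)
Lemma dual_expand_plus c : c \in pplus A ->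
  \sum_(i < n) (pform A (w i) c *: u i + (sgn * pform A (u i) c) *: w i) = c
  /\ \sum_(i < n) (pform A (w i) c *: u i + (- (sgn * pform A (u i) c)) *: w i) = c.
Proof.
case: duals => bp _ wu _ cp.
have e : \sum_(i < n) pform A (w i) c *: u i = c.
  rewrite {2}(coord_basis bp cp); apply: eq_bigr => i _; congr (_ *: _).
    rewrite {1}(coord_basis bp cp) linear_sumr (bigD1 i) //= big1 ?addr0 => [|j ji].
      by rewrite linearZr /= -tnth_nth wu eqxx mulr1.
    by rewrite linearZr /= -tnth_nth wu eq_sym (negPf ji) mulr0.
  by rewrite -tnth_nth.
have u0 i : pform A (u i) c = 0.
  by apply: pplus_isotropic => //; apply: (basis_mem bp); apply: mem_tnth.
split; rewrite -[RHS]e; apply: eq_bigr => i _.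
  by rewrite u0 mulr0 scale0r addr0.
by rewrite u0 mulr0 oppr0 scale0r addr0.
Qed.

Lemma dual_expand_minus c : c \in pminus A ->
  \sum_(i < n) (pform A (w i) c *: u i + (sgn * pform A (u i) c) *: w i) = - c
  /\ \sum_(i < n) (pform A (w i) c *: u i + (- (sgn * pform A (u i) c)) *: w i) = c.
Proof.
case: duals => _ bm _ uw cm.
have e : \sum_(i < n) (- (sgn * pform A (u i) c)) *: w i = c.
  rewrite {2}(coord_basis bm cm); apply: eq_bigr => i _; congr (_ *: _).
    rewrite {1}(coord_basis bm cm) linear_sumr (bigD1 i) //= big1 ?addr0 => [|j ji].
      by rewrite linearZr /= -tnth_nth uw eqxx mulr1; ring: sgn2.
    by rewrite linearZr /= -tnth_nth uw eq_sym (negPf ji) !mulr0.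
  by rewrite -tnth_nth.
have w0 i : pform A (w i) c = 0.
  by apply: pminus_isotropic => //; apply: (basis_mem bm); apply: mem_tnth.
split; rewrite -[in RHS]e -?sumrN; apply: eq_bigr => i _.
  by rewrite w0 scale0r add0r scaleNr opprK.
by rewrite w0 scale0r add0r.
Qed.

Let u_plus i : u i \in pplus A.
Proof. by case: duals => bp _ _ _; apply: (basis_mem bp); apply: mem_tnth. Qed.

Lemma charge_op_vac N : (0 < N)%N -> charge_op N vac = - (sgn * n%:R) *: vac.
Proof.
case: N => // N _; rewrite /charge_op.
rewrite (eq_bigr (fun=> (- sgn) *: vac)) => [|i _].
  by rewrite sumr_const card_ord -scaler_nat scalerA mulrN mulrC.
rewrite big_ord_recl big1 ?addr0 => [|j _] /=.
  rewrite oppr0 fmC (@fm_vac _ 0); last by right.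
  rewrite (@fm_vac _ (1 + 0)); last by left.
  rewrite addr0 eqxx !fm0 !scaler0 add0r addr0.
  by case: duals => _ _ _ ->; rewrite eqxx mulr1.
rewrite (@fm_vac (w i)); last by left.
rewrite (@fm_vac (u i)); last by left.
by rewrite !fm0 scaler0 addr0.
Qed.

Lemma energy_op_vac N : energy_op N vac = 0.
Proof.
rewrite /energy_op big1 // => i _; rewrite big1 // => j _.
rewrite !fm_vac; try by left.
by rewrite !fm0 scaler0 subr0 scaler0.
Qed.

(** The Virasoro element contains each dual pair in both orders.  The charges [P i]
that the two orders produce cancel, while the scalars add up. *)
Lemma energy_combine N x (P : 'I_n -> M) :
  2^-1 *: \sum_(i < n)
    ((\sum_(j < N) (j.+1)%:R *: (fm (u i) (- (1 + j%:Z)) (fm (w i) (1 + j%:Z) x)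
         - sgn *: fm (w i) (- (1 + j%:Z)) (fm (u i) (1 + j%:Z) x))
      - 2^-1 *: P i + (- sgn / 8%:R) *: x)
    - sgn *: (\sum_(j < N) (j.+1)%:R *: (fm (w i) (- (1 + j%:Z)) (fm (u i) (1 + j%:Z) x)
         - sgn *: fm (u i) (- (1 + j%:Z)) (fm (w i) (1 + j%:Z) x))
      - 2^-1 *: (sgn *: P i) + (1 / 8%:R) *: x))
  = energy_op N x + (- (sgn * n%:R / 8%:R)) *: x.
Proof.
have -> : (- (sgn * n%:R / 8%:R)) *: x = \sum_(i < n) (- sgn / 8%:R) *: x.
  by rewrite sumr_const card_ord scalerMnl -mulr_natr; congr (_ *: _); ring.
rewrite /energy_op scaler_sumr -big_split /=; apply: eq_bigr => i _.
set S := \sum_(j < N) _; set S' := \sum_(j < N) _.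
have -> : S' = - sgn *: S.
  rewrite /S /S' scaler_sumr; apply: eq_bigr => j _.
  rewrite scalerA mulrC -scalerA; congr (_ *: _).
  by rewrite scalerBr scalerA mulNr sgn2 scaleN1r opprK scaleNr addrC.
move: (P i) S => y z.
have -> : sgn *: (- sgn *: z - 2^-1 *: (sgn *: y) + (1 / 8%:R) *: x)
    = - z - 2^-1 *: y + (sgn / 8%:R) *: x.
  rewrite scalerDr scalerBr !scalerA mulrN sgn2 scaleN1r mulrAC sgn2.
  by rewrite !mul1r.
rewrite !opprD !opprK addrACA [z - _ + _]addrACA addNr addr0 -mulr2n -scalerBl.
rewrite scalerDr scalerA (_ : 2^-1 *: (z *+ 2) = z); last first.
  by rewrite -[z *+ 2]scaler_nat scalerA mulVf ?pnatr_eq0 // scale1r.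
by congr (_ + _ *: _); field.
Qed.

Section Stable.
Hypothesis fm_trunc : forall x, exists N : nat,
  forall a (m : int), N%:Z <= m -> fm a m x = 0.

(** The operator [J] agrees on each vector with a truncation [O N], where [N]
depends on the vector; an [N] that serves both [x] and [fm c m x] transfers the
commutation rule to [J]. *)
Lemma current_comm (J : M -> M) (O : nat -> M -> M) (k : K) (c c' : A) (m : int) x :
  (forall (N : nat) x, (forall a (m : int), N%:Z <= m -> fm a m x = 0) ->
     J x = O N x + k *: x) ->
  (forall N x, (`|m| < N)%N -> O N (fm c m x) = fm c m (O N x) + fm c' m x) ->
  J (fm c m x) = fm c m (J x) + fm c' m x.
Proof.
move=> JO Oc; have [N1 h1] := fm_trunc x; have [N2 h2] := fm_trunc (fm c m x).
pose N := (maxn (maxn N1 N2) `|m|.+1)%N.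
have N1N : N1%:Z <= N by rewrite lez_nat /N; lia.
have N2N : N2%:Z <= N by rewrite lez_nat /N; lia.
rewrite (JO N) => [|a p h]; last by apply: h2; apply: le_trans h.
rewrite (JO N) => [|a p h]; last by apply: h1; apply: le_trans h.
rewrite Oc; last by rewrite /N; lia.
by rewrite fmD fmZ addrAC.
Qed.

End Stable.

End CurrentOperators.

(** * The operators J(0) and L(0) on a twisted Fock module *)

Section FockOperators.
Variables (K : numFieldType) (s : bool) (A : polspace K s).
Local Notation sgn := ((-1) ^+ s : K).
Local Notation V := (@fock false K s A).
Local Notation M := (@fock true K s A).

Lemma fmode_commute (a : A) m (b : A) n (x : M) : fmode a m (fmode b n x)
  = sgn *: fmode b n (fmode a m x) + (if m + n == 0 then pform A a b else 0) *: x.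
Proof. by rewrite (@fmodeC true K s A (a, m) (b, n)) lform_tw. Qed.

Lemma fmode_kill (a : A) (n : int) : 0 < n \/ n = 0 /\ a \in pplus A ->
  fmode a n (fvac true A) = 0.
Proof.
move=> h; apply: (@fmode_vac true K s A (a, n)).
by rewrite /annihilator freq_tw ltr0z; case: h => [|[-> ?]]; [left | right].
Qed.

(** A mode of large index can be moved through a word to the vacuum, since it
commutes, up to sign, with all the letters. *)
Lemma fmode_trunc (x : M) : exists N : nat,
  forall (a : A) (m : int), N%:Z <= m -> fmode a m x = 0.
Proof.
move: x; apply: fock_ind => [|w].
  split=> [|k x y /= [N1 h1] [N2 h2]].
    by exists 0%N => a m _; exact: linear_fun0 (fmode_linear _ _).
  exists (maxn N1 N2) => a m hm; rewrite fmode_linear h1 ?h2 ?scaler0 ?addr0 //.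
    by apply: le_trans hm; rewrite lez_nat leq_maxr.
  by apply: le_trans hm; rewrite lez_nat leq_maxl.
elim: w => [|[b n] w [N IH]].
  exists 1%N => a m hm; apply: fmode_kill; left; exact: lt_le_trans hm.
exists (maxn N `|n|.+1)%N => a m hm; rewrite -fmodeE fmode_commute IH; last first.
  by apply: le_trans hm; rewrite lez_nat leq_maxl.
rewrite (linear_fun0 (fmode_linear _ _)) scaler0 add0r.
have /negPf -> : m + n != 0.
  have : `|n|.+1%:Z <= m by apply: le_trans hm; rewrite lez_nat leq_maxr.
  by case: n {hm} => n; lia.
by rewrite scale0r.
Qed.

Lemma fgen_pos (a b : A) (j : nat) :
  fmode a j.+1%:Z (fgen b) = 0 /\ fmode a 0 (fgen b) = pform A a b *: fvac false A.
Proof.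
have fr (n : int) : freq false n + freq false (-1) = n%:~R.
  by rewrite /freq mulrN1z; field.
split; rewrite /fgen fmodeE (@fword_commute false K s A [::] [::]) /=.
  rewrite (@fword_annihilate _ _ _ _ [:: (b, -1)] (a, j.+1%:Z)); last first.
    by left; rewrite /freq /= ltr_pwDr // ler0z.
  by rewrite /Defs.lform /= fr intr_eq0 /= scaler0 scale0r addr0.
rewrite (@fword_annihilate _ _ _ _ [:: (b, -1)] (a, 0)); last first.
  by left; rewrite /freq /= add0r.
by rewrite scaler0 add0r; congr (_ *: _).
Qed.

Lemma fword_swap (a b : A) (m n : int) : m < 0 -> n < 0 ->
  fword false [:: (a, m); (b, n)] = sgn *: fword false [:: (b, n); (a, m)].
Proof.
move=> m0 n0; rewrite (@fword_commute false K s A [::] [::]) /=.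
rewrite /Defs.lform /= (_ : (_ == 0) = false) ?scale0r ?addr0 //.
rewrite /freq addrACA -intrD; apply/negP => /eqP h.
have : (m + n)%:~R = -1%:~R :> rat by apply/eqP; rewrite -subr_eq0 opprK -h; apply/eqP; field.
by rewrite -mulrNz => /intr_inj; lia.
Qed.

Variables (Y : modes V V) (Yt : modes V M).
Hypotheses (hY : is_fock_sva Y) (hYt : is_fock_twisted Y Yt).

Let fgen_par (a : A) : fpar s (fgen a).
Proof.
apply: lspan_ext; exists [:: (a, -1)] => //=.
by rewrite andbT eqxx.
Qed.

Let fgen_deg (a : A) : Defs.fdeg true (fgen a).
Proof. by apply: lspan_ext; exists [:: (a, -1)]. Qed.

Let Yt_bil : bilinear_modes Yt. Proof. by case: hYt.1 => -[]. Qed.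
Let Yt_jac : jacobi (@fpar false K s A) (@Defs.fdeg false K s A) Y Yt.
Proof. by case: hYt.1 => _ _ _ _ []. Qed.
Let Yt_vac r x : Yt (fvac false A) r x = if r == -1 then x else 0.
Proof. by case: hYt.1 => _ _ _ _ []. Qed.

Let YE (a : A) (n : int) r x : r = n%:~R -> Y (fgen a) r x = fmode a n x.
Proof. by move=> ->; exact: hY.2. Qed.

Let fgen0 (a b : A) : Y (fgen a) 0 (fgen b) = pform A a b *: fvac false A.
Proof. by rewrite (@YE a 0) // (fgen_pos a b 0).2. Qed.

Let fgenS (a b : A) (j : nat) : Y (fgen a) j.+1%:R (fgen b) = 0.
Proof. by rewrite (@YE a j.+1%:Z) // (fgen_pos a b j).1. Qed.

Let Ytg (a : A) n x : Yt (fgen a) (n%:~R - 1 / 2) x = fmode a n x.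
Proof. exact: hYt.2. Qed.

Lemma twisted_pairN1 (a b : A) N x : (forall a (m : int), N%:Z <= m -> fmode a m x = 0) ->
  Yt (fword false [:: (a, -1); (b, -1)]) 0 x
  = \sum_(j < N) (fmode a (- j%:Z) (fmode b j%:Z x)
      + sgn *: fmode b (- (1 + j%:Z)) (fmode a (1 + j%:Z) x)) - (pform A a b / 2) *: x.
Proof.
move=> hN; rewrite -(fmodeE false a (-1) [:: (b, -1)]) -(@YE _ _ (-1)) ?mulrN1z //.
exact: (borcherdsN1 Yt_jac Yt_bil Yt_vac (fgen_par a) (fgen_par b) (fgen_deg a)
  (fgen_deg b) (Ytg a) (Ytg b) (fgen0 a b) (fgenS a b) (hN a) (hN b)).
Qed.

Lemma twisted_pairN2 (a b : A) N x : (forall a (m : int), N%:Z <= m -> fmode a m x = 0) ->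
  Yt (fword false [:: (a, -2); (b, -1)]) 1 x
  = \sum_(j < N) j.+1%:R *: (fmode a (- (1 + j%:Z)) (fmode b (1 + j%:Z) x)
      - sgn *: fmode b (- (1 + j%:Z)) (fmode a (1 + j%:Z) x))
    - 2^-1 *: Yt (fword false [:: (a, -1); (b, -1)]) 0 x + (pform A a b / 8%:R) *: x.
Proof.
move=> hN; rewrite -(fmodeE false a (-1) [:: (b, -1)]) -(@YE _ _ (-1)) ?mulrN1z //.
rewrite -(fmodeE false a (-2) [:: (b, -1)]) -(@YE _ _ (-2)) //.
exact: (borcherdsN2 Yt_jac Yt_bil Yt_vac (fgen_par a) (fgen_par b) (fgen_deg a)
  (fgen_deg b) (Ytg a) (Ytg b) (fgen0 a b) (fgenS a b) (hN a) (hN b)).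
Qed.

Variables (n : nat) (ap am : n.-tuple A).
Hypothesis duals : dual_bases ap am.
Local Notation mode := (fun a n => @fmode true K s A a n).

Let pf_uw i : pform A (tnth ap i) (tnth am i) = - sgn.
Proof. by case: duals => _ _ _ ->; rewrite eqxx mulr1. Qed.
Let pf_wu i : pform A (tnth am i) (tnth ap i) = 1.
Proof. by case: duals => _ _ -> _; rewrite eqxx. Qed.

(** The correction is minus half the sum of the pairings of [ap] with [am]. *)
Lemma twisted_charge N x : (forall a (m : int), N%:Z <= m -> fmode a m x = 0) ->
  Yt (jmath ap am) 0 x = charge_op mode ap am N x + (sgn * n%:R / 2) *: x.
Proof.
move=> hN; rewrite /jmath (linear_fun_sum _ _ _ (Yt_bil.1 0 x)).
rewrite (eq_bigr _ (fun i _ => twisted_pairN1 _ _ hN)) big_split /=.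
congr (_ + _); rewrite (eq_bigr (fun=> (sgn / 2) *: x)) => [|i _].
  by rewrite sumr_const card_ord scalerMnl -mulr_natr; congr (_ *: _); ring.
by rewrite pf_uw -scaleNr mulNr opprK.
Qed.

Lemma twisted_energy N x : (forall a (m : int), N%:Z <= m -> fmode a m x = 0) ->
  Yt (omega ap am) 1 x = energy_op mode ap am N x + (- (sgn * n%:R / 8%:R)) *: x.
Proof.
move=> hN; rewrite /omega (linear_funZ _ _ (Yt_bil.1 1 x)).
rewrite (linear_fun_sum _ _ _ (Yt_bil.1 1 x)).
rewrite -(energy_combine mode ap am N x (fun i =>
  Yt (fword false [:: (tnth ap i, -1); (tnth am i, -1)]) 0 x)).
congr (_ *: _); apply: eq_bigr => i _.
rewrite (@fword_swap (tnth ap i) (tnth am i) (-1) (-2)) //.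
pose f := fword false [:: (tnth am i, -2); (tnth ap i, -1)].
pose f' := fword false [:: (tnth ap i, -1); (tnth am i, -1)].
have e z : Yt (z - sgn *: f) 1 x = Yt z 1 x - sgn *: Yt f 1 x.
  rewrite (linear_funD z (- (sgn *: f)) (Yt_bil.1 1 x)) -!scaleNr.
  by rewrite (linear_funZ (- sgn) f (Yt_bil.1 1 x)).
have e' : Yt (sgn *: f') 0 x = sgn *: Yt f' 0 x.
  by rewrite (linear_funZ sgn f' (Yt_bil.1 0 x)).
have e1 := twisted_pairN2 (tnth ap i) (tnth am i) hN.
have e2 := twisted_pairN2 (tnth am i) (tnth ap i) hN.
have e3 := congr1 (fun v => Yt v 0 x) (@fword_swap (tnth am i) (tnth ap i) (-1) (-1) isT isT).
rewrite pf_uw in e1; rewrite pf_wu in e2.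
apply: etrans (e _) _; apply: (congr2 (fun y z => y - sgn *: z)); first exact: e1.
exact: (etrans e2 (congr1 (fun v => _ - 2^-1 *: v + _) (etrans e3 e'))).
Qed.

Let mode_lin (a : A) (m : int) : linear (mode a m). Proof. exact: fmode_linear. Qed.
Let mode_lina k (a b : A) (m : int) x :
  mode (k *: a + b) m x = k *: mode a m x + mode b m x.
Proof. exact: fmode_lineara. Qed.
Let modeZ k (a : A) (m : int) x : mode (k *: a) m x = k *: mode a m x.
Proof.
by apply: (@linear_funZ K A M (fun a => mode a m x)) => l c d; apply: mode_lina.
Qed.

Lemma twisted_charge_plus c m x : c \in pplus A ->
  Yt (jmath ap am) 0 (mode c m x) = mode c m (Yt (jmath ap am) 0 x) + mode c m x.
Proof.
move=> cp; apply: (current_comm mode_lin fmode_trunc _ (@twisted_charge)) => N y mN.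
have := charge_op_comm mode_lin mode_lina fmode_commute ap am c y mN.
by rewrite (dual_expand_plus duals cp).1.
Qed.

Lemma twisted_charge_minus c m x : c \in pminus A ->
  Yt (jmath ap am) 0 (mode c m x) = mode c m (Yt (jmath ap am) 0 x) - mode c m x.
Proof.
move=> cm; rewrite -[- mode c m x]scaleN1r -modeZ scaleN1r.
apply: (current_comm mode_lin fmode_trunc _ (@twisted_charge)) => N y mN.
have := charge_op_comm mode_lin mode_lina fmode_commute ap am c y mN.
by rewrite (dual_expand_minus duals cm).1.
Qed.

Lemma twisted_energy_comm c m x : c \in pplus A \/ c \in pminus A -> m <= 0 ->
  Yt (omega ap am) 1 (mode c m x)
  = mode c m (Yt (omega ap am) 1 x) + (- m)%:~R *: mode c m x.
Proof.
move=> hc m0; rewrite -modeZ.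
apply: (current_comm mode_lin fmode_trunc _ (@twisted_energy)) => N y mN.
have := energy_op_comm mode_lin mode_lina fmode_commute ap am c y m0 mN.
case: hc => h; [rewrite (dual_expand_plus duals h).2 | rewrite (dual_expand_minus duals h).2].
  by move=> e; apply: etrans e _; apply: (congr1 (GRing.add _)); exact/esym/modeZ.
by move=> e; apply: etrans e _; apply: (congr1 (GRing.add _)); exact/esym/modeZ.
Qed.

Lemma vac_trunc (a : A) (m : int) : 1%:Z <= m -> mode a m (fvac true A) = 0.
Proof. by move=> h; apply: fmode_kill; left; exact: lt_le_trans h. Qed.

Lemma twisted_charge_vac :
  Yt (jmath ap am) 0 (fvac true A) = (- (sgn * n%:R / 2)) *: fvac true A.
Proof.
apply: etrans (twisted_charge vac_trunc) _.
have := charge_op_vac mode_lin fmode_commute fmode_kill duals (ltn0Sn 0).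
move=> e; apply: etrans (congr1 (fun z => z + _) e) _; rewrite -scalerDl.
by apply: (congr1 (fun z => z *: _)); field.
Qed.

Lemma twisted_energy_vac :
  Yt (omega ap am) 1 (fvac true A) = (- (sgn * n%:R / 8%:R)) *: fvac true A.
Proof.
apply: etrans (twisted_energy vac_trunc) _.
have := energy_op_vac mode_lin fmode_kill ap am 1.
by move=> e; apply: etrans (congr1 (fun z => z + _) e) _; rewrite add0r.
Qed.

End FockOperators.

(** * Enumeration of the creation operators *)

Section CreationModes.
Variables (K : numFieldType) (s : bool) (A : polspace K s) (M : lmodType K).
Variables (fm : A -> int -> M -> M) (vac : M).
Local Notation sgn := ((-1) ^+ s : K).
Hypotheses (fm_lin : forall a n, linear (fm a n))
  (fm_lina : forall k a b n x, fm (k *: a + b) n x = k *: fm a n x + fm b n x).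
Hypothesis fmC : forall a m b n x, fm a m (fm b n x)
  = sgn *: fm b n (fm a m x) + (if m + n == 0 then pform A a b else 0) *: x.
Hypothesis fm_vac : forall a n, 0 < n \/ n = 0 /\ a \in pplus A -> fm a n vac = 0.
Hypothesis fm_span : forall U : set M, subspace U -> U vac ->
  (forall a n x, U x -> U (fm a n x)) -> forall x, U x.
Variable phi : M -> K.
Hypotheses (phi_lin : linear (phi : M -> K^o)) (phi_vac : phi vac = 1).
Hypothesis phi_c : forall a m x, m < 0 \/ m = 0 /\ a \in pminus A -> phi (fm a m x) = 0.
Variables (n : nat) (ap am : n.-tuple A).
Hypothesis duals : dual_bases ap am.

(** The creation operators are enumerated level by level, those of level [k]
being [am_r(-k)] followed by [ap_r(-k-1)], so that the zero mode [am_0(0)]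
comes first. *)
Definition creation (i : nat) : A * int :=
  if (i %% n.*2 < n)%N then (am`_(i %% n.*2), - (i %/ n.*2)%:Z)
  else (ap`_(i %% n.*2 - n), - (i %/ n.*2).+1%:Z).

(** The factor [- sgn] makes the pairing with [creation i] equal to 1 in both
symmetry types. *)
Definition annihilation (i : nat) : A * int :=
  if (i %% n.*2 < n)%N then (- sgn *: ap`_(i %% n.*2), (i %/ n.*2)%:Z)
  else (am`_(i %% n.*2 - n), (i %/ n.*2).+1%:Z).

Definition cre i : M -> M := fm (creation i).1 (creation i).2.
Definition ann i : M -> M := fm (annihilation i).1 (annihilation i).2.

Let sgn2 : sgn * sgn = 1. Proof. by rewrite -expr2 sqrr_sign. Qed.

Let ap_plus r : ap`_r \in pplus A.
Proof.
have [h|h] := ltnP r (size ap); last by rewrite nth_default // mem0v.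
by case: duals => bp _ _ _; apply: (basis_mem bp); apply: mem_nth.
Qed.

Let am_minus r : am`_r \in pminus A.
Proof.
have [h|h] := ltnP r (size am); last by rewrite nth_default // mem0v.
by case: duals => _ bm _ _; apply: (basis_mem bm); apply: mem_nth.
Qed.

Let am_ap r r' : (r < n)%N -> (r' < n)%N -> pform A am`_r ap`_r' = (r == r')%:R.
Proof.
move=> rn rn'; case: duals => _ _ h _; have := h (Ordinal rn) (Ordinal rn').
by rewrite !(tnth_nth 0) -val_eqE.
Qed.

Let ap_am r r' : (r < n)%N -> (r' < n)%N ->
  pform A ap`_r am`_r' = - sgn * (r == r')%:R.
Proof.
move=> rn rn'; case: duals => _ _ _ h; have := h (Ordinal rn) (Ordinal rn').
by rewrite !(tnth_nth 0) -val_eqE.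
Qed.

Let mod_lt i : (0 < n)%N -> ~~ (i %% n.*2 < n)%N -> (i %% n.*2 - n < n)%N.
Proof.
move=> n0; rewrite -leqNgt => h; rewrite ltn_subLR // addnn ltn_mod.
by rewrite double_gt0.
Qed.

Let mode_eq i j : (i == j) = ((i %/ n.*2 == j %/ n.*2) && (i %% n.*2 == j %% n.*2))%N.
Proof.
apply/eqP/andP => [->//|[/eqP h /eqP h']].
by rewrite (divn_eq i n.*2) h h' -divn_eq.
Qed.

Lemma cre_linear i : linear (cre i). Proof. exact: fm_lin. Qed.
Lemma ann_linear i : linear (ann i). Proof. exact: fm_lin. Qed.

Lemma creationP i : (creation i).2 < 0
  \/ (creation i).2 = 0 /\ (creation i).1 \in pminus A.
Proof.
rewrite /creation; case: ifP => _ /=; last by left.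
by case: (_ %/ _)%N => [|k]; [right | left].
Qed.

Lemma creC i j x : cre i (cre j x) = sgn *: cre j (cre i x).
Proof.
rewrite /cre fmC; suff -> : (if (creation i).2 + (creation j).2 == 0
    then pform A (creation i).1 (creation j).1 else 0) = 0 by rewrite scale0r addr0.
case: (creationP i) (creationP j) => [hi|[-> hi]] [hj|[-> hj]].
- by rewrite lt_eqF //; lia.
- by rewrite addr0 lt_eqF.
- by rewrite add0r lt_eqF.
- by rewrite eqxx; apply: pminus_isotropic.
Qed.

Lemma annC (n0 : (0 < n)%N) i j x :
  ann i (cre j x) = sgn *: cre j (ann i x) + (i == j)%:R *: x.
Proof.
rewrite /ann /cre fmC; congr (_ + _ *: _).
rewrite /annihilation /creation mode_eq.
case: (boolP (i %% _ < n)%N) => hi; case: (boolP (j %% _ < n)%N) => hj /=.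
- rewrite linearZl_LR /= ap_am //= subr_eq0 eqz_nat mulrA mulNr mulrN opprK sgn2 mul1r.
  by case: eqP.
- rewrite linearZl_LR /= (pplus_isotropic (ap_plus _) (ap_plus _)) mulr0 if_same.
  have /negPf -> : (i %% n.*2)%N != (j %% n.*2)%N by apply/eqP => h; rewrite -h hi in hj.
  by rewrite andbF.
- rewrite (pminus_isotropic (am_minus _) (am_minus _)) if_same.
  have /negPf -> : (i %% n.*2)%N != (j %% n.*2)%N by apply/eqP => h; rewrite h hj in hi.
  by rewrite andbF.
- rewrite am_ap ?mod_lt // subr_eq0 eqz_nat eqSS.
  move: hi hj; set p := (i %% _)%N; set q := (j %% _)%N; rewrite -!leqNgt => hi hj.
  rewrite (_ : (p - n == q - n)%N = (p == q)); last by rewrite -(eqn_add2r n) !subnK.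
  by case: ((i %/ _)%N == _).
Qed.

Lemma ann_vac i : ann i vac = 0.
Proof.
rewrite /ann /annihilation; case: ifP => _ /=; apply: fm_vac; last by left.
case: (_ %/ _)%N => [|k]; [right | by left].
by split=> //; apply: memvZ.
Qed.

Lemma phi_cre i x : phi (cre i x) = 0.
Proof.
by rewrite /cre; apply: phi_c; exact: creationP.
Qed.

(** Every mode is a linear combination of creation and annihilation operators,
because [ap] and [am] together span the whole space. *)
Lemma mode_span (U : set M) : subspace U -> U vac ->
  (forall i x, U x -> U (cre i x)) -> (forall i x, U x -> U (ann i x)) -> forall x, U x.
Proof.
move=> sU Uv Uc Ua; apply: fm_span => // a m x Ux.
have fmS (I : finType) (F : I -> A) : fm (\sum_i F i) m x = \sum_i fm (F i) m x.
  by apply: (@linear_fun_sum K A M (fun a => fm a m x)) => k b c; apply: fm_lina.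
have fmZa k b : fm (k *: b) m x = k *: fm b m x.
  by apply: (@linear_funZ K A M (fun a => fm a m x)) => l c d; apply: fm_lina.
have fmDa b c : fm (b + c) m x = fm b m x + fm c m x.
  by rewrite -{1}[b]scale1r fm_lina scale1r.
have [bp bm _ _] := duals.
rewrite -(subrK (polproj a) a) addrC fmDa (coord_basis bm (polproj_minus a)).
rewrite (coord_basis bp (polproj_plus a)) !fmS.
apply: subspaceD => //; apply: subspace_sum => // r _; rewrite fmZa; apply: subspaceZ => //.
- have rn := ltn_ord r.
  have [m0|m0] := ltP m 0.
    have := Uc (`|m|.-1 * n.*2 + (n + r))%N x Ux.
    have lt : (n + r < n.*2)%N by rewrite -addnn ltn_add2l.
    rewrite /cre /creation modnMDl modn_small // divnMDl; last by lia.
    rewrite divn_small // ltnNge leq_addr /= addKn addn0.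
    by rewrite (_ : - (_.+1)%:Z = m) //; lia.
  have := Ua (`|m| * n.*2 + r)%N x Ux.
  have lt : (r < n.*2)%N by lia.
  rewrite /ann /annihilation modnMDl modn_small // divnMDl; last by lia.
  rewrite divn_small // rn /= addn0 (_ : `|m|%:Z = m) ?fmZa; last by lia.
  by move=> /(subspaceZ (- sgn) sU); rewrite scalerA mulrNN sgn2 scale1r.
- have rn := ltn_ord r.
  have [m0|m0] := leP m 0.
    have := Uc (`|m| * n.*2 + r)%N x Ux.
    have lt : (r < n.*2)%N by lia.
    rewrite /cre /creation modnMDl modn_small // divnMDl; last by lia.
    rewrite divn_small // rn /= addn0.
    by rewrite (_ : - `|m|%:Z = m) //; lia.
  have := Ua (`|m|.-1 * n.*2 + (n + r))%N x Ux.
  have lt : (n + r < n.*2)%N by rewrite -addnn ltn_add2l.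
  rewrite /ann /annihilation modnMDl modn_small // divnMDl; last by lia.
  rewrite divn_small // ltnNge leq_addr /= addKn addn0.
  by rewrite (_ : (_.+1)%:Z = m) //; lia.
Qed.

Definition fock_state : {poly nat} -> M := osc_state cre vac.
Definition fock_coord : {poly nat} -> M -> K := osc_coord s ann phi.

Lemma fock_basis (n0 : (0 < n)%N) :
  coordinate_basis (occ_valid s) fock_state fock_coord.
Proof.
exact: (osc_basis cre_linear ann_linear creC (annC n0) ann_vac phi_lin phi_vac
  phi_cre mode_span).
Qed.

Definition mode_charge (i : nat) : K := if (i %% n.*2 < n)%N then -1 else 1.
Definition mode_level (i : nat) : nat :=
  if (i %% n.*2 < n)%N then (i %/ n.*2)%N else (i %/ n.*2).+1.
Definition mode_eigen (lam : 'I_n -> K) (i : nat) : K :=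
  if (i %% n.*2 < n)%N then [seq (lam j)^-1 | j <- enum 'I_n]`_(i %% n.*2)
  else [seq lam j | j <- enum 'I_n]`_(i %% n.*2 - n).

End CreationModes.

(** * Occupied states as joint eigenvectors *)

Section FockBasis.
Variables (K : numFieldType) (s : bool) (A : polspace K s).
Local Notation sgn := ((-1) ^+ s : K).
Local Notation V := (@fock false K s A).
Local Notation M := (@fock true K s A).
Local Notation mode := (fun a n => @fmode true K s A a n).
Variables (n : nat) (up um : n.-tuple A).
Hypotheses (n0 : (0 < n)%N) (duals : dual_bases up um).

Definition tw_state : {poly nat} -> M := fock_state mode (fvac true A) up um.
Definition tw_coord : {poly nat} -> M -> K := fock_coord mode (@vev K s A) up um.

Let mode_lin (a : A) (m : int) : linear (mode a m). Proof. exact: fmode_linear. Qed.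
Let mode_lina k (a b : A) (m : int) x :
  mode (k *: a + b) m x = k *: mode a m x + mode b m x.
Proof. exact: fmode_lineara. Qed.

Let mode_span (U : set M) : subspace U -> U (fvac true A) ->
  (forall a m x, U x -> U (mode a m x)) -> forall x, U x.
Proof.
move=> sU Uv Um; apply: fock_ind => // w.
by elim: w => [|[a m] w IH] //; rewrite -fmodeE; apply: Um.
Qed.

Let vev_cre (a : A) (m : int) x : m < 0 \/ m = 0 /\ a \in pminus A -> vev (mode a m x) = 0.
Proof. by move=> h; apply: (@vev_creation K s A (a, m)). Qed.

Lemma tw_basis : coordinate_basis (occ_valid s) tw_state tw_coord.
Proof.
exact: (fock_basis mode_lin mode_lina (@fmode_commute K s A) (@fmode_kill K s A)
  mode_span (@vev_linear K s A) (@vev_vac K s A) vev_cre duals n0).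
Qed.

Let c_lin i : linear (cre mode up um i). Proof. exact: cre_linear. Qed.

Lemma tw_state_par k : exists e, fpar e (tw_state k).
Proof.
apply: (osc_state_ind (P := fun x => exists e, fpar e x)).
  exists false; apply: lspan_ext; exists [::] => //=.
  by rewrite andbF.
move=> i x [e hx]; exists (s (+) e); move: x hx.
apply: lspan_min => [|_ [w /= /eqP hw <-]].
  split=> [|k0 x y /= hx hy]; first by rewrite /= (linear_fun0 (c_lin i)); exact: (lspan_subspace _).1.
  by rewrite (c_lin i k0 x y); apply: (lspan_subspace _).2.
rewrite /= /cre fmodeE; apply: lspan_ext; exists (((creation up um i).1, (creation up um i).2) :: w) => //=.
have bb (b c : bool) : b && ~~ c = b (+) (b && c) by case: b c => -[].
by rewrite -hw bb.
Qed.

Section Twisted.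
Variables (Y : modes V V) (Yt : modes V M).
Hypotheses (hY : is_fock_sva Y) (hYt : is_fock_twisted Y Yt).
Variables (ap am : n.-tuple A).
Hypothesis duals0 : dual_bases ap am.

Let up_plus r : up`_r \in pplus A.
Proof.
have [h|h] := ltnP r (size up); last by rewrite nth_default // mem0v.
by case: duals => bp _ _ _; apply: (basis_mem bp); apply: mem_nth.
Qed.

Let um_minus r : um`_r \in pminus A.
Proof.
have [h|h] := ltnP r (size um); last by rewrite nth_default // mem0v.
by case: duals => _ bm _ _; apply: (basis_mem bm); apply: mem_nth.
Qed.

Lemma tw_state_charge k : Yt (jmath ap am) 0 (tw_state k)
  = (- (sgn * n%:R / 2) + \sum_(i < size k) mode_charge K n i *+ (k`_i)%R) *: tw_state k.
Proof.
apply: (osc_state_additive c_lin (twisted_charge_vac hY hYt duals0)) => i x.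
rewrite /cre /creation /mode_charge; case: ifP => _.
  by rewrite scaleN1r; apply: (twisted_charge_minus hY hYt duals0); apply: um_minus.
by rewrite scale1r; apply: (twisted_charge_plus hY hYt duals0); apply: up_plus.
Qed.

Lemma tw_state_energy k : Yt (omega ap am) 1 (tw_state k)
  = (- (sgn * n%:R / 8%:R) + \sum_(i < size k) (mode_level n i)%:R *+ (k`_i)%R)
    *: tw_state k.
Proof.
apply: (osc_state_additive c_lin (o := fun i => (mode_level n i)%:R)
  (twisted_energy_vac hY hYt duals0)) => i x.
rewrite /cre /creation /mode_level; case: ifP => _.
  have := twisted_energy_comm hY hYt duals0 x (or_intror (um_minus (i %% n.*2)%N)).
  by move=> /(_ (- (i %/ n.*2)%:Z)); rewrite opprK; apply; rewrite oppr_le0.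
have := twisted_energy_comm hY hYt duals0 x (or_introl (up_plus (i %% n.*2 - n)%N)).
by move=> /(_ (- ((i %/ n.*2).+1)%:Z)); rewrite opprK; apply; rewrite oppr_le0.
Qed.

End Twisted.

Section Eigen.
Variables (g : {linear A -> A}) (lam : 'I_n -> K).
Hypotheses (gform : forall x y, pform A (g x) (g y) = pform A x y)
  (gplus : forall x, x \in pplus A -> g x \in pplus A).
Hypotheses (gup : forall j, g (tnth up j) = lam j *: tnth up j)
  (gum : forall j, g (tnth um j) = (lam j)^-1 *: tnth um j).

Lemma tw_state_fact k : fact g (tw_state k)
  = (\prod_(i < size k) mode_eigen lam i ^+ (k`_i)%R) *: tw_state k.
Proof.
have fl := fact_linear (tw := true) gform gplus.
apply: (osc_state_multiplicative c_lin (O := @fact true K s A g)).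
- by move=> c x; apply: linear_funZ.
- exact: fact_vac.
move=> i x; rewrite /cre fact_fmode // /creation /mode_eigen.
have modeZ c (a : A) (m : int) y : mode (c *: a) m y = c *: mode a m y.
  by apply: (@linear_funZ K A M (fun a => mode a m y)) => l b d; apply: mode_lina.
have nm r (F : 'I_n -> K) (rn : (r < n)%N) : [seq F j | j <- enum 'I_n]`_r = F (Ordinal rn).
  by rewrite (nth_map (Ordinal rn)) ?size_enum_ord //; congr F; apply: val_inj; rewrite /= nth_enum_ord.
case: (boolP (i %% n.*2 < n)%N) => h /=.
  have e := gum (Ordinal h); rewrite (tnth_nth 0) /= in e.
  rewrite (nm _ (fun j => (lam j)^-1) h) e; exact: modeZ.
have h' : (i %% n.*2 - n < n)%N.
  by rewrite -leqNgt in h; rewrite ltn_subLR // addnn ltn_mod double_gt0.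
have e := gup (Ordinal h'); rewrite (tnth_nth 0) /= in e.
rewrite (nm _ lam h') e; exact: modeZ.
Qed.

End Eigen.
End FockBasis.

(** * Tensor products, diagonal operators and graded traces *)

Section TensorBasis.
Variables (K : fieldType) (V W : lmodType K) (I J : choiceType).
Variables (P : pred I) (b : I -> V) (f : I -> V -> K).
Variables (Q : pred J) (c : J -> W) (g : J -> W -> K).
Hypotheses (bf : coordinate_basis P b f) (cg : coordinate_basis Q c g).

Definition tens_state (p : (I * J)%type) : tens V W := b p.1 ⊗ c p.2.
Definition tens_coord (p : (I * J)%type) (t : tens V W) : K :=
  tlift (U := K^o) (fun v w => f p.1 v * g p.2 w) t.

Lemma tens_basis : coordinate_basis (fun p => P p.1 && Q p.2) tens_state tens_coord.
Proof.
have [fl fb bs] := bf; have [gl gc cs] := cg.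
have l1 p (w : W) : linear (fun v => f p.1 v * g p.2 w : K^o).
  by move=> k x y; rewrite fl mulrDl /GRing.scale /= mulrA.
have l2 p (v : V) : linear (fun w => f p.1 v * g p.2 w : K^o).
  by move=> k x y; rewrite gl mulrDr /GRing.scale /= mulrCA.
split=> [p|p q /andP[p1 p2] /andP[q1 q2]|].
- exact: tlift_linear (l1 p) (l2 p).
- rewrite /tens_coord /tens_state (tlift_pure (l1 p) (l2 p)) fb // gc //.
  by rewrite -natrM mulnb -xpair_eqE -!surjective_pairing.
rewrite -subTset => t _; move: t.
set S := lspan _; have sS : subspace S := lspan_subspace _.
have pre (X : lmodType K) (h : X -> tens V W) (B : set X) :
    linear h -> (forall x, B x -> S (h x)) -> lspan B = setT -> forall x, S (h x).
  move=> hl hB BT x; have : lspan B x by rewrite BT.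
  apply: (lspan_min (U := [set x | S (h x)])) => //.
  split=> [|k y z /= hy hz]; first by rewrite /= (linear_fun0 hl); exact: sS.1.
  by rewrite hl; apply: sS.2.
apply: presented_ind => // -[v w]; move: v.
apply: (pre V (fun v => v ⊗ w) _ _ _ bs) => [|_ [i Pi <-]]; first exact: tpure_linearl.
move: w; apply: (pre W (fun w => b i ⊗ w) _ _ _ cs) => [|_ [j Qj <-]].
  exact: tpure_linearr.
by apply: lspan_ext; exists (i, j) => //; rewrite /= Pi Qj.
Qed.

End TensorBasis.

Section DiagonalTrace.
Variables (R : realType) (W : lmodType R[i]) (I : choiceType).
Local Notation C := R[i].
Variables (P : pred I) (b : I -> W) (f : I -> W -> C).
Hypothesis bf : coordinate_basis P b f.

Let f_lin i : linear (f i : W -> C^o). Proof. by case: bf. Qed.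
Let f_b i j : P i -> P j -> f i (b j) = (i == j)%:R. Proof. by case: bf => _ h _; apply: h. Qed.

Lemma basis_expand w : exists2 s : {fset I}, {in s, forall i, P i} &
  forall s' : {fset I}, {in s', forall i, P i} -> (s `<=` s')%fset ->
    w = \sum_(i <- s') f i w *: b i.
Proof.
have : lspan [set b i | i in [set i | P i]] w by case: bf => _ _ ->.
apply: (lspan_min (U := [set w | exists2 s : {fset I}, {in s, forall i, P i} &
  forall s' : {fset I}, {in s', forall i, P i} -> (s `<=` s')%fset ->
    w = \sum_(i <- s') f i w *: b i])).
  split=> [|k x y /= [s1 P1 h1] [s2 P2 h2]].
    exists fset0 => [i|s' _ _]; first by rewrite in_fset0.
    by rewrite big1 // => i _; rewrite (linear_fun0 (f_lin i)) scale0r.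
  exists (s1 `|` s2)%fset => [i|s' Ps'].
    by rewrite in_fsetU => /orP[/P1|/P2].
  rewrite fsubUset => /andP[s1s s2s].
  rewrite {1}(h1 _ Ps' s1s) {1}(h2 _ Ps' s2s) scaler_sumr -big_split /=.
  by apply: eq_bigr => i _; rewrite f_lin scalerDl scalerA.
move=> _ [i Pi <-]; exists [fset i]%fset => [j|s' Ps' is'].
  by rewrite in_fset1 => /eqP ->.
have {}is' : i \in s' by rewrite -fsub1set.
rewrite (bigD1_seq i) ?fset_uniq //= f_b // eqxx scale1r big_seq_cond big1 ?addr0 //.
by move=> j /andP[js ji]; rewrite f_b ?Ps' // (negPf ji) scale0r.
Qed.

(** The vector [w] need not be an eigenvector: the coordinate functional itself is
an eigenvector of the transpose of [O]. *)
Lemma coord_diag (O : W -> W) (o : I -> C) : linear O ->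
  (forall i, P i -> O (b i) = o i *: b i) ->
  forall i w, P i -> f i (O w) = o i * f i w.
Proof.
move=> Ol Ob i w Pi; have [s Ps hs] := basis_expand w.
have -> : f i (O w) = f i (O (\sum_(j <- (i |` s)%fset) f j w *: b j)).
  rewrite -hs ?fsubsetU1 // => j; rewrite in_fset1U => /predU1P[->//|/Ps //].
rewrite (linear_fun_sum _ _ _ Ol) (linear_fun_sum _ _ _ (f_lin i)).
rewrite (bigD1_seq i) ?fset_uniq ?fset1U1 //= big_seq_cond big1 ?addr0.
  rewrite (linear_funZ _ _ Ol) Ob // !(linear_funZ _ _ (f_lin i)) f_b // eqxx.
  by rewrite /GRing.scale /= mulr1 mulrC.
move=> j /andP[]; rewrite in_fset1U => js ji.
have Pj : P j by case/predU1P: js => [->//|/Ps].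
rewrite (linear_funZ _ _ Ol) Ob // !(linear_funZ _ _ (f_lin i)) f_b //.
by rewrite eq_sym (negPf ji) !scaler0.
Qed.

Variables (J L T : W -> W) (jw lw t : I -> C).
Hypotheses (J_lin : linear J) (L_lin : linear L).
Hypotheses (Jb : forall i, P i -> J (b i) = jw i *: b i)
  (Lb : forall i, P i -> L (b i) = lw i *: b i)
  (Tb : forall i, P i -> T (b i) = t i *: b i).
Definition weight_fiber (m n : C) : set I := [set i | [/\ P i, jw i = m & lw i = n]].
Hypothesis fin_fiber : forall m n, finite_set (weight_fiber m n).

Definition weight_trace (m n : C) : C := \sum_(i <- fset_set (weight_fiber m n)) t i.

(** By [coord_diag] a joint eigenvector has non-zero coordinates only on basis
vectors of the same weights, so that the joint eigenspaces have the finite fibers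
as bases. *)
Lemma diagonal_graded_trace : is_graded_trace J L T weight_trace.
Proof.
split.
  rewrite -subTset => w _; have : lspan [set b i | i in [set i | P i]] w by case: bf => _ _ ->.
  apply: lspan_min; first exact: lspan_subspace.
  move=> _ [i Pi <-]; apply: lspan_ext; exists (jw i), (lw i).
  by split; [apply: Jb | apply: Lb].
move=> m n; rewrite /weight_trace; set F := fset_set _.
have FP i : i \in F -> [/\ P i, jw i = m & lw i = n].
  by rewrite in_fset_set // inE.
have PF i : P i -> jw i = m -> lw i = n -> i \in F.
  by move=> *; rewrite in_fset_set // inE.
pose e (i : 'I_(size F)) : I := tnth (in_tuple F) i.
have eF i : e i \in F by exact: mem_tnth.
have sumF (X : zmodType) (G : I -> X) : \sum_(i <- F) G i = \sum_i G (e i).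
  by rewrite (big_tnth _ _ F).
have e_inj i j : (e i == e j) = (i == j).
  rewrite /e !(tnth_nth (e i)) nth_uniq ?ltn_ord ?fset_uniq //.
exists (size F), (fun i => b (e i)), (\matrix_(i, j) ((i == j)%:R * t (e i))).
split.
- move=> w; split=> [[Jw Lw]|[x ->]].
    exists (fun i => f (e i) w); rewrite -(sumF _ (fun i => f i w *: b i)).
    have [s Ps hs] := basis_expand w.
    have PU : {in (F `|` s)%fset, forall i, P i}.
      by move=> i; rewrite in_fsetU => /orP[/FP[]|/Ps].
    rewrite {1}(hs (F `|` s)%fset) ?fsubsetUr //.
    apply/esym/big_fset_incl; first exact: fsubsetUl.
    move=> i iU iF; have Pi := PU _ iU; apply/eqP; rewrite scaler_eq0; apply/orP; left.
    have := coord_diag J_lin Jb w Pi; have := coord_diag L_lin Lb w Pi.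
    rewrite Jw Lw !(linear_funZ _ _ (f_lin i)) /GRing.scale /= => hL hJ.
    apply: contraNT iF => f0; apply: PF => //; apply: (mulIf f0); by rewrite -?hL -?hJ.
  split; rewrite ?(linear_fun_sum _ _ _ J_lin) ?(linear_fun_sum _ _ _ L_lin) scaler_sumr;
    apply: eq_bigr => i _; have [Pi Jm Ln] := FP _ (eF i).
    by rewrite (linear_funZ _ _ J_lin) Jb // Jm !scalerA mulrC.
  by rewrite (linear_funZ _ _ L_lin) Lb // Ln !scalerA mulrC.
- move=> x x0 i; have [Pi _ _] := FP _ (eF i).
  have := congr1 (f (e i)) x0; rewrite (linear_fun0 (f_lin _)) (linear_fun_sum _ _ _ (f_lin _)).
  rewrite (bigD1 i) //= big1 ?addr0 => [|j ji].
    by rewrite (linear_funZ _ _ (f_lin _)) f_b // eqxx /GRing.scale /= mulr1.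
  have [Pj _ _] := FP _ (eF j).
  by rewrite (linear_funZ _ _ (f_lin _)) f_b // e_inj eq_sym (negPf ji) scaler0.
- move=> j; have [Pj _ _] := FP _ (eF j); rewrite Tb //.
  rewrite (bigD1 j) //= big1 ?addr0 => [|i ij]; first by rewrite mxE eqxx mul1r.
  by rewrite mxE (negPf ij) mul0r scale0r.
- by rewrite sumF; apply: eq_bigr => i _; rewrite mxE eqxx mul1r.
Qed.

End DiagonalTrace.

Section TensorModes.
Variable K : fieldType.

Lemma fsum_single (I : choiceType) (X : zmodType) (F : I -> X) i0 :
  (forall i, i != i0 -> F i = 0) -> \sum_(i \in [set: I]) F i = F i0.
Proof.
move=> F0; transitivity (\sum_(i \in [set i0]) F i); last exact: fsbig_set1.
apply/esym/fsbig_widen => //.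
by move=> i [_ /= /eqP ii0]; apply: F0.
Qed.

Variables (V1 V2 M1 M2 : lmodType K) (par2 : bool -> set V2) (parM1 : bool -> set M1).
Variables (Y1 : modes V1 M1) (Y2 : modes V2 M2).
Variables (Y : modes (tens V1 V2) (tens M1 M2)) (vac1 : V1) (vac2 : V2).
Hypotheses (hY : is_tensor_modes par2 parM1 Y1 Y2 Y).
Hypotheses (Y1vac : forall r m, Y1 vac1 r m = if r == -1 then m else 0)
  (Y2vac : forall r m, Y2 vac2 r m = if r == -1 then m else 0) (pv2 : par2 false vac2).

(** The vacuum has a single non-zero mode, which leaves one term of the sum that
defines the modes of a pure tensor; it is even, so no sign appears. *)
Lemma tens_modes_left u r m n p : parM1 p m -> Y (u ⊗ vac2) r (m ⊗ n) = Y1 u r m ⊗ n.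
Proof.
move=> pm; rewrite (hY.2 _ _ _ _ _ _ _ pv2 pm) scale1r (fsum_single (i0 := r)).
  by rewrite Y2vac addrAC subrr add0r eqxx.
move=> i ir; rewrite Y2vac (_ : (_ == _) = false).
  by rewrite (linear_fun0 (tpure_linearr _)).
by apply/negP => /eqP h; case/eqP: ir; rewrite -[r](subrK 1) -[r - 1](subrK i) h; ring.
Qed.

Lemma tens_modes_right v r m n p : par2 false v -> parM1 p m ->
  Y (vac1 ⊗ v) r (m ⊗ n) = m ⊗ Y2 v r n.
Proof.
move=> pv pm; rewrite (hY.2 _ _ _ _ _ _ _ pv pm) scale1r (fsum_single (i0 := -1)).
  by rewrite Y1vac eqxx opprK subrK.
by move=> i /negPf i1; rewrite Y1vac i1 (linear_fun0 (tpure_linearl _)).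
Qed.

End TensorModes.

(** * Eigenbases of an element of finite order *)

Section FiniteOrderMatrix.
Variable K : numClosedFieldType.

(** In characteristic zero the polynomial [X^m - 1] is separable, so the minimal
polynomial of a matrix of order dividing [m] has simple roots.  The powers are
given as a family [Nk] since square matrices of size zero form no ring. *)
Lemma finite_order_diag n (N : 'M[K]_n) (Nk : nat -> 'M[K]_n) m :
  Nk 0%N = 1%:M -> (forall k, Nk k.+1 = Nk k *m N) -> (0 < m)%N -> Nk m = 1%:M ->
  exists (P : 'M[K]_n) (d : 'I_n -> K), [/\ P \in unitmx,
    P *m N = diag_mx (\row_j d j) *m P, forall k, \tr (Nk k) = \sum_j d j ^+ k
    & forall j, d j ^+ m = 1].
Proof.
case: n N Nk => [|n] N Nk N0 NS m0 Nm.
  exists 1%:M, (fun=> 1); split=> [|||j]; rewrite ?unitmx1 ?expr1n //.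
    by apply/matrixP => -[].
  by move=> k; rewrite /mxtrace !big_ord0.
have NkE k : Nk k = N ^+ k by elim: k => [//|k IH]; rewrite NS IH exprSr.
have [rs Drs] := closed_field_poly_normal ('X^m - 1 : {poly K}).
rewrite (monicP (monicXnsubC 1 m0)) scale1r in Drs.
have urs : uniq rs.
  rewrite -separable_prod_XsubC -Drs; apply: separable_Xn_sub_1.
  by rewrite pnatr_eq0 -lt0n.
have /diagonalizableP [P Pu /diagonalizable_forPex [D hD]] : exists2 rs, uniq rs &
    mxminpoly N %| \prod_(x <- rs) ('X - x%:P).
  exists rs => //; rewrite -Drs; apply: mxminpoly_min.
  by rewrite rmorphB rmorphXn rmorph1 /= horner_mx_X -NkE Nm subrr.
have PN : P *m N = diag_mx D *m P by apply/(simmxP Pu).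
have PNk k : P *m N ^+ k = diag_mx (\row_j D 0 j ^+ k) *m P.
  elim: k => [|k IH]; first by rewrite mulmx1 (_ : diag_mx _ = 1%:M) ?mul1mx //;
    apply/matrixP => i j; rewrite !mxE expr0.
  rewrite exprSr mulmxA IH -mulmxA PN mulmxA mulmx_diag; congr (diag_mx _ *m _).
  by apply/rowP => j; rewrite !mxE exprSr.
have Dk k : diag_mx (\row_j D 0 j ^+ k) = P *m N ^+ k *m invmx P.
  by rewrite PNk mulmxK.
exists P, (fun j => D 0 j); split=> //.
- by rewrite PN; congr (diag_mx _ *m _); apply/rowP => j; rewrite mxE.
- move=> k; rewrite NkE -[N ^+ k]mul1mx -(mulVmx Pu) -mulmxA mxtrace_mulC -Dk mxtrace_diag.
  by apply: eq_bigr => j _; rewrite mxE.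
- move=> j; have := Dk m; rewrite -NkE Nm mulmx1 mulmxV // => /matrixP /(_ j j).
  by rewrite !mxE eqxx.
Qed.

End FiniteOrderMatrix.

Import passmx.

Section RepEigenbasis.
Variables (gT : finGroupType) (H : {group gT}) (K : numClosedFieldType) (s : bool).
Variables (A : polspace K s) (rho : polrep H A) (g : gT).
Hypothesis gH : g \in H.
Local Notation sgn := ((-1) ^+ s : K).
Local Notation U := (pplus A).
Local Notation gf := (rep_full rho g).

Let pfC x y : pform A x y = - sgn * pform A y x. Proof. by rewrite -pformC. Qed.

Let pform_suml (I : finType) (F : I -> A) z :
  pform A (\sum_i F i) z = \sum_i pform A (F i) z.
Proof.
apply: (@linear_fun_sum K A K^o (fun x => pform A x z)) => k x y.
by rewrite linearPl.
Qed.

Lemma rep_full_plusE x : x \in U -> gf x = vsval (rho g (vsproj U x)).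
Proof. by move=> xU; rewrite -(rep_full_plus rho gH) vsprojK. Qed.

Lemma rep_full_pplus x : x \in U -> gf x \in U.
Proof. by move=> xU; rewrite rep_full_plusE ?subvsP. Qed.

Lemma rep_full_isometry x y : pform A (gf x) (gf y) = pform A x y.
Proof.
have dec z : exists z1 z2, [/\ z1 \in U, z2 \in pminus A & z = z1 + z2].
  have : z \in (pplus A + pminus A)%VS by rewrite pol_full memvf.
  by case/memv_addP => z1 h1 [z2 h2 ->]; exists z1, z2.
have [x1 [x2 [x1p x2m ->]]] := dec x; have [y1 [y2 [y1p y2m ->]]] := dec y.
have gx1 := rep_full_pplus x1p; have gy1 := rep_full_pplus y1p.
have gx2 := rep_full_minus rho gH x2m; have gy2 := rep_full_minus rho gH y2m.
have pD a1 a2 b1 b2 : pform A (a1 + a2) (b1 + b2)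
    = pform A a1 b1 + pform A a1 b2 + (pform A a2 b1 + pform A a2 b2).
  by rewrite linearDl /= !linearDr.
rewrite [gf (x1 + x2)]linearD [gf (y1 + y2)]linearD !pD.
rewrite (pplus_isotropic gx1 gy1) (pplus_isotropic x1p y1p).
rewrite (pminus_isotropic gx2 gy2) (pminus_isotropic x2m y2m).
rewrite (rep_full_form rho gH x1p y2m) (pfC _ (gf y1)) (rep_full_form rho gH y1p x2m).
by rewrite -pfC.
Qed.

(** The form pairs [um] perfectly with [up] and is preserved by [g], so [g] has to
act on [um] by the inverse eigenvalues. *)
Lemma rep_eigen_minus n (d : 'I_n -> K) (up um : n.-tuple A) : dual_bases up um ->
  (forall j, d j != 0) -> (forall j, gf (tnth up j) = d j *: tnth up j) ->
  forall j, gf (tnth um j) = (d j)^-1 *: tnth um j.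
Proof.
case=> bup bum umup upum d0 gup j.
have up_plus i : tnth up i \in U by apply: (basis_mem bup); apply: mem_tnth.
have um_minus i : tnth um i \in pminus A by apply: (basis_mem bum); apply: mem_tnth.
have zm : gf (tnth um j) \in pminus A by exact: (rep_full_minus rho gH).
rewrite [LHS](coord_basis bum zm).
have cz i : coord um i (gf (tnth um j)) = (d i)^-1 * (i == j)%:R.
  have := rep_full_form rho gH (up_plus i) (um_minus j).
  have pc : pform A (tnth up i) (gf (tnth um j)) = coord um i (gf (tnth um j)) * - sgn.
    rewrite {1}(coord_basis bum zm) linear_sumr (bigD1 i) //= big1 ?addr0 => [|k ki].
      by rewrite linearZr /= -tnth_nth upum eqxx mulr1.
    by rewrite linearZr /= -tnth_nth upum eq_sym (negPf ki) !mulr0.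
  rewrite gup linearZl_LR /= pc upum => e.
  have sg0 : - sgn != 0 by rewrite oppr_eq0 signr_eq0.
  apply: (mulfI (d0 i)); rewrite mulrA divff // mul1r.
  by apply: (mulIf sg0); rewrite -mulrA e mulrC.
rewrite (bigD1 j) //= big1 ?addr0 => [|i ij].
  by rewrite cz eqxx mulr1 -tnth_nth.
by rewrite cz (negPf ij) mulr0 scale0r.
Qed.

(** Only the basis of [pplus A] has to be changed to eigenvectors; the dual basis
change of [pminus A] follows. *)
Lemma rep_eigenbasis n (ap am : n.-tuple A) : dual_bases ap am ->
  exists (lam : 'I_n -> K) (up um : n.-tuple A),
  [/\ dual_bases up um,
      forall j, gf (tnth up j) = lam j *: tnth up j,
      forall j, gf (tnth um j) = (lam j)^-1 *: tnth um j,
      forall k, lftrace (rho (g ^+ k)%g) = \sum_j lam j ^+ k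
    & forall j, lam j ^+ #[g]%g = 1].
Proof.
move=> [bp bm am_ap ap_am].
have dn : n = \dim {:subvs_of U}.
  by rewrite dimvf /= -(size_basis bp) .
subst n.
set v := vbasis {:subvs_of U}.
have bv : basis_of {:subvs_of U} v by exact: vbasisP.
pose Nk k := mxof v v (rho (g ^+ k)%g).
have [P [d [Pu PN trN dN]]] : exists (P : 'M[K]_(\dim {:subvs_of U})) (d : 'I__ -> K),
    [/\ P \in unitmx, P *m mxof v v (rho g) = diag_mx (\row_j d j) *m P,
     forall k, \tr (Nk k) = \sum_j d j ^+ k & forall j, d j ^+ #[g]%g = 1].
  apply: finite_order_diag => [|k||].
  - by rewrite /Nk expg0 rep_plus1 mxof1 // (basis_free bv).
  - by rewrite /Nk expgS rep_plusM ?groupX // (mxof_comp _ _ bv).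
  - exact: order_gt0.
  - by rewrite /Nk expg_order rep_plus1 mxof1 // (basis_free bv).
pose S0 : 'M[K]_(\dim {:subvs_of U}) := \matrix_(i, j) coord ap j (vsval v`_i).
pose T0 : 'M[K]_(\dim {:subvs_of U}) := \matrix_(i, j) coord v j (vsproj U ap`_i).
have ST : S0 *m T0 = 1%:M.
  apply/matrixP => i k; rewrite !mxE.
  under eq_bigr do rewrite !mxE -linearZ -linearZ /=.
  rewrite -!linear_sum /= -(coord_basis bp (subvsP _)) vsvalK.
  by rewrite coord_free ?(basis_free bv) // eq_sym.
have [S0u _] := mulmx1_unit ST.
pose S := P *m S0; have Su : S \in unitmx by rewrite unitmx_mul Pu S0u.
pose x i := vecof v (row i P).
pose up := [tuple vsval (x i) | i < \dim {:subvs_of U}].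
pose um := [tuple \sum_j (invmx S) j i *: tnth am j | i < \dim {:subvs_of U}].
have upE i : tnth up i = \sum_j S i j *: tnth ap j.
  rewrite tnth_mktuple /x (coord_basis bp (subvsP _)); apply: eq_bigr => j _.
  rewrite (tnth_nth 0); congr (_ *: _); rewrite /S !mxE /vecof linear_sum linear_sum /=.
  by apply: eq_bigr => k _; rewrite !mxE !linearZ.
have up_plus i : tnth up i \in U by rewrite tnth_mktuple subvsP.
have um_minus i : tnth um i \in pminus A.
  rewrite tnth_mktuple; apply: memv_suml => j _; apply: memvZ.
  by apply: (basis_mem bm); apply: mem_tnth.
have umup i k : pform A (tnth um i) (tnth up k) = (i == k)%:R.
  rewrite tnth_mktuple upE pform_suml /=.
  have /matrixP /(_ k i) : S *m invmx S = 1%:M by rewrite mulmxV.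
  rewrite !mxE eq_sym => <-; apply: eq_bigr => j _; rewrite linearZl_LR /= linear_sumr /=.
  rewrite (bigD1 j) //= big1 ?addr0 => [|l lj].
    by rewrite linearZr /= am_ap eqxx mulr1 mulrC.
  by rewrite linearZr /= am_ap eq_sym (negPf lj) mulr0.
have upum i k : pform A (tnth up i) (tnth um k) = - sgn * (i == k)%:R.
  by rewrite pfC umup eq_sym.
have d0 j : d j != 0.
  apply: contraTneq (isT) => dj0; have := dN j; rewrite dj0 expr0n.
  by rewrite gtn_eqF ?order_gt0 // => /esym/eqP; rewrite oner_eq0.
have gup j : gf (tnth up j) = d j *: tnth up j.
  rewrite tnth_mktuple rep_full_plusE ?subvsP // vsvalK /x (hom_vecof _ bv).
  suff -> : row j P *m mxof v v (rho g) = d j *: row j P by rewrite !linearZ.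
  rewrite -row_mul PN; apply/rowP => k.
  rewrite !mxE (bigD1 j) //= big1 ?addr0 => [|i ij]; first by rewrite !mxE eqxx mulr1n.
  by rewrite !mxE eq_sym (negPf ij) mulr0n mul0r.
clearbody up um.
have bup : basis_of U up.
  rewrite basisEfree; apply/and3P; split; last by rewrite size_tuple (size_basis bp).
    apply/freeP => c c0 k.
    have : pform A (tnth um k) (\sum_i c i *: up`_i) = 0 by rewrite c0 linear0r.
    rewrite linear_sumr (bigD1 k) //= big1 ?addr0 => [|i ik].
      by rewrite linearZr /= -tnth_nth umup eqxx mulr1.
    by rewrite linearZr /= -tnth_nth umup eq_sym (negPf ik) mulr0.
  by apply/span_subvP => z /tnthP [i ->].
have bum : basis_of (pminus A) um.
  rewrite basisEfree; apply/and3P; split; last by rewrite size_tuple (size_basis bm).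
    apply/freeP => c c0 k.
    have : pform A (\sum_i c i *: um`_i) (tnth up k) = 0 by rewrite c0 linear0l.
    rewrite pform_suml (bigD1 k) //= big1 ?addr0 => [|i ik].
      by rewrite linearZl_LR /= -tnth_nth umup eqxx mulr1.
    by rewrite linearZl_LR /= -tnth_nth umup (negPf ik) mulr0.
  by apply/span_subvP => z /tnthP [i ->].
exists d, up, um; split=> //.
- have dd : dual_bases up um by split.
  exact: rep_eigen_minus dd d0 gup.
- move=> k; rewrite -trN /lftrace /mxtrace; apply: eq_bigr => i _.
  by rewrite !mxE vecof_delta.
Qed.

Lemma rep_full_inv (x : A) k : x \in U -> k != 0 -> gf x = k *: x ->
  rep_full rho g^-1%g x = k^-1 *: x.
Proof.
move=> xU k0 gx; have gV : g^-1%g \in H by rewrite groupV.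
have e : rep_full rho g^-1%g (gf x) = x.
  rewrite (rep_full_plusE xU) (rep_full_plus rho gV) -comp_lfunE.
  by rewrite -rep_plusM // mulVg rep_plus1 id_lfunE vsprojK.
by rewrite -{2}e gx linearZ /= scalerA mulVf // scale1r.
Qed.

End RepEigenbasis.

(** * Limits of complex sequences and infinite products *)

Section SequenceLimits.
Variable K : numFieldType.
Implicit Types (f g : nat -> K) (l m : K).

Definition slim f l : Prop := f @ \oo --> l.

Lemma slimP f l : slim f l <->
  forall e : K, 0 < e -> exists N, forall n, (N <= n)%N -> `|f n - l| < e.
Proof.
rewrite /slim; split=> [/cvgrPdist_lt h e e0|h].
  by have [N _ hN] := h e e0; exists N => n nN; rewrite distrC; apply: hN.
apply/cvgrPdist_lt => e e0; have [N hN] := h e e0.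
by exists N => // n nN; rewrite /= distrC; apply: hN.
Qed.

Lemma slim_cst l : slim (fun=> l) l. Proof. exact: cvg_cst. Qed.
Lemma slimD f g l m : slim f l -> slim g m -> slim (fun n => f n + g n) (l + m).
Proof. exact: cvgD. Qed.
Lemma slimM f g l m : slim f l -> slim g m -> slim (fun n => f n * g n) (l * m).
Proof. exact: cvgM. Qed.
Lemma slimV f l : l != 0 -> slim f l -> slim (fun n => (f n)^-1) l^-1.
Proof. by move=> l0; apply: cvgV. Qed.
Lemma slim_unique f l m : slim f l -> slim f m -> l = m.
Proof. by apply: cvg_unique. Qed.
Lemma slim_ext f g l : (forall n, f n = g n) -> slim f l -> slim g l.
Proof. by move=> /funext ->. Qed.

End SequenceLimits.

Section ComplexSequences.
Variable R : realType.
Local Notation C := R[i].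

Lemma limn_slim (f : nat -> C) (l : C) : slim f l -> limn (f : nat -> C^o) = l.
Proof. by move=> h; apply: cvg_lim. Qed.

(** The norm of [R[i]] has its values in [R[i]]; estimates are made on its real
part, in an ordered field. *)
Definition modulus (z : C) : R := complex.Re `|z|.

Lemma modulusE z : `|z| = (modulus z)%:C%C.
Proof. by rewrite /modulus RRe_real // normr_real. Qed.

Lemma modulus_ge0 z : 0 <= modulus z.
Proof. by rewrite -ler0c -modulusE normr_ge0. Qed.

Lemma modulusM z w : modulus (z * w) = modulus z * modulus w.
Proof. by apply: complexI; rewrite rmorphM /= -!modulusE normrM. Qed.

Lemma modulusD z w : modulus (z + w) <= modulus z + modulus w.
Proof. by rewrite -lecR rmorphD /= -!modulusE ler_normD. Qed.

Lemma modulus1 : modulus 1 = 1.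
Proof. by apply: complexI; rewrite -modulusE normr1. Qed.

Lemma modulus0 : modulus 0 = 0.
Proof. by apply: complexI; rewrite -modulusE normr0. Qed.

Lemma modulusN z : modulus (- z) = modulus z.
Proof. by apply: complexI; rewrite -!modulusE normrN. Qed.

Lemma modulusX z n : modulus (z ^+ n) = modulus z ^+ n.
Proof. by elim: n => [|n IH]; rewrite ?modulus1 // !exprS modulusM IH. Qed.

Lemma modulusV z : modulus z^-1 = (modulus z)^-1.
Proof. by apply: complexI; rewrite fmorphV /= -!modulusE normfV. Qed.

Lemma modulus_prod (I : Type) (r : seq I) (P : pred I) (F : I -> C) :
  modulus (\prod_(i <- r | P i) F i) = \prod_(i <- r | P i) modulus (F i).
Proof. by apply: (big_morph modulus modulusM modulus1). Qed.

Lemma modulus_sum (I : Type) (r : seq I) (P : pred I) (F : I -> C) :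
  modulus (\sum_(i <- r | P i) F i) <= \sum_(i <- r | P i) modulus (F i).
Proof.
elim/big_rec2: _ => [|i y x _ h]; first by rewrite modulus0.
by apply: le_trans (modulusD _ _) _; rewrite lerD2l.
Qed.

Lemma modulus_eq0 z : (modulus z == 0) = (z == 0).
Proof. by rewrite -(inj_eq (@complexI R)) -modulusE normr_eq0. Qed.

Lemma slim_modulus (f : nat -> C) l : slim f l <->
  forall e : R, 0 < e -> exists N, forall n, (N <= n)%N -> modulus (f n - l) < e.
Proof.
rewrite slimP; split=> h e e0.
  have [|N hN] := h e%:C%C; first by rewrite ltcR.
  by exists N => n /hN; rewrite modulusE ltcR.
have re : e = (complex.Re e)%:C%C by rewrite RRe_real // gtr0_real.
have [|N hN] := h (complex.Re e); first by rewrite -ltcR -re.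
by exists N => n /hN; rewrite modulusE {2}re ltcR.
Qed.

Lemma modulus_Re z : `|complex.Re z| <= modulus z.
Proof. by rewrite -lecR -modulusE normc_ge_Re. Qed.

Lemma modulus_Im z : `|complex.Im z| <= modulus z.
Proof.
rewrite -lecR -modulusE; case: z => a b /=; rewrite normc_def /= lecR.
by rewrite -sqrtr_sqr ler_wsqrtr // lerDr sqr_ge0.
Qed.

(** The real and the imaginary part are partial sums of absolutely convergent real
series. *)
Lemma bounded_variation_cvg (g : nat -> C) (B : R) :
  (forall N, \sum_(n < N) modulus (g n.+1 - g n) <= B) -> exists l, slim g l.
Proof.
move=> hB.
have real (p : C -> R) : (forall z w, p (z - w) = p z - p w) ->
    (forall z, `|p z| <= modulus z) -> cvgn (p \o g).
  move=> pB pm; pose u n := p (g n.+1) - p (g n).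
  have su : cvgn (series u).
    apply: normed_cvg; apply: nondecreasing_is_cvgn.
      by apply: nondecreasing_series => n _ _; apply: normr_ge0.
    exists B => _ [N _ <-]; rewrite -[X in X <= _]/(\sum_(0 <= k < N) `|u k|) big_mkord.
    apply: le_trans (hB N).
    by apply: ler_sum => n _; rewrite /u -pB.
  have -> : p \o g = (fun n => p (g 0%N) + series u n).
    apply/funext => n; have /= -> := congr1 (@^~ n) (telescopeK (p \o g)).
    by rewrite addrC subrK.
  by apply: is_cvgD => //; exact: is_cvg_cst.
have cr := real _ (raddfB (@complex.Re R)) modulus_Re.
have ci := real _ (raddfB (@complex.Im R)) modulus_Im.
pose fr n := complex.Re (g n); pose fi n := complex.Im (g n).
exists (limn fr +i* limn fi)%C.
apply/slim_modulus => e e0.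
have e2 : 0 < e / 2 by rewrite divr_gt0.
have /slimP/(_ _ e2)[N1 h1] : slim fr (limn fr) by exact: cr.
have /slimP/(_ _ e2)[N2 h2] : slim fi (limn fi) by exact: ci.
exists (maxn N1 N2) => n; rewrite geq_max => /andP[/h1 {}h1 /h2 {}h2].
rewrite [e]splitr; apply: le_lt_trans (ltrD h1 h2).
rewrite /fr /fi; set lr := limn _; set li := limn _.
rewrite (_ : g n - _ = (complex.Re (g n) - lr)%:C%C + 'i%C * (complex.Im (g n) - li)%:C%C).
  apply: le_trans (modulusD _ _) _; rewrite modulusM.
  have mi : modulus 'i%C = 1 by apply: complexI; rewrite -modulusE normc_def /= expr0n add0r expr1n sqrtr1.
  have mr (x : R) : modulus x%:C%C = `|x| by apply: complexI; rewrite -modulusE normc_def /= expr0n addr0 sqrtr_sqr.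
  by rewrite mi mul1r !mr.
by case: (g n) => a b; simpc.
Qed.

Lemma prod1D_le_exp (a : nat -> R) N : (forall n, 0 <= a n) ->
  \prod_(n < N) (1 + a n) <= expR (\sum_(n < N) a n).
Proof.
move=> a0; rewrite expR_sum; apply: ler_prod => n _.
by rewrite addr_ge0 //= expR_ge1Dx.
Qed.

(** Consecutive partial products differ by [u n] times a partial product, which is
at most [expR B] in modulus. *)
Lemma prod1D_cvg (u : nat -> C) (B : R) :
  (forall N, \sum_(n < N) modulus (u n) <= B) ->
  exists l, slim (fun N => \prod_(n < N) (1 + u n)) l.
Proof.
move=> hB; apply: (@bounded_variation_cvg _ (expR B * B)) => N.
have bnd M : modulus (\prod_(n < M) (1 + u n)) <= expR B.
  rewrite modulus_prod; apply: le_trans (_ : expR (\sum_(n < M) modulus (u n)) <= _).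
    apply: le_trans (prod1D_le_exp _ (fun n => modulus_ge0 (u n))).
    apply: ler_prod => n _; rewrite modulus_ge0 /= -[X in _ <= X + _]modulus1.
    exact: modulusD.
  by rewrite ler_expR.
apply: le_trans (_ : \sum_(n < N) expR B * modulus (u n) <= _).
  apply: ler_sum => n _; rewrite big_ord_recr /= mulrDr mulr1 addrAC subrr add0r.
  by rewrite modulusM; apply: ler_wpM2r; [exact: modulus_ge0 | exact: bnd].
by rewrite -mulr_sumr ler_wpM2l ?expR_ge0.
Qed.

(** The q-Pochhammer symbols [(a; q)_N] and [(a; q)_oo]. *)
Definition qpoch (a q : C) (N : nat) : C := \prod_(n < N) (1 - a * q ^+ n).
Definition qinf (a q : C) : C := infprod (fun n => 1 - a * q ^+ n.-1).

Lemma geometric_bound (x : R) N : 0 <= x -> x < 1 ->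
  \sum_(n < N) x ^+ n <= (1 - x)^-1.
Proof.
move=> x0 x1; have d0 : 0 < 1 - x by rewrite subr_gt0.
rewrite -(ler_pM2l d0) divff ?gt_eqF //.
have -> : (1 - x) * (\sum_(n < N) x ^+ n) = 1 - x ^+ N.
  by rewrite -opprB mulNr -subrX1 opprB.
by rewrite lerBlDr lerDl exprn_ge0.
Qed.

Lemma qpoch_summable a q N : modulus q < 1 ->
  \sum_(n < N) modulus (- (a * q ^+ n)) <= modulus a * (1 - modulus q)^-1.
Proof.
move=> q1; under eq_bigr do rewrite modulusN modulusM modulusX.
by rewrite -mulr_sumr ler_wpM2l ?modulus_ge0 // geometric_bound ?modulus_ge0.
Qed.

Lemma qpoch_cvg a q : modulus q < 1 -> slim (qpoch a q) (qinf a q).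
Proof.
move=> q1; have [l hl] := prod1D_cvg (u := fun n => - (a * q ^+ n)) (fun N => qpoch_summable a N q1).
have h : slim (qpoch a q) l by exact: hl.
suff -> : qinf a q = l by [].
apply: limn_slim; apply: slim_ext h => N.
by rewrite /qpoch big_add1 big_mkord.
Qed.

(** The reciprocals [1 / (1 + u n)] are of the form [1 + v n] with [v] absolutely
summable too, so their product converges, and to an inverse of [l]. *)
Lemma prod1D_neq0 (u : nat -> C) (B c : R) l : 0 < c ->
  (forall n, c <= modulus (1 + u n)) -> (forall N, \sum_(n < N) modulus (u n) <= B) ->
  slim (fun N => \prod_(n < N) (1 + u n)) l -> l != 0.
Proof.
move=> c0 hc hB hl; have u0 n : 1 + u n != 0.
  by rewrite -modulus_eq0 gt_eqF // (lt_le_trans c0).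
pose v n := - u n / (1 + u n).
have hv N : \sum_(n < N) modulus (v n) <= c^-1 * B.
  apply: le_trans (_ : \sum_(n < N) c^-1 * modulus (u n) <= _).
    apply: ler_sum => n _; rewrite modulusM modulusN modulusV mulrC.
    by rewrite ler_wpM2r ?modulus_ge0 // lef_pV2 ?posrE // (lt_le_trans c0).
  by rewrite -mulr_sumr ler_wpM2l // invr_ge0 ltW.
have [m hm] := prod1D_cvg hv; apply: contraTneq isT => l0.
have := slimM hl hm; rewrite l0 mul0r => h0.
have h1 N : (\prod_(n < N) (1 + u n)) * (\prod_(n < N) (1 + v n)) = 1.
  rewrite -big_split /= big1 // => n _.
  by rewrite /v; field; apply: u0.
have := slim_unique (slim_ext (g := fun=> 1) h1 h0) (slim_cst (l := 1)).
by move/eqP; rewrite eq_sym oner_eq0.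
Qed.

Lemma qinf_neq0 a q : modulus a < 1 -> modulus q < 1 -> qinf a q != 0.
Proof.
move=> a1 q1; have c0 : 0 < 1 - modulus a by rewrite subr_gt0.
apply: (@prod1D_neq0 (fun n => - (a * q ^+ n)) _ _ _ c0 _
  (fun N => qpoch_summable a N q1)); last exact: qpoch_cvg.
move=> n; have h : modulus (a * q ^+ n) <= modulus a.
  by rewrite modulusM modulusX ler_piMr ?modulus_ge0 // exprn_ile1 ?modulus_ge0 // ltW.
apply: le_trans (lerB (lexx 1) h) _; rewrite lerBlDr -{1}modulus1.
rewrite -[X in modulus X <= _](subrK (a * q ^+ n)); exact: modulusD.
Qed.

End ComplexSequences.

(** * Unconditional summation and regrouping *)

Section UnconditionalSums.
Variable R : realType.
Local Notation C := R[i].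

Lemma fset_sum_split (V : nmodType) (I : choiceType) (A B : {fset I}) (F : I -> V) :
  (A `<=` B)%fset -> \sum_(i <- B) F i = \sum_(i <- A) F i + \sum_(i <- B | i \notin A) F i.
Proof.
move=> AB; rewrite (bigID (mem A)) /=; congr (_ + _); rewrite -big_filter.
apply: perm_big; apply: uniq_perm; rewrite ?filter_uniq ?fset_uniq // => i.
by rewrite mem_filter /=; case: (boolP (i \in A)) => //= /(fsubsetP AB).
Qed.

Section Exhaustion.
Variables (I : choiceType) (P : pred I) (D : nat -> {fset I}).
Hypotheses (D_P : forall N i, i \in D N -> P i)
  (D_mono : forall N M, (N <= M)%N -> (D N `<=` D M)%fset)
  (D_exh : forall i, P i -> exists N, i \in D N).

Lemma exhaust_fset (s : {fset I}) : {in s, forall i, P i} -> exists N, (s `<=` D N)%fset.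
Proof.
move=> sP; have [N hN] : exists N, {subset enum_fset s <= D N}.
  have : {in enum_fset s, forall i, P i} by exact: sP.
  elim: (enum_fset s) => [|i r IH] rP; first by exists 0%N.
  have [N hN] := IH (fun j jr => rP j (mem_behead (s := i :: r) jr)).
  have [M hM] := D_exh (rP i (mem_head _ _)).
  exists (maxn N M) => j; rewrite inE => /predU1P[->|/hN].
    exact: (fsubsetP (D_mono (leq_maxr _ _))).
  exact: (fsubsetP (D_mono (leq_maxl _ _))).
by exists N; apply/fsubsetP.
Qed.

Variables (F : I -> C) (B : R) (S : C).
Hypotheses (F_bound : forall N, \sum_(i <- D N) modulus (F i) <= B)
  (F_lim : slim (fun N => \sum_(i <- D N) F i) S).

(** A finite set [s] that contains [D N] lies in some later [D M].  The sums over
[s] and [D M] differ by terms outside [D N], whose total modulus is small because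
the sums of moduli increase to a limit. *)
Lemma unconditional (e : R) : 0 < e -> exists N, forall s : {fset I},
  {in s, forall i, P i} -> (D N `<=` s)%fset -> modulus (\sum_(i <- s) F i - S) < e.
Proof.
move=> e0; have e2 : 0 < e / 2 by rewrite divr_gt0.
have e4 : 0 < e / 4%:R by rewrite divr_gt0 // ltr0n.
pose a N := \sum_(i <- D N) modulus (F i).
have a_mono N M : (N <= M)%N -> a N <= a M.
  move=> NM; rewrite /a (fset_sum_split _ (D_mono NM)) lerDl sumr_ge0 // => i _.
  exact: modulus_ge0.
have [l al] : exists l, slim a l.
  exists (limn a); apply: nondecreasing_is_cvgn; first by move=> N M; apply: a_mono.
  by exists B => _ [N _ <-]; apply: F_bound.
have [N1 h1] := (slimP a l).1 al _ e4.
have [N2 h2] := (slim_modulus _ _).1 F_lim _ e2.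
exists N1 => s sP N1s; have [M0 sM0] := exhaust_fset sP.
pose M := maxn M0 (maxn N1 N2).
have M0M : (M0 <= M)%N by rewrite /M leq_maxl.
have N1M : (N1 <= M)%N by rewrite /M !leq_max leqnn orbT.
have N2M : (N2 <= M)%N by rewrite /M !leq_max leqnn !orbT.
have sM : (s `<=` D M)%fset by apply: fsubset_trans sM0 (D_mono M0M).
have -> : \sum_(i <- s) F i - S = (\sum_(i <- D M) F i - S) + - \sum_(i <- D M | i \notin s) F i.
  by rewrite (fset_sum_split F sM); ring.
rewrite [e]splitr; apply: le_lt_trans (modulusD _ _) _; apply: ltrD; first exact: h2.
rewrite modulusN; apply: le_lt_trans (modulus_sum _ _ _) _.
apply: le_lt_trans (_ : a M - a N1 < _).
  rewrite /a (fset_sum_split _ (D_mono N1M)) addrAC subrr add0r.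
  rewrite big_mkcond [leRHS]big_mkcond; apply: ler_sum => i _.
  case: (boolP (i \in s)) => /= [_|si].
    by case: ifP => _ //; apply: modulus_ge0.
  by rewrite (contraNN (fsubsetP N1s i)).
have hM := h1 M N1M; have hN := h1 N1 (leqnn _).
have -> : e / 2 = e / 4%:R + e / 4%:R by field.
move: hM hN; rewrite !ltr_distl => /andP[_ hM] /andP[hN _].
by rewrite ltrBlDr; apply: lt_le_trans hM _; move: hN; set w := e / 4%:R; lra.
Qed.

(** All terms over a fiber have the same non-zero modulus, so infinitely many of
them would exceed every bound. *)
Lemma fiber_finite (T : eqType) (w : I -> T) (v : T) :
  (forall i, P i -> F i != 0) -> (forall i j, w i = w j -> modulus (F i) = modulus (F j)) ->
  finite_set [set i | P i /\ w i = v].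
Proof.
move=> F0 wF; apply: contrapT => inf.
have [i0 [Pi0 wi0]] : [set i | P i /\ w i = v] !=set0.
  by apply/set0P/eqP => e0; apply: inf; rewrite e0.
pose r := modulus (F i0).
have r0 : 0 < r by rewrite lt_def modulus_ge0 andbT modulus_eq0 F0.
have [s sA sn] := infinite_set_fset (Num.Def.truncn (B / r)).+1 inf.
have sP : {in s, forall i, P i} by move=> i is'; have [] := sA i is'.
have [N sN] := exhaust_fset sP.
have : \sum_(i <- s) modulus (F i) <= B.
  apply: le_trans (F_bound N); rewrite (fset_sum_split _ sN) lerDl sumr_ge0 // => i _.
  exact: modulus_ge0.
rewrite big_seq (eq_bigr (fun=> r)) => [|i is']; last first.
  by rewrite (wF i i0) //; have [_ ->] := sA i is'.
rewrite -big_seq big_const_seq count_predT iter_addr addr0 -mulr_natr.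
rewrite mulrC -ler_pdivlMr //; apply/negP; rewrite -ltNge.
apply: lt_le_trans (_ : ((Num.Def.truncn (B / r)).+1)%:R <= _); last by rewrite ler_nat.
exact: truncnS_gt.
Qed.

End Exhaustion.

Section Regroup.
Variables (I : choiceType) (P : pred I) (D : nat -> {fset I}).
Hypotheses (D_P : forall N i, i \in D N -> P i)
  (D_mono : forall N M, (N <= M)%N -> (D N `<=` D M)%fset)
  (D_exh : forall i, P i -> exists N, i \in D N).
Variables (jw lw t F : I -> C) (tau z S : C) (B : R).
Hypotheses (F_bound : forall N, \sum_(i <- D N) modulus (F i) <= B)
  (F_lim : slim (fun N => \sum_(i <- D N) F i) S).
Hypothesis FE : forall i, P i -> F i = t i * e2pi (jw i * z) * e2pi (lw i * tau).
Hypothesis fin_fiber : forall m n, finite_set (weight_fiber P jw lw m n).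

(** A finite set of weights pulls back to a finite set of indices, since the
fibers are finite; if the set of weights contains the weights of [D N], its
preimage contains [D N]. *)
Lemma series_converges_regroup :
  series_converges (fun m n => - weight_trace P jw lw t m n) tau z (- S).
Proof.
have FT := @totally_filter (C * C)%type.
apply/cvgrPdist_lt => e e0.
have re : e = (complex.Re e)%:C%C by rewrite RRe_real // gtr0_real.
have [|N hN] := unconditional D_mono D_exh F_bound F_lim (e := complex.Re e).
  by rewrite -ltcR -re.
pose w i := (jw i, lw i); exists [fset w i | i in D N]%fset => // A /= NA.
(* The preimage of [A] is the concatenation [fl A] of its fibers. *)
pose fib (p : (C * C)%type) := enum_fset (fset_set (weight_fiber P jw lw p.1 p.2)).
have fibP p i : (i \in fib p) = P i && (w i == p).
  rewrite /fib in_fset_set //; apply/idP/idP; rewrite inE.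
    by move=> [Pi j1 j2]; rewrite Pi /w j1 j2 -surjective_pairing eqxx.
  by case/andP=> Pi /eqP <-.
pose fl (r : seq (C * C)) := flatten [seq fib p | p <- r].
have flP r i : (i \in fl r) = P i && (w i \in r).
  elim: r => [|p r IH]; first by rewrite andbF.
  by rewrite /fl /= mem_cat -/(fl r) IH fibP inE; case: (P i).
have fl_uniq r : uniq r -> uniq (fl r).
  elim: r => //= p r IH /andP[pr ur]; rewrite cat_uniq fset_uniq IH //= andbT.
  apply/hasPn => i; rewrite -/(fl r) flP => /andP[Pi wr]; rewrite fibP Pi /=.
  by apply: contraNneq pr => <-.
pose s := seq_fset tt (fl A).
have sE (G : I -> C) : \sum_(i <- s) G i = \sum_(i <- fl A) G i.
  apply: perm_big; apply: uniq_perm; first exact: fset_uniq.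
    by apply: fl_uniq; exact: fset_uniq.
  by move=> i; rewrite seq_fsetE.
pose G (p : C * C) := - weight_trace P jw lw t p.1 p.2 * e2pi (p.1 * z) * e2pi (p.2 * tau).
have -> : partial_sum (G : C * C -> C^o) A = - \sum_(i <- s) F i.
  transitivity (\sum_(p <- A) G p); first by rewrite big_seq_fsetE.
  rewrite sE /fl big_flatten /= big_map -sumrN.
  apply: eq_bigr => p _; rewrite /G /weight_trace !mulNr; congr (- _).
  rewrite !mulr_suml big_seq [RHS]big_seq; apply: eq_bigr => i.
  by rewrite -[i \in _]/(i \in fib p) fibP => /andP[Pi /eqP <-]; rewrite FE.
rewrite opprK addrC modulusE re ltcR; apply: hN => [i|].
  by rewrite seq_fsetE flP => /andP[].
apply/fsubsetP => i iD; rewrite seq_fsetE flP (D_P iD).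
by apply: (fsubsetP NA); apply/imfsetP; exists i.
Qed.

End Regroup.
End UnconditionalSums.

(** * Sums over occupation numbers *)

Section OccupationSums.
Variable R : realType.
Local Notation C := R[i].

Lemma big_fsetM (T : Type) (idx : T) (op : Monoid.com_law idx) (I J : choiceType)
    (A : {fset I}) (B : {fset J}) (F : I * J -> T) :
  \big[op/idx]_(p <- (A `*` B)%fset) F p
  = \big[op/idx]_(i <- A) \big[op/idx]_(j <- B) F (i, j).
Proof.
rewrite -big_allpairs; apply: perm_big; apply: uniq_perm.
- exact: fset_uniq.
- by apply: allpairs_uniq; rewrite ?fset_uniq // => -[a b] [c d] _ _ /=.
- case=> i j; rewrite in_fsetM /=; apply/andP/allpairsP => /= [[iA jB]|].
    by exists (i, j).
  by case=> -[a b] /= [aA bB [-> ->]].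
Qed.

Section Box.
Variables (m M : nat).

(** Occupations of the first [m] modes with at most [M] quanta each.  They are
enumerated through finite functions, over which a sum of products is a product
of sums. *)
Definition box_poly (f : {ffun 'I_m -> 'I_M.+1}) : {poly nat} :=
  \poly_(i < m) oapp (fun j => f j : nat) 0%N (insub i).

Definition occ_box : {fset {poly nat}} :=
  [fset box_poly f | f in [set: {ffun 'I_m -> 'I_M.+1}]%SET]%fset.

Lemma box_polyE f (j : 'I_m) : (box_poly f)`_j = f j.
Proof. by rewrite coef_poly ltn_ord valK. Qed.

Lemma box_poly_inj : injective box_poly.
Proof.
by move=> f g fg; apply/ffunP => j; apply: val_inj; rewrite /= -!box_polyE fg.
Qed.

Lemma occ_boxP (k : {poly nat}) : reflect
  ((size k <= m)%N /\ forall i, ((k`_i)%R <= M)%N) (k \in occ_box).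
Proof.
rewrite /occ_box; apply: (iffP (imfsetP _ _ _ _)) => [[f _ ->]|[km kM]].
  split=> [|i]; first exact: size_poly.
  rewrite coef_poly; case: ifP => // im.
  by rewrite (insubT (fun i => i < m)%N im) /= -ltnS ltn_ord.
exists [ffun j : 'I_m => inord (k`_j)%R]; first by rewrite /= inE.
apply/polyP => i; rewrite coef_poly; case: ltnP => im.
  by rewrite (insubT (fun i => i < m)%N im) /= ffunE inordK // ltnS.
by rewrite nth_default // (leq_trans km).
Qed.

Lemma occ_box_sum (phi : nat -> nat -> C) :
  \sum_(k <- occ_box) \prod_(i < m) phi i (k`_i)%R
  = \prod_(i < m) \sum_(j < M.+1) phi i j.
Proof.
rewrite bigA_distr_bigA big_imfset /=; last by move=> f g _ _; apply: box_poly_inj.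
rewrite big_enum_cond /=; apply: eq_big => [f|f _]; first by rewrite inE.
by apply: eq_bigr => i _; rewrite box_polyE.
Qed.

End Box.

Definition occ_weight (x : nat -> C) (k : {poly nat}) : C :=
  \prod_(i < size k) x i ^+ (k`_i)%R.

Lemma occ_weight_widen x m (k : {poly nat}) : (size k <= m)%N ->
  occ_weight x k = \prod_(i < m) x i ^+ (k`_i)%R.
Proof.
move=> km; rewrite /occ_weight (big_ord_widen _ (fun i => x i ^+ (k`_i)%R) km).
rewrite big_mkcond; apply: eq_bigr => i _; case: ltnP => // ki.
by rewrite nth_default.
Qed.

Lemma occ_weight_sum x m M :
  \sum_(k <- occ_box m M) occ_weight x k = \prod_(i < m) \sum_(j < M.+1) x i ^+ j.
Proof.
rewrite -(occ_box_sum m M (fun i j => x i ^+ j)) big_seq [RHS]big_seq.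
by apply: eq_bigr => k /occ_boxP[km _]; apply: occ_weight_widen.
Qed.

Lemma occ_weight_clifford x m :
  \sum_(k <- occ_box m 1) occ_weight x k = \prod_(i < m) (1 + x i).
Proof. by rewrite occ_weight_sum; under eq_bigr do rewrite big_ord_recl big_ord1. Qed.

(** With [x 0 = -1] the sum over the two occupations of the zero mode kills
every term but the one that counts that mode. *)
Lemma occ_charge_clifford (c0 : C) (c x : nat -> C) m : x 0%N = -1 ->
  \sum_(k <- occ_box m.+1 1) (c0 + \sum_(i < size k) c i *+ (k`_i)%R) * occ_weight x k
  = - c 0%N * \prod_(i < m) (1 + x i.+1).
Proof.
move=> x0.
(* The contribution of the quanta of one mode: unless it is the zero mode, the
   factor [1 + x 0] is still present. *)
have one i : \sum_(k <- occ_box m.+1 1) (k`_i)%R%:R * occ_weight x k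
    = if i == 0%N then - \prod_(j < m) (1 + x j.+1) else 0.
  have [im|im] := ltnP i m.+1; last first.
    rewrite big_seq big1 => [|k /occ_boxP[km _]].
      by rewrite (gtn_eqF (leq_trans _ im)).
    by rewrite nth_default ?mul0r // (leq_trans km).
  transitivity (\prod_(j < m.+1) \sum_(l < 2)
      (if val j == i then l%:R else 1) * x j ^+ l).
    rewrite -(occ_box_sum m.+1 1 (fun j l => (if j == i then l%:R else 1) * x j ^+ l)).
    rewrite big_seq [RHS]big_seq; apply: eq_bigr => k /occ_boxP[km _].
    rewrite (occ_weight_widen _ km) big_split /=; congr (_ * _).
    rewrite (bigD1 (Ordinal im)) //= eqxx big1 ?mulr1 // => j ji.
    by rewrite (negPf (_ : val j != i)).
  case: eqP => [->|/eqP i0].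
    rewrite big_ord_recl /= big_ord_recl big_ord1 mul0r add0r expr1 x0 mul1r mulN1r.
    by congr (- _); apply: eq_bigr => j _; rewrite big_ord_recl big_ord1 !mul1r.
  by rewrite big_ord_recl /= eq_sym (negPf i0) big_ord_recl big_ord1 !mul1r x0 subrr mul0r.
under eq_bigr do rewrite mulrDl.
rewrite big_split /= -mulr_sumr occ_weight_clifford big_ord_recl x0 subrr mul0r mulr0 add0r.
transitivity (\sum_(k <- occ_box m.+1 1) \sum_(i < m.+1) c i * ((k`_i)%R%:R * occ_weight x k)).
  rewrite big_seq [RHS]big_seq; apply: eq_bigr => k /occ_boxP[km _].
  rewrite mulr_suml (big_ord_widen _ (fun i => c i *+ (k`_i)%R * occ_weight x k) km).
  rewrite big_mkcond; apply: eq_bigr => i _; rewrite mulrA mulr_natr; case: ltnP => // ki.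
  by rewrite [k`_i]nth_default // mulr0n mul0r.
rewrite exchange_big /=; under eq_bigr do rewrite -mulr_sumr one.
set p := \prod_(i < m) _.
rewrite (bigD1 ord0) //= big1 ?addr0 => [|i i0]; last by rewrite (negPf (i0 : val i != 0%N)) mulr0.
by rewrite mulrN mulNr.
Qed.

Lemma occ_modulus_sum x m M :
  \sum_(k <- occ_box m M) modulus (occ_weight x k)
  = \prod_(i < m) \sum_(j < M.+1) modulus (x i) ^+ j.
Proof.
apply: complexI; rewrite rmorph_sum rmorph_prod /=.
transitivity (\sum_(k <- occ_box m M) occ_weight (fun i => (modulus (x i))%:C%C) k).
  apply: eq_bigr => k _; rewrite /occ_weight modulus_prod rmorph_prod.
  by apply: eq_bigr => i _; rewrite modulusX rmorphXn.
rewrite occ_weight_sum; apply: eq_bigr => i _; rewrite rmorph_sum.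
by apply: eq_bigr => j _; rewrite rmorphXn.
Qed.

Lemma modulus_nat n : modulus (n%:R : C) = n%:R.
Proof. by apply: complexI; rewrite -modulusE normr_nat rmorph_nat. Qed.

Lemma clifford_bound (x : nat -> C) m (B : R) : \sum_(i < m) modulus (x i) <= B ->
  \sum_(k <- occ_box m 1) modulus (occ_weight x k) <= expR B.
Proof.
move=> hB; rewrite occ_modulus_sum; under eq_bigr do rewrite big_ord_recl big_ord1 expr0 expr1.
apply: le_trans (prod1D_le_exp _ (a := fun i => modulus (x i)) _) _ => [i|].
  exact: modulus_ge0.
by rewrite ler_expR.
Qed.

(** The charge is at most one plus the number of quanta, hence at most 2 to the
number of quanta; this doubles the weight of every mode. *)
Lemma clifford_charge_bound (c0 : C) (c x : nat -> C) m (B : R) :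
  modulus c0 <= 1 -> (forall i, modulus (c i) <= 1) -> \sum_(i < m) modulus (x i) <= B ->
  \sum_(k <- occ_box m 1)
    modulus ((c0 + \sum_(i < size k) c i *+ (k`_i)%R) * occ_weight x k) <= expR (2 * B).
Proof.
move=> hc0 hc hB.
apply: le_trans (clifford_bound (x := fun i => 2 * x i) (m := m) (B := 2 * B) _); last first.
  under eq_bigr do rewrite modulusM (modulus_nat 2).
  by rewrite -mulr_sumr ler_wpM2l.
apply: ler_sum => k _.
have -> : occ_weight (fun i => 2 * x i) k = 2 ^+ (\sum_(i < size k) (k`_i)%R)%N * occ_weight x k.
  rewrite /occ_weight -prodrXr -big_split /=; apply: eq_bigr => i _.
  by rewrite exprMn.
rewrite !modulusM modulusX ler_wpM2r ?modulus_ge0 //.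
rewrite (modulus_nat 2) -natrX; apply: le_trans (_ : (1 + \sum_(i < size k) (k`_i)%R)%N%:R <= _).
  rewrite natrD natr_sum; apply: le_trans (modulusD _ _) _; apply: lerD => //.
  apply: le_trans (modulus_sum _ _ _) _; apply: ler_sum => i _.
  by rewrite -[c i *+ _]mulr_natr modulusM modulus_nat ler_piMl.
by rewrite ler_nat add1n ltn_expl.
Qed.

(** A geometric series of ratio [a <= rho] is at most [1 + a / (1 - rho)], which
reduces the Weyl case to the Clifford case. *)
Lemma weyl_bound (x : nat -> C) m M (rho B : R) : rho < 1 -> (forall i, modulus (x i) <= rho) ->
  \sum_(i < m) modulus (x i) <= B ->
  \sum_(k <- occ_box m M) modulus (occ_weight x k) <= expR ((1 - rho)^-1 * B).
Proof.
move=> r1 hr hB; have d0 : 0 < 1 - rho by rewrite subr_gt0.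
rewrite occ_modulus_sum.
apply: le_trans (_ : \prod_(i < m) (1 + (1 - rho)^-1 * modulus (x i)) <= _).
  apply: ler_prod => i _; rewrite sumr_ge0 /= => [|j _]; last by rewrite exprn_ge0 ?modulus_ge0.
  set a := modulus (x i); have a0 : 0 <= a by exact: modulus_ge0.
  have ar : a <= rho by exact: hr.
  have a1 : a < 1 by exact: le_lt_trans ar r1.
  rewrite big_ord_recl expr0 lerD2l; under eq_bigr do rewrite exprS.
  rewrite -mulr_sumr mulrC ler_wpM2r //; apply: le_trans (geometric_bound _ a0 a1) _.
  by rewrite lef_pV2 ?posrE ?subr_gt0 // lerB.
apply: le_trans (prod1D_le_exp _ (a := fun i => (1 - rho)^-1 * modulus (x i)) _) _ => [i|].
  by rewrite mulr_ge0 ?modulus_ge0 // invr_ge0 ltW.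
by rewrite ler_expR -mulr_sumr ler_wpM2l // invr_ge0 ltW.
Qed.

(** The geometric series of a Weyl mode, truncated at order [N], is
[(1 - x ^+ N.+1) / (1 - x)].  The product of these numerators over any number of
modes differs from 1 by at most a multiple of [B * rho ^+ N]. *)
Lemma weyl_truncation (x : nat -> C) (m : nat -> nat) (rho B : R) :
  0 <= rho -> rho < 1 -> (forall i, modulus (x i) <= rho) ->
  (forall n, \sum_(i < n) modulus (x i) <= B) ->
  slim (fun N => \prod_(i < m N) (1 - x i ^+ N.+1)) 1.
Proof.
move=> r0 r1 hr hB; have B0 : 0 <= B by have := hB 0%N; rewrite big_ord0.
have eB : 0 < expR B by exact: expR_gt0.
have key N n : modulus (\prod_(i < n) (1 - x i ^+ N.+1) - 1) <= expR B * (B * rho ^+ N).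
  have us k : \sum_(i < k) modulus (x i ^+ N.+1) <= B * rho ^+ N.
    apply: le_trans (ler_wpM2r (exprn_ge0 N r0) (hB k)); rewrite mulr_suml.
    apply: ler_sum => i _; rewrite modulusX exprS ler_wpM2l ?modulus_ge0 //.
    by apply: lerXn2r; rewrite ?nnegrE ?modulus_ge0.
  have pb k : modulus (\prod_(i < k) (1 - x i ^+ N.+1)) <= expR B.
    rewrite modulus_prod; apply: le_trans (_ : \prod_(i < k) (1 + modulus (x i ^+ N.+1)) <= _).
      apply: ler_prod => i _; rewrite modulus_ge0 /=.
      by apply: le_trans (modulusD _ _) _; rewrite modulus1 modulusN.
    apply: le_trans (prod1D_le_exp _ (a := fun i => modulus (x i ^+ N.+1)) _) _ => [i|].
      exact: modulus_ge0.
    rewrite ler_expR; apply: le_trans (us k) _; rewrite ler_piMr //.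
    by rewrite exprn_ile1 // ltW.
  apply: le_trans (_ : expR B * \sum_(i < n) modulus (x i ^+ N.+1) <= _); last first.
    by rewrite ler_pM2l.
  elim: n => [|n IH]; first by rewrite !big_ord0 subrr modulus0 mulr0.
  rewrite !big_ord_recr /= [leRHS]mulrDr.
  set p := \prod_(i < n) _; set y := x n ^+ _.
  have -> : p * (1 - y) - 1 = (p - 1) + - (p * y) by ring.
  apply: le_trans (modulusD _ _) _; apply: lerD; first exact: IH.
  by rewrite modulusN modulusM ler_wpM2r ?modulus_ge0 //; apply: pb.
apply/slim_modulus => e e0.
have c0 : 0 < expR B * B + 1 by rewrite ltr_wpDl // mulr_ge0 // ltW.
have /slimP /(_ (e / (expR B * B + 1))) : slim (fun n => rho ^+ n) 0.
  by apply: cvg_expr; rewrite ger0_norm.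
case=> [|N hN]; first by rewrite divr_gt0.
exists N => n /hN; rewrite subr0 ger0_norm ?exprn_ge0 // ltr_pdivlMr // => h.
apply: le_lt_trans (key n (m n)) _; apply: le_lt_trans h.
rewrite mulrA mulrC ler_wpM2l ?exprn_ge0 // lerDl //.
Qed.

End OccupationSums.

(** * Exponentials and the weights of the modes *)

Section Exponential.
Variable R : realType.
Local Notation C := R[i].
Local Notation e := (@e2pi R).

Lemma cexpD (x y : C) : cexp (x + y) = cexp x * cexp y.
Proof.
case: x y => a b [c d]; rewrite /cexp /= expRD cosD sinD.
by simpc; congr (_ +i* _)%C; ring.
Qed.

Lemma e2piD x y : e (x + y) = e x * e y.
Proof. by rewrite /e2pi mulrDr cexpD. Qed.

Lemma e2pi0 : e 0 = 1.
Proof. by rewrite /e2pi mulr0 /cexp /= expR0 cos0 sin0 mul1r. Qed.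

Lemma e2pi_neq0 x : e x != 0.
Proof.
apply: contraTneq isT => x0; have := e2piD x (- x).
by rewrite subrr e2pi0 x0 mul0r => /eqP; rewrite oner_eq0.
Qed.

Lemma e2piN x : e (- x) = (e x)^-1.
Proof. by apply: (mulfI (e2pi_neq0 x)); rewrite -e2piD subrr e2pi0 divff ?e2pi_neq0. Qed.

Lemma e2piMn n x : e (x *+ n) = e x ^+ n.
Proof. by elim: n => [|n IH]; rewrite ?mulr0n ?e2pi0 // mulrS e2piD IH exprS. Qed.

Lemma e2pi_nat n x : e (n%:R * x) = e x ^+ n.
Proof. by rewrite mulr_natl e2piMn. Qed.

Lemma e2pi_sum (I : Type) (r : seq I) (P : pred I) (F : I -> C) :
  e (\sum_(i <- r | P i) F i) = \prod_(i <- r | P i) e (F i).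
Proof. exact: (big_morph e e2piD e2pi0). Qed.

Lemma modulus_e2pi x : modulus (e x) = expR (- (2 * pi * complex.Im x)).
Proof.
apply: complexI; rewrite -modulusE /e2pi /cexp.
have -> : complex.Re (2 * (pi : R)%:C%C * 'i%C * x) = - (2 * pi * complex.Im x).
  by case: x => a b; simpc => /=; ring.
rewrite normrM; set t := complex.Im (2 * _ * _ * _).
have -> : `|(cos t +i* sin t)%C| = 1 by rewrite normc_def /= cos2Dsin2 sqrtr1.
by rewrite mulr1 normc_def /= expr0n addr0 sqrtr_sqr ger0_norm ?expR_ge0.
Qed.

Lemma e2pi1 : e 1 = 1.
Proof.
rewrite /e2pi /cexp mulr1.
have -> : complex.Re (2 * (pi : R)%:C%C * 'i%C) = 0 by simpc => /=; ring.
have -> : complex.Im (2 * (pi : R)%:C%C * 'i%C) = pi *+ 2 by simpc => /=; ring.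
by rewrite expR0 cos2pi sin2pi mul1r.
Qed.

Lemma modulus_lt1 x : 0 < complex.Im x -> modulus (e x) < 1.
Proof.
move=> h; rewrite modulus_e2pi -expR0 ltr_expR oppr_lt0.
by rewrite !mulr_gt0 // pi_gt0.
Qed.

End Exponential.

Section ModeWeights.
Variable R : realType.
Local Notation C := R[i].
Variables (n : nat) (lam : 'I_n -> C) (Y q : C).
Hypothesis n0 : (0 < n)%N.

(** A quantum in mode [i] multiplies the term by this factor, where [Y] is the
value of a unit of charge. *)
Definition mode_weight (i : nat) : C :=
  mode_eigen lam i * (if (i %% n.*2 < n)%N then Y^-1 else Y) * q ^+ mode_level n i.

(** The first [N * n.*2] modes are those of [N] complete levels. *)
Lemma mode_weight_prod (G : C -> C) N :
  \prod_(i < N * n.*2) G (mode_weight i)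
  = \prod_(r < n) ((\prod_(l < N) G ((lam r)^-1 * Y^-1 * q ^+ l))
                   * \prod_(l < N) G (lam r * Y * q * q ^+ l)).
Proof.
under [RHS]eq_bigr do rewrite -big_split /=.
rewrite exchange_big /= -(big_mkord xpredT (fun i => G (mode_weight i))).
rewrite big_nat_mul big_mkord; apply: eq_bigr => l _.
have n20 : (0 < n.*2)%N by rewrite double_gt0.
rewrite mulSn -{1}[(l * n.*2)%N]add0n big_addn addnK.
rewrite (@big_cat_nat _ _ _ n) //=; last by rewrite -addnn leq_addr.
rewrite -[X in _ * (\prod_(X <= i < _) _)]add0n big_addn -addnn addnK !big_mkord -big_split /=; apply: eq_bigr => r _.
have nm (F : 'I_n -> C) : [seq F j | j <- enum 'I_n]`_r = F r.
  by rewrite (nth_map r) ?size_enum_ord //; congr F; apply: val_inj; rewrite /= nth_enum_ord.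
have rn : (r < n + n)%N by apply: ltn_addl.
have rn' : (r + n < n + n)%N by rewrite ltn_add2r.
congr (G _ * G _); rewrite /mode_weight /mode_eigen /mode_level -!addnn.
  rewrite [(r + _)%N]addnC modnMDl divnMDl ?addnn // -addnn modn_small // divn_small // addn0.
  by rewrite ltn_ord nm.
rewrite [(r + n + _)%N]addnC modnMDl divnMDl ?addnn // -addnn modn_small // divn_small // addn0.
by rewrite ltnNge leq_addl /= addnK nm exprS; ring.
Qed.

Hypothesis lam1 : forall j, modulus (lam j) = 1.

Let rho : R := Num.max (modulus Y^-1) (modulus (Y * q)).

Lemma mode_eigen_modulus i : modulus (mode_eigen lam i) = 1.
Proof.
have n20 : (0 < n.*2)%N by rewrite double_gt0.
have nm (F : 'I_n -> C) r : (r < n)%N -> exists j, [seq F j | j <- enum 'I_n]`_r = F j.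
  move=> rn; exists (Ordinal rn); rewrite (nth_map (Ordinal rn)) ?size_enum_ord //.
  by congr F; apply: val_inj; rewrite /= nth_enum_ord.
rewrite /mode_eigen; case: ltnP => h.
  by have [j ->] := nm (fun j => (lam j)^-1) _ h; rewrite modulusV lam1 invr1.
have h' : (i %% n.*2 - n < n)%N by rewrite ltn_subLR // addnn ltn_mod.
by have [j ->] := nm lam _ h'.
Qed.

Lemma mode_weight_le i : modulus q < 1 ->
  modulus (mode_weight i) <= rho * modulus q ^+ (i %/ n.*2).
Proof.
move=> q1; rewrite /mode_weight !modulusM mode_eigen_modulus mul1r modulusX /mode_level.
case: ltnP => _; first by rewrite ler_wpM2r ?exprn_ge0 ?modulus_ge0 // le_max lexx.
rewrite exprS mulrA ler_wpM2r ?exprn_ge0 ?modulus_ge0 //.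
by rewrite /rho modulusM le_max lexx orbT.
Qed.

Lemma rho_ge0 : 0 <= rho.
Proof. by rewrite le_max modulus_ge0. Qed.

Lemma mode_weight_rho i : modulus q < 1 -> modulus (mode_weight i) <= rho.
Proof.
move=> q1; apply: le_trans (mode_weight_le i q1) _.
by rewrite ler_piMr ?rho_ge0 // exprn_ile1 ?modulus_ge0 // ltW.
Qed.

Lemma mode_weight_summable m : modulus q < 1 ->
  \sum_(i < m) modulus (mode_weight i) <= n.*2%:R * rho * (1 - modulus q)^-1.
Proof.
move=> q1; have n20 : (0 < n.*2)%N by rewrite double_gt0.
apply: le_trans (_ : \sum_(0 <= i < m * n.*2) modulus (mode_weight i) <= _).
  rewrite -(big_mkord xpredT (fun i => modulus (mode_weight i))).
  rewrite [leRHS](@big_cat_nat _ _ _ m) //=; last by rewrite leq_pmulr.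
  by rewrite lerDl sumr_ge0 // => i _; apply: modulus_ge0.
rewrite big_nat_mul big_mkord.
apply: le_trans (_ : \sum_(l < m) n.*2%:R * rho * modulus q ^+ l <= _).
  apply: ler_sum => l _; rewrite mulSn -{1}[(l * n.*2)%N]add0n big_addn addnK big_mkord.
  rewrite -mulrA mulr_natl -[X in _ *+ X]card_ord -sumr_const; apply: ler_sum => r _.
  apply: le_trans (mode_weight_le _ q1) _.
  by rewrite addnC divnMDl // divn_small // addn0.
by rewrite -mulr_sumr ler_wpM2l ?mulr_ge0 ?rho_ge0 // geometric_bound ?modulus_ge0.
Qed.

End ModeWeights.

Section ModeExponents.
Variables (R : realType) (n : nat) (lam : 'I_n -> R[i]) (tau z : R[i]).

Lemma occ_weight_mode (k : {poly nat}) :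
  occ_weight (mode_weight lam (e2pi z) (e2pi tau)) k
  = (\prod_(i < size k) mode_eigen lam i ^+ (k`_i)%R)
    * e2pi ((\sum_(i < size k) mode_charge R[i] n i *+ (k`_i)%R) * z)
    * e2pi ((\sum_(i < size k) (mode_level n i)%:R *+ (k`_i)%R) * tau).
Proof.
rewrite !mulr_suml !e2pi_sum -!big_split /=; apply: eq_bigr => i _.
rewrite [X in _ * e2pi X * _]mulrnAl [X in _ * _ * e2pi X]mulrnAl 2!e2piMn -2!exprMn e2pi_nat; congr ((_ * _ * _) ^+ _).
by rewrite /mode_charge; case: ifP => _; rewrite ?mulN1r ?mul1r ?e2piN.
Qed.

End ModeExponents.

(** * The generating function of the twisted module *)

Section Limits.
Variable R : realType.
Local Notation C := R[i].

Lemma slim_shift (f : nat -> C) l : slim f l -> slim (fun N => f N.+1) l.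
Proof.
move/slimP => h; apply/slimP => e e0; have [N hN] := h e e0.
by exists N => n /leqW; apply: hN.
Qed.

Lemma slim_prod (I : eqType) (r : seq I) (F : I -> nat -> C) (l : I -> C) :
  (forall i, i \in r -> slim (F i) (l i)) ->
  slim (fun N => \prod_(i <- r) F i N) (\prod_(i <- r) l i).
Proof.
elim: r => [|i r IH] h.
  by rewrite big_nil; apply: slim_ext (slim_cst (l := 1)) => N; rewrite big_nil.
have {}IH := IH (fun j jr => h j (mem_behead (s := i :: r) jr)).
by rewrite big_cons; apply: slim_ext (slimM (h i (mem_head i r)) IH) => N; rewrite big_cons.
Qed.

End Limits.

Section FactorLimits.
Variables (R : realType).
Local Notation C := R[i].
Variable q : C.
Hypothesis q1 : modulus q < 1.

Let qpoch_cvg1 a : slim (fun N => qpoch a q N.+1) (qinf a q).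
Proof. by apply: slim_shift; apply: qpoch_cvg. Qed.

(** The eigenvalues [- lam j] account for the action of (-1)^F. *)
Lemma clifford_factor n (lam : 'I_n -> C) Y : (0 < n)%N ->
  slim (fun N => \sum_(k <- occ_box (N.+1 * n.*2) 1)
                   occ_weight (mode_weight (fun j => - lam j) Y q) k)
       (\prod_(j < n) (qinf ((lam j)^-1 * Y^-1) q * qinf (lam j * Y * q) q)).
Proof.
move=> n0; have h : slim (fun N => \prod_(j < n) (qpoch ((lam j)^-1 * Y^-1) q N.+1 * qpoch (lam j * Y * q) q N.+1))
      (\prod_(j < n) (qinf ((lam j)^-1 * Y^-1) q * qinf (lam j * Y * q) q)).
  by apply: slim_prod => j _; apply: slimM; apply: qpoch_cvg1.
apply: slim_ext h => N.
rewrite occ_weight_clifford (mode_weight_prod _ _ _ n0 (fun x => 1 + x)).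
apply: eq_bigr => j _; rewrite /qpoch; congr (_ * _); apply: eq_bigr => l _.
  by rewrite invrN !mulNr.
by rewrite !mulNr.
Qed.

Lemma weyl_factor n (mu : 'I_n -> C) Y : (0 < n)%N -> (forall j, modulus (mu j) = 1) ->
  modulus Y^-1 < 1 -> modulus (Y * q) < 1 ->
  slim (fun N => \sum_(k <- occ_box (N.+1 * n.*2) N) occ_weight (mode_weight mu Y q) k)
       (\prod_(j < n) (qinf ((mu j)^-1 * Y^-1) q * qinf (mu j * Y * q) q))^-1.
Proof.
move=> n0 mu1 Y1 Yq1; set x := mode_weight mu Y q.
have [rho [r0 r1 hr]] : exists rho, [/\ 0 <= rho, rho < 1 & forall i, modulus (x i) <= rho].
  exists (Num.max (modulus Y^-1) (modulus (Y * q))); split.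
  - exact: rho_ge0.
  - by rewrite gt_max Y1.
  - by move=> i; apply: mode_weight_rho.
have hB m := mode_weight_summable Y n0 mu1 m q1.
have hP : slim (fun N => \prod_(i < N.+1 * n.*2) (1 - x i))
    (\prod_(j < n) (qinf ((mu j)^-1 * Y^-1) q * qinf (mu j * Y * q) q)).
  have h : slim (fun N => \prod_(j < n) (qpoch ((mu j)^-1 * Y^-1) q N.+1 * qpoch (mu j * Y * q) q N.+1))
      (\prod_(j < n) (qinf ((mu j)^-1 * Y^-1) q * qinf (mu j * Y * q) q)).
  by apply: slim_prod => j _; apply: slimM; apply: qpoch_cvg1.
apply: slim_ext h => N.
  by rewrite (mode_weight_prod _ _ _ n0 (fun x => 1 - x)).
have hT := weyl_truncation (fun N => N.+1 * n.*2)%N r0 r1 hr hB.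
have L0 : \prod_(j < n) (qinf ((mu j)^-1 * Y^-1) q * qinf (mu j * Y * q) q) != 0.
  apply/prodf_neq0 => j _; rewrite mulf_neq0 // qinf_neq0 //.
    by rewrite modulusM modulusV mu1 invr1 mul1r.
  by rewrite -mulrA modulusM mu1 mul1r.
rewrite -[X in slim _ X]mul1r; apply: slim_ext (slimM hT (slimV L0 hP)) => N.
rewrite occ_weight_sum -prodf_div; apply: eq_bigr => i _.
have x1 : 1 - x i != 0.
  rewrite subr_eq0; apply/eqP => e1; have := hr i; rewrite -e1 modulus1.
  by rewrite leNgt r1.
apply: (mulIf x1); rewrite divfK // mulrC.
by rewrite -[LHS]opprB subrX1 -mulNr opprB.
Qed.

(** Apart from the zero mode, which has weight -1, the modes have the weights
[- q, - q, - q^2, - q^2], and so on; cutting off after complete levels leaves one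
of the two products of [1 - q^n] one factor shorter than the other. *)
Lemma zero_mode_factor :
  slim (fun N => \sum_(k <- occ_box (N.+1 * 2) 1)
    (1 / 2 + \sum_(i < size k) mode_charge C 1 i *+ (k`_i)%R)
      * occ_weight (mode_weight (fun _ : 'I_1 => - 1) 1 q) k)
  (qinf q q ^+ 2).
Proof.
set x := mode_weight _ _ _.
have x_even l : x (l * 2)%N = - q ^+ l.
  rewrite /x /mode_weight /mode_eigen /mode_level modnMl mulnK //= enum_ordSl /=.
  by rewrite invrN invr1 mulr1 mulN1r.
have x_odd l : x (l * 2).+1%N = - q ^+ l.+1.
  rewrite /x /mode_weight /mode_eigen /mode_level -[1.*2]/2%N -[(l * 2).+1]addn1 modnMDl divnMDl //= addn0 enum_ordSl /=.
  by rewrite mulr1 mulN1r.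
rewrite expr2; have h := slimM (qpoch_cvg (a := q) q1) (@qpoch_cvg1 q).
apply: slim_ext h => N.
have -> : (N.+1 * 2 = (N * 2).+2)%N by rewrite mulSn.
rewrite occ_charge_clifford; last by rewrite (x_even 0%N) expr0.
rewrite /mode_charge mod0n /= opprK mul1r.
elim: N => [|N IH].
  by rewrite big_ord_recl big_ord0 (x_odd 0%N) /qpoch !(big_ord0, big_ord_recl) !mulr1 mul1r expr1.
rewrite (_ : (N.+1 * 2).+1 = (N * 2).+3)%N; last by rewrite mulSn.
rewrite big_ord_recr big_ord_recr /= -IH.
have qS M : qpoch q q M.+1 = qpoch q q M * (1 - q * q ^+ M) by rewrite /qpoch big_ord_recr.
rewrite !qS.
have -> : x (N * 2).+2 = - q ^+ N.+1 by rewrite -(x_even N.+1) mulSn.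
have -> : x (N * 2).+3 = - q ^+ N.+2 by rewrite -(x_odd N.+1) mulSn.
by rewrite !exprS; ring.
Qed.

End FactorLimits.

Section W4Sum.
Variables (R : realType).
Local Notation C := R[i].
Local Notation I := ((({poly nat} * {poly nat}) * {poly nat})%type).

Definition w4_valid : pred I :=
  fun p => (occ_valid true p.1.1 && occ_valid true p.1.2) && occ_valid false p.2.

(** The number of modes and the bound on the Weyl occupations grow together, so
that a single limit suffices. *)
Definition w4_box (N : nat) : {fset I} :=
  ((occ_box (N.+1 * 2) 1 `*` occ_box (N.+1 * 6) 1) `*` occ_box (N.+1 * 8) N)%fset.

Lemma occ_validE (k : {poly nat}) : reflect (forall i, ((k`_i)%R <= 1)%N) (occ_valid true k).
Proof.
apply: (iffP (all_nthP 0)) => h i; last by move=> _; apply: h.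
by case: (ltnP i (size k)) => [/h //|hi]; rewrite nth_default.
Qed.

Lemma w4_box_valid N p : p \in w4_box N -> w4_valid p.
Proof.
rewrite !in_fsetM => /andP[/andP[/occ_boxP[_ h1] /occ_boxP[_ h2]] _].
by rewrite /w4_valid andbT; apply/andP; split; apply/occ_validE.
Qed.

Lemma w4_box_mono N M : (N <= M)%N -> (w4_box N `<=` w4_box M)%fset.
Proof.
move=> NM; apply/fsubsetP => p; rewrite !in_fsetM.
case/andP => /andP[/occ_boxP[s1 h1] /occ_boxP[s2 h2] /occ_boxP[s3 h3]].
have le m : (N.+1 * m <= M.+1 * m)%N by rewrite leq_mul2r ltnS NM orbT.
apply/andP; split; [apply/andP; split|]; apply/occ_boxP; split=> [|i] //;
  try exact: leq_trans (le _); exact: leq_trans (h3 i) NM.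
Qed.

Lemma w4_box_exh p : w4_valid p -> exists N, p \in w4_box N.
Proof.
case: p => -[ke ka] kb; rewrite /w4_valid andbT /= => /andP[/occ_validE h1 /occ_validE h2].
exists (size ke + size ka + size kb + \sum_(i < size kb) (kb`_i)%R)%N.
set N := (_ + _ + _ + _)%N.
have le m s : (0 < m)%N -> (s <= N)%N -> (s <= N.+1 * m)%N.
  by move=> m0 sN; apply: leq_trans (leq_pmulr _ m0); apply: leq_trans sN _.
rewrite !in_fsetM /=; apply/andP; split; [apply/andP; split|]; apply/occ_boxP; split=> //.
1-3: by apply: le => //; rewrite /N; move: (\sum_(_ < _) _)%N => w; lia.
move=> i; case: (ltnP i (size kb)) => hi; last by rewrite nth_default.
apply: leq_trans (_ : (\sum_(i < size kb) (kb`_i)%R <= N)%N); last by rewrite /N leq_addl.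
by rewrite (bigD1 (Ordinal hi)) //= leq_addr.
Qed.

Variables (lam : 'I_3 -> C) (mu : 'I_4 -> C) (y q : C).
Hypotheses (lam1 : forall j, modulus (lam j) = 1) (mu1 : forall j, modulus (mu j) = 1).

(** The charge insertion, with constant [c0] and charges [c], is kept general: with
[c0 = 1] and [c = 0] the term has a modulus that depends on its weight only. *)
Definition w4_term (c0 : C) (c : nat -> C) (p : I) : C :=
  y * (((c0 + \sum_(i < size p.1.1) c i *+ (p.1.1`_i)%R)
         * occ_weight (mode_weight (fun _ : 'I_1 => - 1) 1 q) p.1.1
       * occ_weight (mode_weight (fun j => - lam j) (y ^+ 2) q) p.1.2)
       * occ_weight (mode_weight mu y q) p.2).

Definition w4_limit : C :=
  y * (qinf q q ^+ 2
   * (\prod_(j < 3) (qinf ((lam j)^-1 * (y ^+ 2)^-1) q * qinf (lam j * y ^+ 2 * q) q))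
   * (\prod_(j < 4) (qinf ((mu j)^-1 * y^-1) q * qinf (mu j * y * q) q))^-1).

Lemma big_fsetM_mul (K : comPzRingType) (J1 J2 : choiceType) (A : {fset J1}) (B : {fset J2}) (F : J1 -> K) (G : J2 -> K) :
  \sum_(p <- (A `*` B)%fset) F p.1 * G p.2 = (\sum_(i <- A) F i) * \sum_(j <- B) G j.
Proof.
rewrite big_fsetM mulr_suml; apply: eq_bigr => i _ /=.
by rewrite mulr_sumr.
Qed.

Hypotheses (q1 : modulus q < 1) (y1 : modulus y^-1 < 1) (yq1 : modulus (y * q) < 1).

Lemma w4_sum_limit : slim (fun N => \sum_(p <- w4_box N) w4_term (1 / 2) (mode_charge C 1) p) w4_limit.
Proof.
have h2 := @clifford_factor _ _ q1 3 lam (y ^+ 2) isT.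
have h3 := @weyl_factor _ _ q1 4 mu y isT mu1 y1 yq1.
have h := slimM (slim_cst (l := y)) (slimM (slimM (zero_mode_factor q1) h2) h3).
apply: slim_ext h => N /=.
by rewrite -big_fsetM_mul -big_fsetM_mul mulr_sumr.
Qed.

(** The boxes are products, and so are the bounds of the three factors. *)
Lemma w4_sum_bound (c0 : C) (c : nat -> C) :
  modulus c0 <= 1 -> (forall i, modulus (c i) <= 1) ->
  exists B, forall N, \sum_(p <- w4_box N) modulus (w4_term c0 c p) <= B.
Proof.
move=> hc0 hc; have nlam1 j : modulus (- lam j) = 1 by rewrite modulusN.
have m11 (j : 'I_1) : modulus (-1 : C) = 1 by rewrite modulusN modulus1.
have bnd n (nu : 'I_n -> C) Y : (0 < n)%N -> (forall j, modulus (nu j) = 1) ->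
    exists B, forall m, \sum_(i < m) modulus (mode_weight nu Y q i) <= B.
  by move=> n0 nu1; eexists => m; exact: (mode_weight_summable Y n0 nu1 m q1).
have [B1 hB1] := bnd 1%N (fun=> -1) 1 isT m11.
have [B2 hB2] := bnd 3%N (fun j => - lam j) (y ^+ 2) isT nlam1.
have [B3 hB3] := bnd 4%N mu y isT mu1.
have hr i : modulus (mode_weight mu y q i) <= Num.max (modulus y^-1) (modulus (y * q)).
  exact: mode_weight_rho.
have r1 : Num.max (modulus y^-1) (modulus (y * q)) < 1 by rewrite gt_max y1.
exists (modulus y * (expR (2 * B1) * expR B2
  * expR ((1 - Num.max (modulus y^-1) (modulus (y * q)))^-1 * B3))) => N.
have -> : \sum_(p <- w4_box N) modulus (w4_term c0 c p) = modulus y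
   * ((\sum_(k <- occ_box (N.+1 * 2) 1)
         modulus ((c0 + \sum_(i < size k) c i *+ (k`_i)%R)
           * occ_weight (mode_weight (fun _ : 'I_1 => - 1) 1 q) k))
   * (\sum_(k <- occ_box (N.+1 * 6) 1)
         modulus (occ_weight (mode_weight (fun j => - lam j) (y ^+ 2) q) k))
   * (\sum_(k <- occ_box (N.+1 * 8) N) modulus (occ_weight (mode_weight mu y q) k))).
  rewrite -big_fsetM_mul -big_fsetM_mul mulr_sumr; apply: eq_bigr => p _.
  by rewrite /w4_term 3!modulusM.
rewrite ler_wpM2l ?modulus_ge0 //.
apply: ler_pM; first by rewrite mulr_ge0 ?sumr_ge0 // => k _; apply: modulus_ge0.
- by rewrite sumr_ge0 // => k _; apply: modulus_ge0.
- apply: ler_pM; try by rewrite sumr_ge0 // => k _; apply: modulus_ge0.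
    exact: clifford_charge_bound hc0 hc (hB1 _).
  exact: clifford_bound (hB2 _).
- exact: weyl_bound r1 hr (hB3 _).
Qed.

End W4Sum.

(** * Characteristic polynomials from character values *)

(** A pair [(c, d)] in these lists stands for a factor [1 - c X^d] of the
characteristic polynomial. *)
Definition chi2_factors (K : pzRingType) (c : cls336) (w : K) : seq (K * nat) :=
  match c with
  | C1A | C2A => [:: (1, 1%N); (1, 1%N); (1, 1%N)]
  | C4A => [:: (1, 1%N); (-1, 1%N); (-1, 1%N)]
  | C3A | C6A => [:: (1, 3%N)]
  | C8A | C8B => [:: (1, 1%N); (-1, 2%N)]
  | C7A | C7B | C14A | C14B => [:: (w, 1%N); (w ^+ 2, 1%N); (w ^+ 4, 1%N)]
  end.

Definition chi8_factors (K : pzRingType) (c : cls336) (w : K) : seq (K * nat) :=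
  match c with
  | C1A => [:: (1, 1%N); (1, 1%N); (1, 1%N); (1, 1%N)]
  | C2A => [:: (-1, 1%N); (-1, 1%N); (-1, 1%N); (-1, 1%N)]
  | C4A => [:: (-1, 2%N); (-1, 2%N)]
  | C3A => [:: (1, 1%N); (1, 3%N)]
  | C6A => [:: (-1, 1%N); (-1, 3%N)]
  | C8A | C8B => [:: (-1, 4%N)]
  | C7A | C7B => [:: (1, 1%N); (w, 1%N); (w ^+ 2, 1%N); (w ^+ 4, 1%N)]
  | C14A | C14B => [:: (-1, 1%N); (- w, 1%N); (- w ^+ 2, 1%N); (- w ^+ 4, 1%N)]
  end.

Section CharacteristicPolynomials.
Variable R : realType.
Local Notation C := R[i].

(** Newton's identities, with denominators cleared. *)
Lemma newton3 (K : fieldType) (l : 'I_3 -> K) (X : K) : let p k := \sum_j l j ^+ k in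
  6%:R * \prod_j (1 - l j * X) = 6%:R - 6%:R * p 1%N * X
    + 3%:R * (p 1%N ^+ 2 - p 2) * X ^+ 2
    - (p 1%N ^+ 3 - 3%:R * p 1%N * p 2 + 2 * p 3) * X ^+ 3.
Proof. by rewrite /= !big_ord_recr !big_ord0 /=; ring. Qed.

Lemma newton4 (K : fieldType) (l : 'I_4 -> K) (X : K) : let p k := \sum_j l j ^+ k in
  24%:R * \prod_j (1 - l j * X) = 24%:R - 24%:R * p 1%N * X
    + 12%:R * (p 1%N ^+ 2 - p 2) * X ^+ 2
    - 4%:R * (p 1%N ^+ 3 - 3%:R * p 1%N * p 2 + 2 * p 3) * X ^+ 3
    + (p 1%N ^+ 4 - 6%:R * p 1%N ^+ 2 * p 2 + 3%:R * p 2 ^+ 2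
       + 8%:R * p 1%N * p 3 - 6%:R * p 4) * X ^+ 4.
Proof. by rewrite /= !big_ord_recr !big_ord0 /=; ring. Qed.

(** By equality of power sums the numbers [m j] are [d] and the [d * l j], as on the
representation [chi_8] in the orders 7 and 14. *)
Lemma newton4_extend (l : 'I_3 -> C) (m : 'I_4 -> C) (d X : C) :
  (forall k, (0 < k <= 4)%N -> \sum_j m j ^+ k = d ^+ k * (1 + \sum_j l j ^+ k)) ->
  \prod_j (1 - m j * X) = (1 - d * X) * \prod_j (1 - d * l j * X).
Proof.
move=> h; have n24 : 24%:R != 0 :> C by rewrite pnatr_eq0.
apply: (mulfI n24); rewrite newton4 /= !h // !big_ord_recr !big_ord0 /=; ring.
Qed.

Lemma conjc_modulus1 (x : C) : modulus x = 1 -> conjc x = x^-1.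
Proof.
move=> x1; have x0 : x != 0 by rewrite -modulus_eq0 x1 oner_eq0.
apply: (mulfI x0); rewrite divff //; have := modulusE x; rewrite x1 => {x1 x0}.
case: x => a b; rewrite normc_def /= => /complexI h.
have := sqr_sqrtr (addr_ge0 (sqr_ge0 a) (sqr_ge0 b)); rewrite h expr1n => h'.
by simpc; rewrite [b * a]mulrC addNr -!expr2 -h'.
Qed.

Lemma root_of_unity_modulus (x : C) n : (0 < n)%N -> x ^+ n = 1 -> modulus x = 1.
Proof.
move=> n0 xn; apply/eqP; have := modulusX x n; rewrite xn modulus1 => /esym/eqP.
by rewrite pexpr_eq1 ?modulus_ge0.
Qed.

Lemma b7_sum : b7 R + b7bar R = -1.
Proof.
apply/eqP; rewrite eq_complex /b7 /b7bar /=; apply/andP; split; apply/eqP; last by ring.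
by field.
Qed.

Lemma b7_mul : b7 R * b7bar R = 2.
Proof.
have h : Num.sqrt 7%:R * Num.sqrt 7%:R = 7%:R :> R by rewrite -expr2 sqr_sqrtr ?ler0n.
have h4 : Num.sqrt 7%:R / 2 * (Num.sqrt 7%:R / 2) = 7%:R / 4%:R :> R.
  by rewrite mulrACA h; field.
rewrite /b7 /b7bar; simpc; apply/eqP; rewrite eq_complex /=; apply/andP; split; apply/eqP.
  by rewrite h4; field.
by field.
Qed.

Lemma conjc_b7 : conjc (b7 R) = b7bar R.
Proof. by []. Qed.

Lemma conjc_b7bar : conjc (b7bar R) = b7 R.
Proof. by rewrite /b7 /b7bar /= opprK. Qed.

Definition is_b7 (s : C) := s = b7 R \/ s = b7bar R.

Lemma is_b7P s : s ^+ 2 + s + 2 = 0 -> is_b7 s.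
Proof.
move=> h; have : (s - b7 R) * (s - b7bar R) = 0.
  have -> : (s - b7 R) * (s - b7bar R) = s ^+ 2 - (b7 R + b7bar R) * s + b7 R * b7bar R by ring.
  by rewrite b7_sum b7_mul -h; ring.
by move/eqP; rewrite mulf_eq0 !subr_eq0 => /orP[]/eqP ->; [left | right].
Qed.

Lemma is_b7_root s : is_b7 s -> s ^+ 2 + s + 2 = 0.
Proof.
case=> ->; rewrite -b7_mul.
  have -> : b7 R ^+ 2 + b7 R + b7 R * b7bar R = b7 R * (b7 R + b7bar R) + b7 R by ring.
  by rewrite b7_sum; ring.
have -> : b7bar R ^+ 2 + b7bar R + b7 R * b7bar R
  = b7bar R * (b7 R + b7bar R) + b7bar R by ring.
by rewrite b7_sum; ring.
Qed.

Lemma is_b7_conj s : is_b7 s -> conjc s = -1 - s.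
Proof.
by case=> ->; rewrite ?conjc_b7 ?conjc_b7bar -b7_sum; ring.
Qed.

Definition zeta7 : C := e2pi (1 / 7%:R).

Lemma zeta7_order : zeta7 ^+ 7 = 1.
Proof. by rewrite /zeta7 -e2pi_nat mul1r divff ?pnatr_eq0 // e2pi1. Qed.

Lemma zeta7_neq1 : zeta7 != 1.
Proof.
apply/negP => /eqP h.
have hc : complex.Re zeta7 = cos (2 * pi / 7%:R).
  rewrite /zeta7 /e2pi /cexp.
  have -> : 2 * (pi : R)%:C%C * 'i%C * (1 / 7%:R) = (2 * pi / 7%:R : R)%:C%C * 'i%C :> C.
    by rewrite !rmorphM /= fmorphV !rmorph_nat; field.
  by simpc => /=; rewrite ?mulr0 ?mul0r ?subr0 ?addr0 ?mulr1 ?add0r expR0 mul1r.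
have p0 := pi_gt0 R.
have : cos (2 * pi / 7%:R) < cos 0 :> R.
  rewrite ltr_cos ?in_itv /= ?lexx ?pi_ge0 //.
    by rewrite divr_gt0 ?mulr_gt0 ?ltr0n.
  apply/andP; split; first by rewrite divr_ge0 ?mulr_ge0 ?pi_ge0 ?ler0n.
  by rewrite ler_pdivrMr ?ltr0n // mulrC ler_wpM2l ?pi_ge0 // ler_nat.
by rewrite -hc h cos0 /= ltxx.
Qed.

Definition is_zeta7 (w : C) := w = zeta7 \/ w = zeta7^-1.

Lemma is_zeta7V w : is_zeta7 w -> is_zeta7 w^-1.
Proof. by case=> ->; rewrite ?invrK; [right | left]. Qed.

Lemma is_zeta7_order w : is_zeta7 w -> w ^+ 7 = 1.
Proof. by case=> ->; rewrite ?exprVn zeta7_order ?invr1. Qed.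

Lemma is_zeta7_sum w : is_zeta7 w -> \sum_(k < 7) w ^+ k = 0.
Proof.
move=> hw; have w1 : w - 1 != 0.
  by rewrite subr_eq0; case: hw => ->; rewrite ?invr_eq1 zeta7_neq1.
by apply: (mulfI w1); rewrite mulr0 -subrX1 is_zeta7_order // subrr.
Qed.

(** The exponents are the squares modulo 7. *)
Definition gauss_period (w : C) : C := w + w ^+ 2 + w ^+ 4.

Lemma gauss_period_b7 w : is_zeta7 w -> is_b7 (gauss_period w).
Proof.
move=> hw; have := is_zeta7_sum hw.
rewrite !big_ord_recr big_ord0 /= add0r expr0 expr1 => ws.
apply: is_b7P; rewrite /gauss_period -[RHS](mulr0 2) -ws.
have -> : (w + w ^+ 2 + w ^+ 4) ^+ 2 = w ^+ 2 + w ^+ 4 + w ^+ 7 * w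
  + 2 * (w ^+ 3 + w ^+ 5 + w ^+ 6) by ring.
by rewrite is_zeta7_order //; ring.
Qed.

Lemma gauss_periodV w : is_zeta7 w -> gauss_period w^-1 = -1 - gauss_period w.
Proof.
move=> hw; have w7 := is_zeta7_order hw.
have w0 : w != 0.
  by apply: contra_eq_neq w7 => ->; rewrite expr0n eq_sym oner_eq0.
have v k : (k <= 7)%N -> w^-1 ^+ k = w ^+ (7 - k).
  move=> k7; rewrite exprVn; apply: (mulfI (expf_neq0 k w0)).
  by rewrite divff ?expf_neq0 // -exprD subnKC.
have := is_zeta7_sum hw; rewrite !big_ord_recr big_ord0 /= add0r expr0 expr1 => ws.
by rewrite /gauss_period -[X in X + _ + _]expr1 !v //= -[RHS]addr0 -ws; ring.
Qed.

Lemma gauss_cubic w X : is_zeta7 w ->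
  (1 - w * X) * (1 - w ^+ 2 * X) * (1 - w ^+ 4 * X)
  = 1 - gauss_period w * X + (-1 - gauss_period w) * X ^+ 2 - X ^+ 3.
Proof.
move=> hw; have := is_zeta7_sum hw.
rewrite !big_ord_recr big_ord0 /= add0r expr0 expr1 => ws.
have -> : -1 - gauss_period w = w ^+ 3 + w ^+ 5 + w ^+ 6.
  by rewrite /gauss_period -[LHS]addr0 -ws; ring.
have -> : (1 - w * X) * (1 - w ^+ 2 * X) * (1 - w ^+ 4 * X)
   = 1 - gauss_period w * X + (w ^+ 3 + w ^+ 5 + w ^+ 6) * X ^+ 2 - w ^+ 7 * X ^+ 3.
  by rewrite /gauss_period; ring.
by rewrite is_zeta7_order // mul1r.
Qed.

(** Inversion of [w] exchanges squares and non-squares modulo 7, and with them the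
two values of the period. *)
Lemma zeta7_gauss s : is_b7 s -> exists2 w, is_zeta7 w & gauss_period w = s.
Proof.
have z1 : is_zeta7 zeta7 by left.
move=> hs; have e1 := is_b7_root (gauss_period_b7 z1); have e2 := is_b7_root hs.
have : (s - gauss_period zeta7) * (s - gauss_period zeta7^-1) = 0.
  rewrite gauss_periodV //; set a := gauss_period _ in e1 *.
  by rewrite -[RHS](subrr (a ^+ 2 + a + 2)) {1}e1 -e2; ring.
move/eqP; rewrite mulf_eq0 !subr_eq0 => /orP[]/eqP ->; [exists zeta7 | exists zeta7^-1] => //.
exact: is_zeta7V.
Qed.

(** The non-trivial seventh roots of unity are the powers of [w] and of [w^-1] with
exponents 1, 2, 4. *)
Lemma cyclotomic7 w X : is_zeta7 w ->
  (1 - X) * ((1 - w * X) * (1 - w ^+ 2 * X) * (1 - w ^+ 4 * X))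
   * ((1 - w^-1 * X) * (1 - w^-1 ^+ 2 * X) * (1 - w^-1 ^+ 4 * X)) = 1 - X ^+ 7.
Proof.
move=> hw; rewrite !gauss_cubic ?gauss_periodV //; last exact: is_zeta7V.
have := is_b7_root (gauss_period_b7 hw); set g := gauss_period w => e.
transitivity (1 - X ^+ 7 - (g ^+ 2 + g + 2) * (X ^+ 2 + X ^+ 3 - X ^+ 4 - X ^+ 5)); first by ring.
by rewrite e mul0r subr0.
Qed.

(** Eigenvalues of modulus 1 satisfy [e_2 = e_3 * conj e_1]; together with
[|e_1|^2 = 2] this pins down [e_2] and [e_3] from the first two power sums. *)
Lemma b7_cubic (l : 'I_3 -> C) s : (forall j, modulus (l j) = 1) -> is_b7 s ->
  \sum_j l j = s -> is_b7 (\sum_j l j ^+ 2) ->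
  forall X, \prod_j (1 - l j * X) = 1 - s * X + (-1 - s) * X ^+ 2 - X ^+ 3.
Proof.
move=> l1 hs; rewrite !big_ord_recr !big_ord0 /= !add0r.
set a := l _; set b := l _; set c := l _ => e1 hp2 X.
have [a0 b0 c0] : [/\ a != 0, b != 0 & c != 0].
  by rewrite -!modulus_eq0 !l1 oner_eq0.
pose e3 := a * b * c; have e30 : e3 != 0 by rewrite !mulf_neq0.
have e2 : a * b + a * c + b * c = e3 * (-1 - s).
  have [ca cb cc] : [/\ conjc a = a^-1, conjc b = b^-1 & conjc c = c^-1].
    by split; apply: conjc_modulus1; apply: l1.
  rewrite -is_b7_conj // -e1 2!rmorphD /= ca cb cc /e3.
  by field; rewrite a0 b0 c0.
have e2' : 2 * (a * b + a * c + b * c) = s ^+ 2 - (a ^+ 2 + b ^+ 2 + c ^+ 2).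
  by rewrite -e1; ring.
have rs := is_b7_root hs; have t0 : -1 - s != 0.
  apply: contraTneq isT => h; have : s = -1.
    by transitivity (-1 - (-1 - s)); [ring | rewrite h subr0].
  move=> s1; have : (2 : C) = 0 by rewrite -[RHS]rs s1; ring.
  by move/eqP; rewrite pnatr_eq0.
have e31 : e3 = 1.
  have [p2|p2] : a ^+ 2 + b ^+ 2 + c ^+ 2 = s \/ a ^+ 2 + b ^+ 2 + c ^+ 2 = -1 - s.
    have : (a ^+ 2 + b ^+ 2 + c ^+ 2 - s) * (a ^+ 2 + b ^+ 2 + c ^+ 2 - (-1 - s)) = 0.
      move: (is_b7_root hp2); set p := a ^+ 2 + _ + _ => rp.
      by rewrite -[RHS](subrr (s ^+ 2 + s + 2)) {1}rs -rp; ring.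
    by move/eqP; rewrite mulf_eq0 !subr_eq0 => /orP[]/eqP ->; [left | right].
    apply: (mulIf t0); rewrite mul1r -e2; have n2 : (2 : C) != 0 by rewrite pnatr_eq0.
    by apply: (mulfI n2); rewrite e2' p2 -[LHS]subr0 -rs; ring.
  have e3c : e3 * conjc e3 = 1.
    by rewrite conjc_modulus1 ?divff // /e3 !modulusM !l1 !mulr1.
  have h : 2 * (e3 * (-1 - s)) = -1.
    by rewrite -e2 e2' p2 -[LHS]subr0 -rs; ring.
  have hc : 2 * (conjc e3 * s) = -1.
    have hN : conjc (-1 : C) = -1 by exact: (rmorphN1 (@conjc R)).
    have E : conjc (2 * (e3 * conjc s)) = conjc 2 * (conjc e3 * conjc (conjc s)).
      by rewrite !(rmorphM (@conjc R)).
    by rewrite (conjc_nat _ 2) conjcK in E; rewrite -E is_b7_conj // h.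
  have : 2 * (e3 * (-1 - s)) * (2 * (conjc e3 * s)) = 1 by rewrite h hc mulrNN mulr1.
  have -> : 2 * (e3 * (-1 - s)) * (2 * (conjc e3 * s))
    = 4%:R * (e3 * conjc e3) * (2 - (s ^+ 2 + s + 2)) by ring.
  rewrite e3c rs subr0 mulr1 -natrM => h8; have : (7%:R : C) = 0.
    by transitivity ((4 * 2)%:R - 1 : C); [ring | rewrite h8 subrr].
  by move/eqP; rewrite pnatr_eq0.
rewrite !big_ord_recr !big_ord0 /= mul1r -/a -/b -/c.
have -> : (1 - a * X) * (1 - b * X) * (1 - c * X)
  = 1 - (a + b + c) * X + (a * b + a * c + b * c) * X ^+ 2 - e3 * X ^+ 3.
  by rewrite /e3; ring.
by rewrite e1 e2 e31 !mul1r.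
Qed.

Definition factor_prod (L : seq (C * nat)) (X : C) : C :=
  \prod_(p <- L) (1 - p.1 * X ^+ p.2).

Local Arguments conjc : simpl never.

(** Inverses are complex conjugates on the unit circle. *)
Lemma factor_prod_conj n (l : 'I_n -> C) (L L' : seq (C * nat)) :
  (forall j, modulus (l j) = 1) -> L' = [seq (conjc p.1, p.2) | p <- L] ->
  (forall X, \prod_j (1 - l j * X) = factor_prod L X) ->
  forall X, \prod_j (1 - (l j)^-1 * X) = factor_prod L' X.
Proof.
move=> l1 -> h X; rewrite -[X]conjcK; move: (conjc X) => Z.
have cS (c : C) (x : C) : 1 - conjc c * x^*%C = (1 - c * x)^*%C.
  by rewrite (rmorphB (@conjc R)) /= (rmorphM (@conjc R)) /= conjc1.
transitivity ((\prod_j (1 - l j * Z))^*%C).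
  rewrite (rmorph_prod (@conjc R)); apply: eq_bigr => j _.
  by rewrite -conjc_modulus1 // cS.
rewrite h /factor_prod big_map (rmorph_prod (@conjc R)); apply: eq_bigr => p _ /=.
have cX (x : C) d : conjc x ^+ d = conjc (x ^+ d) by rewrite (rmorphXn (@conjc R)).
by rewrite cX cS.
Qed.

Section Classes.
Variables (gT : finGroupType) (H : {group gT}) (cl : gT -> cls336) (g : gT).
Hypotheses (cl_order : {in H, forall g, #[g]%g = cls_order (cl g)}) (gH : g \in H).
Variables (l : 'I_3 -> C) (m : 'I_4 -> C).
Hypotheses (l1 : forall j, modulus (l j) = 1) (m1 : forall j, modulus (m j) = 1).
Hypotheses (hl : forall k, \sum_j l j ^+ k = chi2 R (cl (g ^+ k)%g))
  (hm : forall k, \sum_j m j ^+ k = chi8 R (cl (g ^+ k)%g)).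

Let power_order k : cls_order (cl (g ^+ k)%g)
  = (cls_order (cl g) %/ gcdn (cls_order (cl g)) k)%N.
Proof. by rewrite -!cl_order ?groupX // orderXgcd. Qed.

Let n6 : (6%:R : C) != 0. Proof. by rewrite pnatr_eq0. Qed.
Let n24 : (24%:R : C) != 0. Proof. by rewrite pnatr_eq0. Qed.

(** The order of a power of [g] determines its class, up to conjugation in the
orders 7, 8 and 14, and so the power sums of the eigenvalues.  The two classes of
order 8 have the same character values; in the orders 7 and 14 the choice of [w]
absorbs the ambiguity. *)
Lemma class_factors : exists2 w, is_zeta7 w & forall X,
  [/\ \prod_j (1 - l j * X) = factor_prod (chi2_factors (cl g) w) X,
      \prod_j (1 - m j * X) = factor_prod (chi8_factors (cl g) w) X,
      \prod_j (1 - (l j)^-1 * X) = factor_prod (chi2_factors (cl g) w^-1) X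
    & \prod_j (1 - (m j)^-1 * X) = factor_prod (chi8_factors (cl g) w^-1) X].
Proof.
have o2 := power_order 2; have o3 := power_order 3; have o4 := power_order 4.
have l_1 := hl 1; have l_2 := hl 2; have l_3 := hl 3.
have m_1 := hm 1; have m_2 := hm 2; have m_3 := hm 3; have m_4 := hm 4.
have l_4 := hl 4; rewrite expg1 in l_1 m_1.
suff [w hw h] : exists2 w, is_zeta7 w & forall X,
    \prod_j (1 - l j * X) = factor_prod (chi2_factors (cl g) w) X /\
    \prod_j (1 - m j * X) = factor_prod (chi8_factors (cl g) w) X.
  exists w => // X; have [h1 h2] := h X; split=> //.
    apply: (factor_prod_conj (L := chi2_factors (cl g) w)) => // [|Z]; last by have [] := h Z.
    have wc : conjc w = w^-1.
      by apply: conjc_modulus1; apply: (root_of_unity_modulus (n := 7)) => //; apply: is_zeta7_order.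
    by case: (cl g) => /=; rewrite ?(rmorphXn (@conjc R)) /= ?(rmorphN1 (@conjc R)) ?conjc1 ?wc.
  apply: (factor_prod_conj (L := chi8_factors (cl g) w)) => // [|Z]; last by have [] := h Z.
  have wc : conjc w = w^-1.
    by apply: conjc_modulus1; apply: (root_of_unity_modulus (n := 7)) => //; apply: is_zeta7_order.
  by case: (cl g) => /=; rewrite ?(rmorphN (@conjc R)) /= ?(rmorphXn (@conjc R)) /=
    ?(rmorphN1 (@conjc R)) ?conjc1 ?wc.
have z7 : is_zeta7 zeta7 by left.
(* In the orders 7 and 14 the class of a power is known up to conjugation only;
   that [chi_2] is [b7] or its conjugate and that [chi_8] is [d (1 + chi_2)] is
   all that is needed, with [d = 1] or [d = -1] on [g]. *)
have gauss d s : is_b7 s -> \sum_j l j ^+ 1 = s -> is_b7 (\sum_j l j ^+ 2) ->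
    (forall k, (0 < k <= 4)%N -> \sum_j m j ^+ k = d ^+ k * (1 + \sum_j l j ^+ k)) ->
    exists2 w, is_zeta7 w & forall X,
      \prod_j (1 - l j * X) = (1 - w * X) * (1 - w ^+ 2 * X) * (1 - w ^+ 4 * X) /\
      \prod_j (1 - m j * X)
        = (1 - d * X) * ((1 - d * w * X) * (1 - d * w ^+ 2 * X) * (1 - d * w ^+ 4 * X)).
  move=> hs p1 p2 hd; have [w hw e] := zeta7_gauss hs; exists w => // X.
  have lE Z : \prod_j (1 - l j * Z) = (1 - w * Z) * (1 - w ^+ 2 * Z) * (1 - w ^+ 4 * Z).
    rewrite gauss_cubic // e; apply: b7_cubic => //; by rewrite -p1; apply: eq_bigr => j _; rewrite expr1.
  split=> //; rewrite (newton4_extend _ hd); congr (_ * _).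
  transitivity (\prod_j (1 - l j * (d * X))).
    by apply: eq_bigr => j _; rewrite mulrA [l j * d]mulrC.
  by rewrite lE; ring.
have eb : b7bar R = -1 - b7 R by rewrite -b7_sum; ring.
have chi7 c : cls_order c = 7%N -> is_b7 (chi2 R c) /\ chi8 R c = 1 + chi2 R c.
  by case: c => //= _; split; try (by [left | right]); rewrite eb; ring.
have chi14 c : cls_order c = 14%N -> is_b7 (chi2 R c) /\ chi8 R c = - (1 + chi2 R c).
  by case: c => //= _; split; try (by [left | right]); rewrite eb; ring.
have case7 : cls_order (cl g) = 7%N -> exists2 w, is_zeta7 w & forall X,
    \prod_j (1 - l j * X) = factor_prod (chi2_factors C7A w) X /\
    \prod_j (1 - m j * X) = factor_prod (chi8_factors C7A w) X.
  move=> o; rewrite o in o2 o3 o4.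
  have [] := gauss 1 (chi2 R (cl g)).
  - by have [] := chi7 _ o.
  - exact: l_1.
  - by rewrite l_2; have [] := chi7 _ o2.
  - case=> [|[|[|[|[|k]]]]] // _; rewrite expr1n mul1r.
    + by rewrite l_1 m_1; have [] := chi7 _ o.
    + by rewrite l_2 m_2; have [] := chi7 _ o2.
    + by rewrite l_3 m_3; have [] := chi7 _ o3.
    + by rewrite l_4 m_4; have [] := chi7 _ o4.
  move=> w hw e; exists w => // X; have [-> ->] := e X.
  by rewrite /factor_prod !big_cons !big_nil /= !expr1 !mul1r !mulr1 !mulrA.
have case14 : cls_order (cl g) = 14%N -> exists2 w, is_zeta7 w & forall X,
    \prod_j (1 - l j * X) = factor_prod (chi2_factors C14A w) X /\
    \prod_j (1 - m j * X) = factor_prod (chi8_factors C14A w) X.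
  move=> o; rewrite o in o2 o3 o4.
  have [] := gauss (-1) (chi2 R (cl g)).
  - by have [] := chi14 _ o.
  - exact: l_1.
  - by rewrite l_2; have [] := chi7 _ o2.
  - case=> [|[|[|[|[|k]]]]] // _.
    + by rewrite l_1 m_1 expr1 mulN1r; have [] := chi14 _ o.
    + by rewrite l_2 m_2 sqrrN expr1n mul1r; have [] := chi7 _ o2.
    + by rewrite l_3 m_3 exprS sqrrN expr1n mulr1 mulN1r; have [] := chi14 _ o3.
    + by rewrite l_4 m_4 (exprM _ 2 2) sqrrN !expr1n mul1r; have [] := chi7 _ o4.
  move=> w hw e; exists w => // X; have [-> ->] := e X.
  by rewrite /factor_prod !big_cons !big_nil /= !expr1 !mulN1r !mulr1 !mulrA.
case E: (cl g) o2 o3 o4 l_1 m_1 case7 case14 => o2 o3 o4 l_1 m_1 case7 case14;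
  try exact: case7; try exact: case14; exists zeta7 => // X; split.
all: rewrite /factor_prod ?big_cons ?big_nil /=.
all: try (apply: (mulfI n6); rewrite newton3 /=).
all: try (apply: (mulfI n24); rewrite newton4 /=).
all: rewrite ?l_1 ?l_2 ?l_3 ?m_1 ?m_2 ?m_3 ?m_4.
all: move: o2 o3 o4 => /=.
all: case: (cl (g ^+ 2)%g) => //= _.
all: case: (cl (g ^+ 3)%g) => //= _.
all: case: (cl (g ^+ 4)%g) => //= _.
all: ring.
Qed.

End Classes.

End CharacteristicPolynomials.

(** * Theta quotients as identities in a field *)

Local Notation eta := Defs.eta.

Section ThetaProducts.
Variable R : realType.
Local Notation C := R[i].

(** The identity of polynomials applies to each level of the infinite products,
at [X = a * q ^+ k]. *)
Lemma qinf_factors n (l : 'I_n -> C) (L : seq (C * nat)) (a q : C) : modulus q < 1 ->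
  all (fun p => 0 < p.2)%N L -> (forall X, \prod_j (1 - l j * X) = factor_prod L X) ->
  \prod_j qinf (l j * a) q = \prod_(p <- L) qinf (p.1 * a ^+ p.2) (q ^+ p.2).
Proof.
move=> q1 L0 h.
have h1 : slim (fun N => \prod_j qpoch (l j * a) q N) (\prod_j qinf (l j * a) q).
  by apply: slim_prod => j _; apply: qpoch_cvg.
have h2 : slim (fun N => \prod_(p <- L) qpoch (p.1 * a ^+ p.2) (q ^+ p.2) N)
    (\prod_(p <- L) qinf (p.1 * a ^+ p.2) (q ^+ p.2)).
  apply: slim_prod => p pL.
  apply: qpoch_cvg; rewrite modulusX exprn_ilt1 ?modulus_ge0 //.
  by have := allP L0 _ pL; rewrite lt0n.
apply: slim_unique h1 (slim_ext _ h2) => N.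
rewrite /qpoch exchange_big /= [RHS]exchange_big /=; apply: eq_bigr => k _.
transitivity (\prod_j (1 - l j * (a * q ^+ k))).
  by rewrite h /factor_prod; apply: eq_bigr => p _; rewrite exprMn -exprM mulnC exprM mulrA.
by apply: eq_bigr => j _; rewrite mulrA.
Qed.

Lemma infprod_slim (f : nat -> C) l :
  slim (fun N => \prod_(n < N) f n.+1) l -> infprod f = l.
Proof.
by move=> h; apply: limn_slim; apply: slim_ext h => N; rewrite big_add1 big_mkord.
Qed.

Lemma infprod3 (f : nat -> C) x y z q : modulus q < 1 ->
  (forall n, f n.+1 = (1 - x * q ^+ n) * (1 - y * q ^+ n) * (1 - z * q ^+ n)) ->
  infprod f = qinf x q * qinf y q * qinf z q.
Proof.
move=> q1 fE; apply: infprod_slim.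
have h := slimM (slimM (qpoch_cvg (a := x) q1) (qpoch_cvg (a := y) q1)) (qpoch_cvg (a := z) q1).
apply: slim_ext h => N; rewrite /qpoch -!big_split /=.
by apply: eq_bigr => n _; rewrite fE.
Qed.

Lemma eta_qinf (tau : C) : modulus (e2pi tau) < 1 ->
  eta tau = e2pi (tau / 24%:R) * qinf (e2pi tau) (e2pi tau).
Proof.
move=> q1; rewrite /Defs.eta; congr (_ * _); apply: infprod_slim.
have h := qpoch_cvg (a := e2pi tau) q1; apply: slim_ext h => N.
by apply: eq_bigr => n _; rewrite exprS.
Qed.

Lemma theta1_qinf (tau z : C) : modulus (e2pi tau) < 1 ->
  theta1 tau z = - 'i * (e2pi (tau / 8%:R) * e2pi (z / 2)
   * (qinf (e2pi z)^-1 (e2pi tau) * qinf (e2pi z * e2pi tau) (e2pi tau)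
      * qinf (e2pi tau) (e2pi tau))).
Proof.
move=> q1; rewrite /theta1; set q := e2pi tau; set y := e2pi z.
rewrite (infprod3 (x := y^-1) (y := y * q) (z := q) q1); last by move=> n; rewrite /= exprS; ring.
by rewrite -/q; ring.
Qed.

Lemma theta2_qinf (tau z : C) : modulus (e2pi tau) < 1 ->
  theta2 tau z = e2pi (tau / 8%:R) * e2pi (z / 2)
   * (qinf (- (e2pi z)^-1) (e2pi tau) * qinf (- (e2pi z * e2pi tau)) (e2pi tau)
      * qinf (e2pi tau) (e2pi tau)).
Proof.
move=> q1; rewrite /theta2; set q := e2pi tau; set y := e2pi z.
rewrite (infprod3 (x := - y^-1) (y := - (y * q)) (z := q) q1) //.
by move=> n; rewrite /= exprS; ring.
Qed.

End ThetaProducts.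

Section ThetaAlgebra.
Variables (K : fieldType) (F : K -> K -> K) (q y a b ii : K).
Hypotheses (ii2 : ii * ii = -1) (a0 : a != 0) (b0 : b != 0) (yb : y = b ^+ 2).

(** Eta and theta functions of level [k] at [m z], in terms of the infinite
product [F], [a = e(tau / 24)] and [b = e(z / 2)]. *)
Definition eta_mono (k : nat) : K := a ^+ k * F (q ^+ k) (q ^+ k).
Definition theta1_mono (k m : nat) : K := - ii * (a ^+ (3 * k) * b ^+ m *
  (F (y ^+ m)^-1 (q ^+ k) * F (y ^+ m * q ^+ k) (q ^+ k) * F (q ^+ k) (q ^+ k))).
Definition theta2_mono (k m : nat) : K := a ^+ (3 * k) * b ^+ m *
  (F (- (y ^+ m)^-1) (q ^+ k) * F (- (y ^+ m * q ^+ k)) (q ^+ k) * F (q ^+ k) (q ^+ k)).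

(** The generating function of the twisted module in terms of the factors of the
characteristic polynomials instead of the eigenvalues. *)
Definition class_limit (c : cls336) (w : K) : K :=
  let fq (L : seq (K * nat)) x := \prod_(p <- L) F (p.1 * x ^+ p.2) (q ^+ p.2) in
  y * (F q q ^+ 2
    * (fq (chi2_factors c w^-1) (y ^+ 2)^-1 * fq (chi2_factors c w) (y ^+ 2 * q))
    * (fq (chi8_factors c w^-1) y^-1 * fq (chi8_factors c w) (y * q))^-1).

Hypotheses (nP : forall k, F (q ^+ k.+1) (q ^+ k.+1) != 0)
  (nE : forall k m, F (y ^+ m.+1)^-1 (q ^+ k.+1) != 0)
  (nNE : forall k m, F (- (y ^+ m.+1)^-1) (q ^+ k.+1) != 0)
  (nD : forall k m, F (y ^+ m.+1 * q ^+ m.+1) (q ^+ k.+1) != 0)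
  (nND : forall k m, F (- (y ^+ m.+1 * q ^+ m.+1)) (q ^+ k.+1) != 0).

Let ii0 : ii != 0.
Proof.
by apply: contra_eq_neq ii2 => ->; rewrite mul0r eq_sym oppr_eq0 oner_eq0.
Qed.

(* Since [field] does not know the square of [ii], its powers are removed in pairs. *)
Let drop_i n (x l : K) : x = l * (- (ii * ii)) ^+ n -> x = l.
Proof. by rewrite ii2 opprK expr1n mulr1. Qed.

Let y6 : y ^+ 2 ^+ 3 = y ^+ 6. Proof. by rewrite -exprM. Qed.
Let y4 : y ^+ 2 ^+ 2 = y ^+ 4. Proof. by rewrite -exprM. Qed.

Ltac expand := rewrite /class_limit /eta_mono /theta1_mono /theta2_mono
  /chi2_factors /chi8_factors
  ?(big_cons, big_nil) /= ?(mulN1r, mul1r, mulr1, muln1, expr1, exprVn)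
  ?[(y * q) ^+ _]exprMn ?[(y ^+ 2 * q) ^+ _]exprMn ?y4 ?y6.

(* The identities hold whatever the values of [F] are, so these become variables
   before [field] is called. *)
Ltac theta_field n :=
  repeat (match goal with |- context [F ?u ?v] =>
     let Q := fresh "Q" in move: (F u v) => Q end);
  intros; rewrite yb; apply: (drop_i (n := n)); field;
  rewrite ?oppr_eq0; repeat (apply/andP; split); assumption.

Lemma theta_1A w : 2 * ii * eta_mono 1 ^+ 3 * theta1_mono 1 2 ^+ 3 / theta1_mono 1 1 ^+ 4
  = - (class_limit C1A w + class_limit C1A w^-1).
Proof. move: (nP 0) (nE 0 0) (nD 0 0); expand; theta_field 0%N. Qed.

Lemma theta_2A w : 2 * ii * eta_mono 1 ^+ 3 * theta1_mono 1 2 ^+ 3 / theta2_mono 1 1 ^+ 4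
  = - (class_limit C2A w + class_limit C2A w^-1).
Proof. move: (nP 0) (nNE 0 0) (nND 0 0); expand; theta_field 2%N. Qed.

Lemma theta_4A w : - 2 * ii * (eta_mono 2 ^+ 2 * theta1_mono 1 2 * theta2_mono 1 2 ^+ 2
    / (eta_mono 1 * theta2_mono 2 2 ^+ 2))
  = - (class_limit C4A w + class_limit C4A w^-1).
Proof. move: (nP 0) (nP 1) (nNE 1 1) (nND 1 1); expand; theta_field 1%N. Qed.

Lemma theta_3A w : 2 * ii * (eta_mono 1 ^+ 3 * theta1_mono 3 6
    / (theta1_mono 1 1 * theta1_mono 3 3))
  = - (class_limit C3A w + class_limit C3A w^-1).
Proof.
move: (nP 0) (nP 2) (nE 0 0) (nD 0 0) (nE 2 2) (nD 2 2); expand; theta_field 0%N.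
Qed.

Lemma theta_6A w : - 2 * ii * (eta_mono 1 ^+ 3 * theta1_mono 3 6
    / (theta2_mono 1 1 * theta2_mono 3 3))
  = - (class_limit C6A w + class_limit C6A w^-1).
Proof.
move: (nP 0) (nP 2) (nNE 0 0) (nND 0 0) (nNE 2 2) (nND 2 2); expand; theta_field 1%N.
Qed.

Lemma theta_8A w : - 2 * ii * (eta_mono 1 * eta_mono 4 * theta1_mono 1 2 * theta2_mono 2 4
    / (eta_mono 2 * theta2_mono 4 4))
  = - (class_limit C8A w + class_limit C8A w^-1).
Proof.
move: (nP 0) (nP 1) (nP 3) (nNE 3 3) (nND 3 3); expand; theta_field 1%N.
Qed.

(** Theta functions at an arbitrary point [u], with [v = e(u)] and [h = e(u / 2)]. *)
Definition theta1_at (v h : K) : K :=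
  - ii * (a ^+ 3 * h * (F v^-1 q * F (v * q) q * F q q)).
Definition theta2_at (v h : K) : K :=
  a ^+ 3 * h * (F (- v^-1) q * F (- (v * q)) q * F q q).

Definition twist_num (w : K) : K :=
  F (w^-1 * (y ^+ 2)^-1) q * F (w * (y ^+ 2 * q)) q.
Definition twist_den (d w : K) : K :=
  F (d * (w * y^-1)) q * F (d * (w^-1 * (y * q))) q.

(** The two shifts are opposite, so they disappear from the product of the
half-integral prefactors [h] and [h']. *)
Lemma theta_shift1 s h h' : h * h' = b ^+ 3 ->
  theta1_at (y ^+ 2 * s) h * theta1_at (y * s^-1) h'
  = (ii * ii) * (a ^+ 6 * b ^+ 3 * F q q ^+ 2 * (twist_num s * twist_den 1 s)).
Proof.
move=> <-; rewrite /theta1_at /twist_num /twist_den !mul1r [(y ^+ 2 * s)^-1]invfM [(y / s)^-1]invfM invrK.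
rewrite [(y ^+ 2)^-1 * _]mulrC [y^-1 * _]mulrC.
by rewrite [y ^+ 2 * s]mulrC [y * s^-1]mulrC -!(mulrA _ _ q); ring.
Qed.

Lemma theta_shift2 s h h' : h * h' = b ^+ 3 ->
  theta1_at (y ^+ 2 * s) h * theta2_at (y * s^-1) h'
  = - ii * (a ^+ 6 * b ^+ 3 * F q q ^+ 2 * (twist_num s * twist_den (-1) s)).
Proof.
move=> <-; rewrite /theta1_at /theta2_at /twist_num /twist_den !mulN1r [(y ^+ 2 * s)^-1]invfM [(y / s)^-1]invfM invrK.
rewrite [(y ^+ 2)^-1 * _]mulrC [y^-1 * _]mulrC.
by rewrite [y ^+ 2 * s]mulrC [y * s^-1]mulrC -!(mulrA _ _ q); ring.
Qed.

Let A7s w := twist_num w * twist_num (w ^+ 2) * twist_num (w ^+ 4).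
Let B7s d w := twist_den d w * twist_den d (w ^+ 2) * twist_den d (w ^+ 4).

Let limit7 w : class_limit C7A w = y * (F q q ^+ 2 * A7s w
  / (F (1 * y^-1) q * F (1 * (y * q)) q * B7s 1 w^-1)).
Proof.
rewrite /class_limit /chi2_factors /chi8_factors !(big_cons, big_nil) /= !expr1.
rewrite /A7s /B7s /twist_num /twist_den !exprVn !invrK !mul1r !mulr1.
by congr (_ * (_ * _ / _)); ring.
Qed.

Let limit14 w : class_limit C14A w = y * (F q q ^+ 2 * A7s w
  / (F (-1 * y^-1) q * F (-1 * (y * q)) q * B7s (-1) w^-1)).
Proof.
rewrite /class_limit /chi2_factors /chi8_factors !(big_cons, big_nil) /= !expr1.
rewrite /A7s /B7s /twist_num /twist_den !exprVn !invrK !mulr1 !mulN1r !mulNr.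
by congr (_ * (_ * _ / _)); ring.
Qed.

(** The factors of a level-one theta function and its twists by all seventh
roots of unity make up one factor of level seven. *)
Definition level7 (d w : K) := forall x,
  F (d * x) q * (F (d * (w * x)) q * F (d * (w ^+ 2 * x)) q * F (d * (w ^+ 4 * x)) q)
    * (F (d * (w^-1 * x)) q * F (d * (w^-1 ^+ 2 * x)) q * F (d * (w^-1 ^+ 4 * x)) q)
  = F (d * x ^+ 7) (q ^+ 7).

Let level7E d w : level7 d w ->
  F (d * (y ^+ 7)^-1) (q ^+ 7) * F (d * (y ^+ 7 * q ^+ 7)) (q ^+ 7)
  = F (d * y^-1) q * F (d * (y * q)) q * (B7s d w * B7s d w^-1).
Proof.
move=> l7; rewrite -exprVn -exprMn -l7 -l7.
by rewrite /B7s /twist_den !exprVn !invrK; ring.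
Qed.

Variable w : K.
Local Notation prod3 f := (f 1%N * (f 2 * f 4)).

Lemma theta_7A (t t' : nat -> K) : level7 1 w ->
  (forall k, t k = (ii * ii) * (a ^+ 6 * b ^+ 3 * F q q ^+ 2 * (twist_num (w ^+ k) * twist_den 1 (w ^+ k)))) ->
  (forall k, t' k = (ii * ii)
    * (a ^+ 6 * b ^+ 3 * F q q ^+ 2 * (twist_num (w^-1 ^+ k) * twist_den 1 (w^-1 ^+ k)))) ->
  - ii * (eta_mono 7 / (eta_mono 1 ^+ 4 * theta1_mono 7 7)) * (prod3 t + prod3 t')
  = - (class_limit C7A w + class_limit C7A w^-1).
Proof.
move=> l7 tE t'E; have e := level7E l7.
have : F (1 * (y ^+ 7)^-1) (q ^+ 7) * F (1 * (y ^+ 7 * q ^+ 7)) (q ^+ 7) != 0.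
  by rewrite !mul1r mulf_neq0 ?nE ?nD.
rewrite e mulf_eq0 (mulf_eq0 (F _ _)) (mulf_eq0 (B7s _ _)) !negb_or.
case/andP=> /andP[e0 d0] /andP[b1 b2].
move: (nP 6) (nP 0) e e0 d0 b1 b2.
rewrite !limit7 invrK /B7s /A7s /eta_mono /theta1_mono !tE !t'E !expr1 !mul1r.
move=> n7 n0 ->; move: n7 n0.
repeat (match goal with
  | |- context [twist_num ?u] => let Q := fresh "Q" in move: (twist_num u) => Q
  | |- context [twist_den ?d ?u] => let Q := fresh "Q" in move: (twist_den d u) => Q end).
rewrite !mulf_eq0 !negb_or -!andbA => n7 n0 e0 d0 /and3P[? ? ?] /and3P[? ? ?].
move: n7 n0 e0 d0; theta_field 3%N.
Qed.

Lemma theta_14A (t t' : nat -> K) : level7 (-1) w ->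
  (forall k, t k = - ii * (a ^+ 6 * b ^+ 3 * F q q ^+ 2 * (twist_num (w ^+ k) * twist_den (-1) (w ^+ k)))) ->
  (forall k, t' k = - ii
    * (a ^+ 6 * b ^+ 3 * F q q ^+ 2 * (twist_num (w^-1 ^+ k) * twist_den (-1) (w^-1 ^+ k)))) ->
  ii * (eta_mono 7 / (eta_mono 1 ^+ 4 * theta2_mono 7 7)) * (prod3 t + prod3 t')
  = - (class_limit C14A w + class_limit C14A w^-1).
Proof.
move=> l7 tE t'E; have e := level7E l7.
have : F (-1 * (y ^+ 7)^-1) (q ^+ 7) * F (-1 * (y ^+ 7 * q ^+ 7)) (q ^+ 7) != 0.
  by rewrite !mulN1r mulf_neq0 ?nNE ?nND.
rewrite e mulf_eq0 (mulf_eq0 (F _ _)) (mulf_eq0 (B7s _ _)) !negb_or.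
case/andP=> /andP[e0 d0] /andP[b1 b2].
move: (nP 6) (nP 0) e e0 d0 b1 b2.
rewrite !limit14 invrK /B7s /A7s /eta_mono /theta2_mono !tE !t'E !expr1 !mulN1r.
move=> n7 n0 ->; move: n7 n0.
repeat (match goal with
  | |- context [twist_num ?u] => let Q := fresh "Q" in move: (twist_num u) => Q
  | |- context [twist_den ?d ?u] => let Q := fresh "Q" in move: (twist_den d u) => Q end).
rewrite !mulf_eq0 !negb_or -!andbA => n7 n0 e0 d0 /and3P[? ? ?] /and3P[? ? ?].
move: n7 n0 e0 d0; theta_field 2%N.
Qed.

End ThetaAlgebra.

(** * The limit for each conjugacy class *)

Lemma prod124 (K : pzRingType) (f : nat -> K) :
  \prod_(k <- [:: 1; 2; 4]%N) f k = f 1%N * (f 2 * f 4).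
Proof. by rewrite !(big_cons, big_nil) mulr1. Qed.

Section ClassLimits.
Variable R : realType.
Local Notation C := R[i].

Lemma w4_limit_class (q y : C) c w (l : 'I_3 -> C) (m : 'I_4 -> C) :
  modulus q < 1 ->
  (forall X, [/\ \prod_j (1 - l j * X) = factor_prod (chi2_factors c w) X,
      \prod_j (1 - m j * X) = factor_prod (chi8_factors c w) X,
      \prod_j (1 - (l j)^-1 * X) = factor_prod (chi2_factors c w^-1) X
    & \prod_j (1 - (m j)^-1 * X) = factor_prod (chi8_factors c w^-1) X]) ->
  w4_limit l m y q = class_limit (@qinf R) q y c w.
Proof.
move=> q1 h.
have a2 v : all (fun p => 0 < p.2)%N (@chi2_factors C c v) by case: (c).
have a8 v : all (fun p => 0 < p.2)%N (@chi8_factors C c v) by case: (c).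
rewrite /w4_limit /class_limit !big_split /=.
congr (_ * (_ * (_ * _) * (_ * _)^-1)).
- by apply: (qinf_factors (l := fun j => (l j)^-1)) => // X; have [] := h X.
- rewrite -(qinf_factors (l := l)) // => [|X]; last by have [] := h X.
  by apply: eq_bigr => j _; rewrite -(mulrA (l j)).
- by apply: (qinf_factors (l := fun j => (m j)^-1)) => // X; have [] := h X.
- rewrite -(qinf_factors (l := m)) // => [|X]; last by have [] := h X.
  by apply: eq_bigr => j _; rewrite -(mulrA (m j)).
Qed.

(** The condition on [d] holds for the signs 1 and -1, which belong to the orders 7
and 14. *)
Lemma qinf_level7 (q d w : C) : modulus q < 1 -> d ^+ 7 = d -> is_zeta7 w ->
  level7 (@qinf R) q d w.
Proof.
move=> q1 d7 hw x.
pose l (j : 'I_7) := d * [:: 1; w; w ^+ 2; w ^+ 4; w^-1; w^-1 ^+ 2; w^-1 ^+ 4]`_j.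
have h X : \prod_j (1 - l j * X) = factor_prod [:: (d, 7%N)] X.
  rewrite /factor_prod big_cons big_nil mulr1 /= -[d in RHS]d7 -exprMn.
  rewrite -(cyclotomic7 (d * X) hw) !big_ord_recr big_ord0 /l /=; ring.
have e := qinf_factors (L := [:: (d, 7%N)]) x q1 isT h.
rewrite big_seq1 in e; apply: (etrans _ e); rewrite !big_ord_recr big_ord0 /l /=.
by rewrite mul1r mulr1 -!(mulrA d) -!mulrA.
Qed.

Variables (tau z : C).
Local Notation q := (e2pi tau).
Local Notation y := (e2pi z).
Local Notation a := (e2pi (tau / 24%:R)).
Local Notation b := (e2pi (z / 2)).
Local Notation limit := (class_limit (@qinf R) q y).
Hypotheses (q1 : modulus q < 1) (y1 : modulus y^-1 < 1) (yq1 : modulus (y * q) < 1).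

Opaque qinf e2pi.

Let qk1 k : modulus (q ^+ k.+1) < 1.
Proof. by rewrite modulusX exprn_ilt1 ?modulus_ge0. Qed.

Let yb : y = b ^+ 2. Proof. by rewrite -e2pi_nat mulrC divfK ?pnatr_eq0. Qed.

Let qkE k : e2pi (k%:R * tau) = q ^+ k. Proof. exact: e2pi_nat. Qed.
Let ymE m : e2pi (m%:R * z) = y ^+ m. Proof. exact: e2pi_nat. Qed.
Let e24 k : e2pi (k%:R * tau / 24%:R) = a ^+ k.
Proof. by rewrite -mulrA e2pi_nat. Qed.

Let etaK k : eta (k.+1%:R * tau) = eta_mono (@qinf R) q a k.+1.
Proof. by rewrite eta_qinf qkE // e24. Qed.

Let e8 k : e2pi (k%:R * tau / 8%:R) = a ^+ (3 * k).
Proof. by rewrite exprM -!e2pi_nat; congr e2pi; field. Qed.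
Let e2 m : e2pi (m%:R * z / 2) = b ^+ m.
Proof. by rewrite -mulrA e2pi_nat. Qed.

Let theta1K k m : theta1 (k.+1%:R * tau) (m%:R * z)
  = theta1_mono (@qinf R) q y a b 'i k.+1 m.
Proof. by rewrite /theta1_mono theta1_qinf qkE // e8 e2 ymE. Qed.

Let theta2K k m : theta2 (k.+1%:R * tau) (m%:R * z)
  = theta2_mono (@qinf R) q y a b k.+1 m.
Proof. by rewrite /theta2_mono theta2_qinf qkE // e8 e2 ymE. Qed.

Let theta1s u : theta1 tau u = theta1_at (@qinf R) q a 'i (e2pi u) (e2pi (u / 2)).
Proof. by rewrite theta1_qinf //; have := e8 1; rewrite mul1r => ->. Qed.

Let theta2s u : theta2 tau u = theta2_at (@qinf R) q a (e2pi u) (e2pi (u / 2)).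
Proof. by rewrite theta2_qinf //; have := e8 1; rewrite mul1r => ->. Qed.

Let eta1 : eta tau = eta_mono (@qinf R) q a 1.
Proof. by have := etaK 0; rewrite mul1r. Qed.
Let theta1m m : theta1 tau (m%:R * z) = theta1_mono (@qinf R) q y a b 'i 1 m.
Proof. by have := theta1K 0 m; rewrite mul1r. Qed.
Let theta2m m : theta2 tau (m%:R * z) = theta2_mono (@qinf R) q y a b 1 m.
Proof. by have := theta2K 0 m; rewrite mul1r. Qed.
Let theta11 : theta1 tau z = theta1_mono (@qinf R) q y a b 'i 1 1.
Proof. by have := theta1m 1; rewrite mul1r. Qed.
Let theta21 : theta2 tau z = theta2_mono (@qinf R) q y a b 1 1.
Proof. by have := theta2m 1; rewrite mul1r. Qed.

Let i2 : 'i * 'i = -1 :> C. Proof. by rewrite -expr2 sqrCi. Qed.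
Let a0 : a != 0. Proof. exact: e2pi_neq0. Qed.
Let b0 : b != 0. Proof. exact: e2pi_neq0. Qed.

Let mxk (x : C) k : modulus x < 1 -> modulus (x ^+ k.+1) < 1.
Proof. by move=> x1; rewrite modulusX exprn_ilt1 ?modulus_ge0. Qed.
Let nP k : qinf (q ^+ k.+1) (q ^+ k.+1) != 0.
Proof. by apply: qinf_neq0. Qed.
Let nE k m : qinf (y ^+ m.+1)^-1 (q ^+ k.+1) != 0.
Proof. by apply: qinf_neq0 => //; rewrite -exprVn; apply: mxk. Qed.
Let nNE k m : qinf (- (y ^+ m.+1)^-1) (q ^+ k.+1) != 0.
Proof. by apply: qinf_neq0 => //; rewrite modulusN -exprVn; apply: mxk. Qed.
Let nD k m : qinf (y ^+ m.+1 * q ^+ m.+1) (q ^+ k.+1) != 0.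
Proof. by apply: qinf_neq0 => //; rewrite -exprMn; apply: mxk. Qed.
Let nND k m : qinf (- (y ^+ m.+1 * q ^+ m.+1)) (q ^+ k.+1) != 0.
Proof. by apply: qinf_neq0 => //; rewrite modulusN -exprMn; apply: mxk. Qed.

Let eshift s : e2pi ((2 * z + s) / 2) * e2pi ((z - s) / 2) = b ^+ 3.
Proof. by rewrite -e2piD -e2pi_nat; congr e2pi; field. Qed.

Let shift1 s : theta1 tau (2 * z + s) * theta1 tau (z - s)
  = ('i * 'i) * (a ^+ 6 * b ^+ 3 * qinf q q ^+ 2
     * (twist_num (@qinf R) q y (e2pi s) * twist_den (@qinf R) q y 1 (e2pi s))).
Proof.
rewrite !theta1s !e2piD e2piN ymE.
by apply: theta_shift1; apply: eshift.
Qed.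

Let shift2 s : theta1 tau (2 * z + s) * theta2 tau (z - s)
  = - 'i * (a ^+ 6 * b ^+ 3 * qinf q q ^+ 2
     * (twist_num (@qinf R) q y (e2pi s) * twist_den (@qinf R) q y (-1) (e2pi s))).
Proof.
rewrite theta1s theta2s !e2piD e2piN ymE.
by apply: theta_shift2; apply: eshift.
Qed.

Let z7k k : e2pi (k%:R / 7%:R) = zeta7 R ^+ k.
Proof. by rewrite /zeta7 -e2pi_nat mulrA mulr1. Qed.
Let z7Nk k : e2pi (- (k%:R / 7%:R)) = (zeta7 R)^-1 ^+ k.
Proof. by rewrite e2piN z7k exprVn. Qed.

Let psi4_7 w : is_zeta7 w -> psi4 C7A tau z = - (limit C7A w + limit C7A w^-1).
Proof.
have z1 : is_zeta7 (zeta7 R) by left.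
suff h : psi4 C7A tau z = - (limit C7A (zeta7 R) + limit C7A (zeta7 R)^-1).
  by case=> ->; [exact: h | rewrite invrK [X in - X]addrC; exact: h].
have l7 := qinf_level7 q1 (expr1n _ 7) z1.
apply: (etrans _ (theta_7A i2 a0 b0 yb nP nE nD l7
  (t := fun k => theta1 tau (2 * z + k%:R / 7%:R) * theta1 tau (z - k%:R / 7%:R))
  (t' := fun k => theta1 tau (2 * z - k%:R / 7%:R) * theta1 tau (z + k%:R / 7%:R)) _ _)).
- by rewrite /psi4 !prod124 (etaK 6) eta1 (theta1K 6 7).
- by move=> k; rewrite shift1 z7k.
- by move=> k; rewrite -[X in theta1 tau (z + X)]opprK shift1 z7Nk.
Qed.

Let psi4_14 w : is_zeta7 w -> psi4 C14A tau z = - (limit C14A w + limit C14A w^-1).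
Proof.
have z1 : is_zeta7 (zeta7 R) by left.
suff h : psi4 C14A tau z = - (limit C14A (zeta7 R) + limit C14A (zeta7 R)^-1).
  by case=> ->; [exact: h | rewrite invrK [X in - X]addrC; exact: h].
have d7 : (-1) ^+ 7 = -1 :> C by rewrite -signr_odd.
have l7 := qinf_level7 q1 d7 z1.
apply: (etrans _ (theta_14A i2 a0 b0 yb nP nNE nND l7
  (t := fun k => theta1 tau (2 * z + k%:R / 7%:R) * theta2 tau (z - k%:R / 7%:R))
  (t' := fun k => theta1 tau (2 * z - k%:R / 7%:R) * theta2 tau (z + k%:R / 7%:R)) _ _)).
- by rewrite /psi4 !prod124 (etaK 6) eta1 (theta2K 6 7).
- by move=> k; rewrite shift2 z7k.
- by move=> k; rewrite -[X in theta2 tau (z + X)]opprK shift2 z7Nk.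
Qed.

(** In the classes that come in conjugate pairs the formula is symmetric in [w] and
[w^-1], so it is the same for both choices of [w]. *)
Lemma psi4_limit c w : is_zeta7 w -> psi4 c tau z = - (limit c w + limit c w^-1).
Proof.
move=> hw; case: c.
- rewrite /psi4 eta1 theta1m theta11; exact: theta_1A.
- rewrite /psi4 eta1 theta1m theta21; exact: theta_2A.
- rewrite /psi4 (etaK 1) eta1 theta1m theta2m (theta2K 1 2); exact: theta_4A.
- rewrite /psi4 eta1 (theta1K 2 6) (theta1K 2 3) theta11; exact: theta_3A.
- rewrite /psi4 eta1 (theta1K 2 6) (theta2K 2 3) theta21; exact: theta_6A.
- rewrite /psi4 eta1 (etaK 1) (etaK 3) theta1m (theta2K 1 4) (theta2K 3 4); exact: theta_8A.
- rewrite /psi4 eta1 (etaK 1) (etaK 3) theta1m (theta2K 1 4) (theta2K 3 4); exact: theta_8A.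
- exact: psi4_7.
- exact: psi4_7.
- exact: psi4_14.
- exact: psi4_14.
Qed.

End ClassLimits.

(** * The joint eigenbasis of the triple tensor product *)

Section Parity.
Variables (K : numFieldType) (s : bool) (A : polspace K s) (n : nat) (ap am : n.-tuple A).

Lemma fpar_pair (l l' : @letter K s A) : fpar false (fword false [:: l; l']).
Proof. by apply: lspan_ext; exists [:: l; l'] => //=; rewrite andbF. Qed.

Lemma fpar_subspace (b : bool) : subspace (@fpar false K s A b).
Proof. exact: lspan_subspace. Qed.

Lemma jmath_par : fpar false (jmath ap am).
Proof.
apply: subspace_sum => [|i _]; first exact: fpar_subspace.
exact: fpar_pair.
Qed.

Lemma omega_par : fpar false (omega ap am).
Proof.
have sP := fpar_subspace false.
have hs : fpar false (\sum_(i < n) (fword false [:: (tnth ap i, -2); (tnth am i, -1)]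
    - fword false [:: (tnth ap i, -1); (tnth am i, -2)])).
  apply: subspace_sum => // i _; rewrite -scaleN1r.
  have h1 := fpar_pair (tnth ap i, -2) (tnth am i, -1).
  have h2 := subspaceZ (-1) sP (fpar_pair (tnth ap i, -1) (tnth am i, -2)).
  exact: subspaceD sP h1 h2.
exact: subspaceZ sP hs.
Qed.

Lemma fvac_par : fpar false (fvac false A).
Proof. by apply: lspan_ext; exists [::] => //=; rewrite andbF. Qed.

Definition occ_charge (k : {poly nat}) : K :=
  - ((-1) ^+ s * n%:R / 2) + \sum_(i < size k) mode_charge K n i *+ (k`_i)%R.
Definition occ_energy (k : {poly nat}) : K :=
  - ((-1) ^+ s * n%:R / 8%:R) + \sum_(i < size k) (mode_level n i)%:R *+ (k`_i)%R.
Definition occ_eigen (lam : 'I_n -> K) (k : {poly nat}) : K :=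
  \prod_(i < size k) mode_eigen lam i ^+ (k`_i)%R.

Lemma mode_eigen_mul (lam mu : 'I_n -> K) i :
  mode_eigen (fun j => lam j * mu j) i = mode_eigen lam i * mode_eigen mu i.
Proof.
have nthM (e : seq 'I_n) (F G : 'I_n -> K) r :
    [seq F j * G j | j <- e]`_r = [seq F j | j <- e]`_r * [seq G j | j <- e]`_r.
  by elim: e r => [|j e IH] [|r] //=; rewrite ?mulr0.
rewrite /mode_eigen; case: ifP => _; last exact: nthM.
by rewrite -nthM; congr (_`_ _); apply: eq_map => j; rewrite invfM.
Qed.

Lemma occ_eigen_mul lam mu k :
  occ_eigen (fun j => lam j * mu j) k = occ_eigen lam k * occ_eigen mu k.
Proof.
rewrite /occ_eigen -big_split /=; apply: eq_bigr => i _.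
by rewrite mode_eigen_mul exprMn.
Qed.

Lemma tw_state_neg (n0 : (0 < n)%N) k :
  @fact true K s A -%R (tw_state ap am k) = occ_eigen (fun=> -1) k *: tw_state ap am k.
Proof.
have h := @tw_state_fact K s A n ap am n0 (GRing.opp : {linear A -> A}) (fun=> -1).
apply: h => [x y|x|j|j] /=.
- by rewrite linearNl linearNr opprK.
- by rewrite memvN.
- by rewrite scaleN1r.
- by rewrite invrN invr1 scaleN1r.
Qed.

End Parity.

Section TensorMapLinear.
Variables (K : fieldType) (V W V' W' : lmodType K) (f : V -> V') (g : W -> W').
Hypotheses (fl : linear f) (gl : linear g).

Lemma tmap_linear : linear (tmap f g).
Proof.
apply: (@tlift_linear _ _ _ _ (fun v w => f v ⊗ g w)) => [w|v] k x y.
  by rewrite fl; apply: tpure_linearl.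
by rewrite gl; apply: tpure_linearr.
Qed.

End TensorMapLinear.

Section W4Operators.
Variables (K : numClosedFieldType) (e a : polspace K true) (b : polspace K false).
Variables (ep em : 1.-tuple e) (ap am : 3.-tuple a) (bp bm : 4.-tuple b).
Hypotheses (hebases : dual_bases ep em) (habases : dual_bases ap am)
  (hbbases : dual_bases bp bm).
Variables (Ye : modes (fock false e) (fock false e)) (hYe : is_fock_sva Ye).
Variables (Ya : modes (fock false a) (fock false a)) (hYa : is_fock_sva Ya).
Variables (Yb : modes (fock false b) (fock false b)) (hYb : is_fock_sva Yb).
Variables (Yetw : modes (fock false e) (fock true e)) (hYetw : is_fock_twisted Ye Yetw).
Variables (Yatw : modes (fock false a) (fock true a)) (hYatw : is_fock_twisted Ya Yatw).
Variables (Ybtw : modes (fock false b) (fock true b)) (hYbtw : is_fock_twisted Yb Ybtw).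
Variables (Ytw : modes (W4 e a b) (W4tw e a b)) (hYtw : is_W4_twisted Yetw Yatw Ybtw Ytw).
Variables (up um : 3.-tuple a) (vp vm : 4.-tuple b).
Hypotheses (uduals : dual_bases up um) (vduals : dual_bases vp vm).
Local Notation I := ((({poly nat} * {poly nat}) * {poly nat})%type).

Definition w4_state : I -> W4tw e a b :=
  tens_state (tens_state (tw_state ep em) (tw_state up um)) (tw_state vp vm).

Definition w4_coord : I -> W4tw e a b -> K :=
  tens_coord (tens_coord (tw_coord ep em) (tw_coord up um)) (tw_coord vp vm).

Let n1 : (0 < 1)%N. Proof. by []. Qed.
Let n3 : (0 < 3)%N. Proof. by []. Qed.
Let n4 : (0 < 4)%N. Proof. by []. Qed.

Lemma w4_basis : coordinate_basis
  (fun p : I => (occ_valid true p.1.1 && occ_valid true p.1.2) && occ_valid false p.2)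
  w4_state w4_coord.
Proof.
exact: (tens_basis (tens_basis (tw_basis n1 hebases) (tw_basis n3 uduals))
  (tw_basis n4 vduals)).
Qed.

Lemma w4_modes (p : I) : [/\
  Ytw (jmath_e4 a b ep em) 0 (w4_state p) = occ_charge K true 1 p.1.1 *: w4_state p,
  Ytw (jmath4 e ap am bp bm) 0 (w4_state p)
    = (2 * occ_charge K true 3 p.1.2 + occ_charge K false 4 p.2) *: w4_state p
  & Ytw (omega4 ep em ap am bp bm) 1 (w4_state p)
    = (occ_energy K true 1 p.1.1 + occ_energy K true 3 p.1.2 + occ_energy K false 4 p.2)
      *: w4_state p].
Proof.
have [Yea [hEA hEAB]] := hYtw.
have [[_ _ _ _ [vace _]] _] := hYetw; have [[_ _ _ _ [vaca _]] _] := hYatw.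
have [[_ _ _ _ [vacb _]] _] := hYbtw.
have pvb := @fvac_par K false b; have pva := @fvac_par K true a.
have [pe hpe] := tw_state_par ep em p.1.1; have [pa hpa] := tw_state_par up um p.1.2.
set x := tw_state ep em p.1.1 in hpe *; set y := tw_state up um p.1.2 in hpa *.
pose z := tw_state vp vm p.2.
have hxy : tens_par (@fpar true K true e) (@fpar true K true a) (pe (+) pa) (x ⊗ y).
  by apply: lspan_ext; exists pe, pa, x, y.
have stE : w4_state p = x ⊗ y ⊗ z by [].
have Ealin r u : linear (Yea u r) by case: hEA => -[].
have vacEA r m : Yea (fvac false e ⊗ fvac false a) r m = if r == -1 then m else 0.
  have [_ _ bs] := tens_basis (tw_basis n1 hebases) (tw_basis n3 uduals).
  pose T := tens (fock true e) (fock true a).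
  have ifl : linear (fun m : T => ((if r == -1 then m else 0) : T)).
    by move=> k m1 m2; case: ifP => _ //; rewrite scaler0 addr0.
  have : lspan [set tens_state (tw_state ep em) (tw_state up um) i | i in
    [set i | occ_valid true i.1 && occ_valid true i.2]] m by rewrite bs.
  apply: (lspan_min (U := [set m | Yea (fvac false e ⊗ fvac false a) r m
      = if r == -1 then m else 0])); first exact: subspace_eq (Ealin _ _) ifl.
  move=> _ [i _ <-] /=; have [pi hpi] := tw_state_par ep em i.1.
  rewrite /tens_state (tens_modes_left hEA vaca pva _ _ _ hpi) vace.
  by case: ifP => _ //; rewrite (linear_fun0 (tpure_linearl _)).
have E r u : Ytw (u ⊗ fvac false a ⊗ fvac false b) r (w4_state p) = Yetw u r x ⊗ y ⊗ z.
  exact: (etrans (tens_modes_left hEAB vacb pvb (u ⊗ fvac false a) r z hxy)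
    (congr1 (fun t => t ⊗ z) (tens_modes_left hEA vaca pva u r y hpe))).
have A r u : fpar false u ->
    Ytw (fvac false e ⊗ u ⊗ fvac false b) r (w4_state p) = x ⊗ Yatw u r y ⊗ z.
  move=> pu; exact: (etrans (tens_modes_left hEAB vacb pvb (fvac false e ⊗ u) r z hxy)
    (congr1 (fun t => t ⊗ z) (tens_modes_right hEA vace r y pu hpe))).
have B r u : fpar false u ->
    Ytw (fvac false e ⊗ fvac false a ⊗ u) r (w4_state p) = x ⊗ y ⊗ Ybtw u r z.
  by move=> pu; exact: (tens_modes_right hEAB vacEA r z pu hxy).
have Yu r m : linear (fun u => Ytw u r m) by case: hEAB => -[].
have l1 k : (k *: x) ⊗ y ⊗ z = k *: w4_state p.
  exact: (etrans (congr1 (fun t => t ⊗ z) (linear_funZ k x (tpure_linearl y)))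
    (linear_funZ k (x ⊗ y) (tpure_linearl z))).
have l2 k : x ⊗ (k *: y) ⊗ z = k *: w4_state p.
  exact: (etrans (congr1 (fun t => t ⊗ z) (linear_funZ k y (tpure_linearr x)))
    (linear_funZ k (x ⊗ y) (tpure_linearl z))).
have l3 k : x ⊗ y ⊗ (k *: z) = k *: w4_state p.
  exact: (linear_funZ k z (tpure_linearr (x ⊗ y))).
have Ee r u c : Yetw u r x = c *: x ->
    Ytw (u ⊗ fvac false a ⊗ fvac false b) r (w4_state p) = c *: w4_state p.
  move=> h; exact: (etrans (E r u) (etrans (congr1 (fun t => t ⊗ y ⊗ z) h) (l1 c))).
have Ea r u c : fpar false u -> Yatw u r y = c *: y ->
    Ytw (fvac false e ⊗ u ⊗ fvac false b) r (w4_state p) = c *: w4_state p.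
  move=> pu h; exact: (etrans (A r u pu) (etrans (congr1 (fun t => x ⊗ t ⊗ z) h) (l2 c))).
have Eb r u c : fpar false u -> Ybtw u r z = c *: z ->
    Ytw (fvac false e ⊗ fvac false a ⊗ u) r (w4_state p) = c *: w4_state p.
  move=> pu h; exact: (etrans (B r u pu) (etrans (congr1 (fun t => x ⊗ y ⊗ t) h) (l3 c))).
have add r u v c d : Ytw u r (w4_state p) = c *: w4_state p ->
    Ytw v r (w4_state p) = d *: w4_state p ->
    Ytw (u + v) r (w4_state p) = (c + d) *: w4_state p.
  move=> hu hv; exact: (etrans (linear_funD u v (Yu r (w4_state p)))
    (etrans (congr2 +%R hu hv) (esym (scalerDl (w4_state p) c d)))).
have scl r u c k : Ytw u r (w4_state p) = c *: w4_state p ->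
    Ytw (k *: u) r (w4_state p) = (k * c) *: w4_state p.
  move=> hu; exact: (etrans (linear_funZ k u (Yu r (w4_state p)))
    (etrans (congr1 (fun t => k *: t) hu) (scalerA k c (w4_state p)))).
have je := Ee 0 _ _ (tw_state_charge hebases hYe hYetw hebases p.1.1).
have ja := Ea 0 _ _ (jmath_par ap am) (tw_state_charge uduals hYa hYatw habases p.1.2).
have jb := Eb 0 _ _ (jmath_par bp bm) (tw_state_charge vduals hYb hYbtw hbbases p.2).
have oe := Ee 1 _ _ (tw_state_energy hebases hYe hYetw hebases p.1.1).
have oa := Ea 1 _ _ (omega_par ap am) (tw_state_energy uduals hYa hYatw habases p.1.2).
have ob := Eb 1 _ _ (omega_par bp bm) (tw_state_energy vduals hYb hYbtw hbbases p.2).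
split; first exact: je.
- exact: (add 0 _ _ _ _ (scl 0 _ _ 2 ja) jb).
- exact: (add 1 _ _ _ _ (add 1 _ _ _ _ oe oa) ob).
Qed.

End W4Operators.

(** * Signs, group elements and weights on the eigenbasis *)

Section EigenOperators.

Lemma tmap_eigen (K : fieldType) (V W : lmodType K) (f : V -> V) (g : W -> W) v w c d :
  linear f -> linear g -> f v = c *: v -> g w = d *: w ->
  tmap f g (v ⊗ w) = (c * d) *: (v ⊗ w).
Proof.
move=> fl gl fv gw; rewrite tmap_pure // fv gw.
by rewrite (linear_funZ _ _ (tpure_linearl _)) (linear_funZ _ _ (tpure_linearr _)) scalerA.
Qed.

Lemma twining_eigen (K : fieldType) (V : lmodType K) (S J A A' : V -> V) v s j x x' :
  linear J -> linear A -> linear A' -> S v = s *: v -> J v = j *: v ->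
  A v = x *: v -> A' v = x' *: v -> A (J (S v)) + A' (J (S v)) = (s * j * (x + x')) *: v.
Proof.
move=> Jl Al A'l Sv Jv Av A'v.
rewrite Sv (linear_funZ _ _ Jl) Jv (linear_funZ _ _ Al) (linear_funZ _ _ A'l).
rewrite (linear_funZ _ _ Al) (linear_funZ _ _ A'l) Av A'v !scalerA -scalerDl.
by rewrite mulrDr.
Qed.

Lemma id_linear (K : fieldType) (V : lmodType K) : linear (@id V).
Proof. by []. Qed.

Variables (K : numClosedFieldType) (e a : polspace K true) (b : polspace K false).

Lemma neg_fact_linear tw s (A : polspace K s) : linear (@fact tw K s A -%R).
Proof.
apply: (fact_linear (g := (-%R : {linear A -> A}))) => [x y|x] /=.
  by rewrite linearNl linearNr opprK.
by rewrite memvN.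
Qed.

Lemma rep_fact_linear (gT : finGroupType) (H : {group gT}) s (A : polspace K s)
    (rho : polrep H A) g : g \in H -> linear (@fact true K s A (rep_full rho g)).
Proof.
move=> gH; apply: (fact_linear (g := (rep_full rho g : {linear A -> A}))) => [x y|x] /=.
  exact: rep_full_isometry.
exact: rep_full_pplus.
Qed.

Variables (ep em : 1.-tuple e) (up um : 3.-tuple a) (vp vm : 4.-tuple b).
Local Notation I := ((({poly nat} * {poly nat}) * {poly nat})%type).
Local Notation state := (w4_state ep em up um vp vm).

Lemma sgnF_state (p : I) : sgnF (state p)
  = (occ_eigen (fun _ : 'I_1 => -1) p.1.1 * occ_eigen (fun _ : 'I_3 => -1) p.1.2 * 1)
    *: state p.
Proof.
have le := @neg_fact_linear true true e; have la := @neg_fact_linear true true a.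
have n1 : (0 < 1)%N by []. have n3 : (0 < 3)%N by [].
have he := tw_state_neg ep em n1 p.1.1; have ha := tw_state_neg up um n3 p.1.2.
exact: (tmap_eigen (tmap_linear le la) (@id_linear _ _) (tmap_eigen le la he ha)
  (esym (scale1r (tw_state vp vm p.2)))).
Qed.

Lemma rep_act_linear (gT : finGroupType) (H : {group gT}) (rho_a : polrep H a)
    (rho_b : polrep H b) g : g \in H -> linear (@rep_act K e a b gT H rho_a rho_b g).
Proof.
move=> gH; apply: tmap_linear; last exact: rep_fact_linear.
by apply: tmap_linear; [exact: id_linear | exact: rep_fact_linear].
Qed.

Lemma rep_act_state (gT : finGroupType) (H : {group gT}) (rho_a : polrep H a)
    (rho_b : polrep H b) g (lam : 'I_3 -> K) (mu : 'I_4 -> K) (p : I) : g \in H ->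
  (forall j, rep_full rho_a g (tnth up j) = lam j *: tnth up j) ->
  (forall j, rep_full rho_a g (tnth um j) = (lam j)^-1 *: tnth um j) ->
  (forall j, rep_full rho_b g (tnth vp j) = mu j *: tnth vp j) ->
  (forall j, rep_full rho_b g (tnth vm j) = (mu j)^-1 *: tnth vm j) ->
  rep_act rho_a rho_b g (state p)
  = (1 * occ_eigen lam p.1.2 * occ_eigen mu p.2) *: state p.
Proof.
move=> gH hup hum hvp hvm.
have la := rep_fact_linear rho_a gH; have lb := rep_fact_linear rho_b gH.
have n3 : (0 < 3)%N by []. have n4 : (0 < 4)%N by [].
have ha := @tw_state_fact K true a 3 up um n3 (rep_full rho_a g : {linear a -> a}) lam
  (rep_full_isometry rho_a gH) (fun x => @rep_full_pplus _ _ _ _ _ rho_a g gH x) hup hum p.1.2.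
have hb := @tw_state_fact K false b 4 vp vm n4 (rep_full rho_b g : {linear b -> b}) mu
  (rep_full_isometry rho_b gH) (fun x => @rep_full_pplus _ _ _ _ _ rho_b g gH x) hvp hvm p.2.
have idl := @id_linear K (fock true e).
exact: (tmap_eigen (tmap_linear idl la) lb
  (tmap_eigen idl la (esym (scale1r (tw_state ep em p.1.1))) ha) hb).
Qed.

End EigenOperators.

Section W4Weights.
Variable R : realType.
Local Notation C := R[i].
Local Notation I := ((({poly nat} * {poly nat}) * {poly nat})%type).

Definition w4_charge (p : I) : C := 2 * occ_charge C true 3 p.1.2 + occ_charge C false 4 p.2.
Definition w4_energy (p : I) : C :=
  occ_energy C true 1 p.1.1 + occ_energy C true 3 p.1.2 + occ_energy C false 4 p.2.
Definition w4_sign (p : I) : C :=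
  occ_eigen (fun _ : 'I_1 => -1) p.1.1 * occ_eigen (fun _ : 'I_3 => -1) p.1.2 * 1.
Definition w4_eigen (lam : 'I_3 -> C) (mu : 'I_4 -> C) (p : I) : C :=
  1 * occ_eigen lam p.1.2 * occ_eigen mu p.2.

(** The vacuum charge is [2 * (3 / 2) - 2 = 1], whence the factor [y] of [w4_term];
the vacuum energy is [1 / 8 + 3 / 8 - 4 / 8 = 0]. *)
Lemma w4_termE (lam : 'I_3 -> C) (mu : 'I_4 -> C) (tau z c0 : C) (c : nat -> C) (p : I) :
  w4_term lam mu (e2pi z) (e2pi tau) c0 c p
  = w4_sign p * (c0 + \sum_(i < size p.1.1) c i *+ (p.1.1`_i)%R) * w4_eigen lam mu p
    * e2pi (w4_charge p * z) * e2pi (w4_energy p * tau).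
Proof.
rewrite /w4_term -e2pi_nat -{2}[1]e2pi0 !occ_weight_mode mulr0 e2pi0 mulr1.
rewrite /w4_sign /w4_eigen /w4_charge /w4_energy /occ_charge /occ_energy.
have -> : \prod_(i < size p.1.2) mode_eigen (fun j => - lam j) i ^+ (p.1.2`_i)%R
    = occ_eigen (fun _ : 'I_3 => -1) p.1.2 * occ_eigen lam p.1.2.
  rewrite -occ_eigen_mul; apply: eq_bigr => i _; congr (mode_eigen _ _ ^+ _).
  by apply/funext => j; rewrite mulN1r.
rewrite -!/(occ_eigen _ _) !expr1 expr0.
set qa := \sum_(i < size p.1.2) mode_charge C 3 i *+ _.
set qb := \sum_(i < size p.2) mode_charge C 4 i *+ _.
set la := \sum_(i < size p.1.2) _; set lb := \sum_(i < size p.2) _.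
set le := \sum_(i < size p.1.1) (mode_level 1 i)%:R *+ _.
have -> : e2pi ((2 * (- (-1 * 3%:R / 2) + qa) + (- (1 * 4%:R / 2) + qb)) * z)
    = e2pi z * e2pi (qa * (2 * z)) * e2pi (qb * z).
  by rewrite -!e2piD; congr e2pi; field.
have -> : e2pi ((- (-1 * 1%:R / 8%:R) + le + (- (-1 * 3%:R / 8%:R) + la)
      + (- (1 * 4%:R / 8%:R) + lb)) * tau)
    = e2pi (le * tau) * e2pi (la * tau) * e2pi (lb * tau).
  by rewrite -!e2piD; congr e2pi; field.
ring.
Qed.

Lemma occ_eigen_modulus n (lam : 'I_n -> C) (k : {poly nat}) : (0 < n)%N ->
  (forall j, modulus (lam j) = 1) -> modulus (occ_eigen lam k) = 1.
Proof.
move=> n0 lam1; have w1 i : modulus (mode_eigen lam i) = 1 by exact: mode_eigen_modulus.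
rewrite /occ_eigen modulus_prod big1 // => i _.
by rewrite modulusX w1 expr1n.
Qed.

Lemma domain_moduli (tau z : C) : 0 < - complex.Im z -> - complex.Im z < complex.Im tau ->
  [/\ modulus (e2pi tau) < 1, modulus (e2pi z)^-1 < 1 & modulus (e2pi z * e2pi tau) < 1].
Proof.
move=> z0 zt; split; first by apply: modulus_lt1; apply: lt_trans zt.
  by rewrite -e2piN; apply: modulus_lt1; rewrite raddfN.
by rewrite -e2piD; apply: modulus_lt1; rewrite raddfD /= -[complex.Im z]opprK addrC subr_gt0.
Qed.

(** At one point of the domain, with all eigenvalues and the insertion equal to 1,
the terms are absolutely summable and their moduli depend on the weights only. *)
Lemma w4_fibers_finite m n : finite_set (weight_fiber w4_valid w4_charge w4_energy m n).
Proof.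
pose tau : C := (0 +i* 2)%C; pose z : C := (0 +i* (-1))%C.
have [q1 y1 yq1] : [/\ modulus (e2pi tau) < 1, modulus (e2pi z)^-1 < 1
    & modulus (e2pi z * e2pi tau) < 1].
  by apply: domain_moduli; rewrite /= opprK ?ltr01 // ltr1n.
pose l1 (j : 'I_3) : C := 1; pose m1 (j : 'I_4) : C := 1.
have l11 j : modulus (l1 j) = 1 by exact: modulus1.
have m11 j : modulus (m1 j) = 1 by exact: modulus1.
have h1 : modulus (1 : C) <= 1 by rewrite modulus1.
have h0 (i : nat) : modulus (0 : C) <= 1 by rewrite modulus0.
have [B hB] := w4_sum_bound l11 m11 q1 y1 yq1 h1 h0.
have FE p : modulus (w4_term l1 m1 (e2pi z) (e2pi tau) 1 (fun=> 0) p)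
    = modulus (e2pi (w4_charge p * z)) * modulus (e2pi (w4_energy p * tau)).
  rewrite w4_termE 4!modulusM big1 => [|i _]; last by rewrite mul0rn.
  rewrite addr0 modulus1 mulr1 /w4_sign /w4_eigen !modulusM !occ_eigen_modulus //.
  - by rewrite modulus1 !mul1r.
  - by rewrite modulusN modulus1.
  - by rewrite modulusN modulus1.
apply: sub_finite_set (fiber_finite w4_box_mono w4_box_exh hB
  (w := fun p => (w4_charge p, w4_energy p)) (m, n) _ _).
- by move=> p [Pp <- <-].
- by move=> p _; rewrite -modulus_eq0 FE mulf_neq0 // modulus_eq0 e2pi_neq0.
- by move=> p p' []; rewrite !FE => -> ->.
Qed.

End W4Weights.

(** * Convergence to the umbral Jacobi forms *)

Theorem proposition4p3 (R : realType)
  (Q : 'M[int]_24) (G4 : finGroupType) (proj : 'M[int]_24 -> G4)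
  (G336 : {group G4}) (cl : G4 -> cls336)
  (hN : even_unimodular Q) (hA3 : root_system_A3_8 Q)
  (hG4 : is_umbral_group Q proj)
  (hG336 : G336 \isog SL2_7) (hcl : class_names G336 cl)
  (e a : polspace R[i] true) (b : polspace R[i] false)
  (he : \dim {:e} = 2%N) (ha : \dim {:a} = 6%N) (hb : \dim {:b} = 8%N)
  (ep em : 1.-tuple e) (ap am : 3.-tuple a) (bp bm : 4.-tuple b)
  (hebases : dual_bases ep em) (habases : dual_bases ap am)
  (hbbases : dual_bases bp bm)
  (rho_a : polrep G336 a) (rho_b : polrep G336 b)
  (hrho_a : {in G336, forall g, lftrace (rho_a g) = chi2 R (cl g)})
  (hrho_b : {in G336, forall g, lftrace (rho_b g) = chi8 R (cl g)})
  (Ye : modes (fock false e) (fock false e)) (hYe : is_fock_sva Ye)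
  (Ya : modes (fock false a) (fock false a)) (hYa : is_fock_sva Ya)
  (Yb : modes (fock false b) (fock false b)) (hYb : is_fock_sva Yb)
  (Yetw : modes (fock false e) (fock true e)) (hYetw : is_fock_twisted Ye Yetw)
  (Yatw : modes (fock false a) (fock true a)) (hYatw : is_fock_twisted Ya Yatw)
  (Ybtw : modes (fock false b) (fock true b)) (hYbtw : is_fock_twisted Yb Ybtw)
  (Ytw : modes (W4 e a b) (W4tw e a b)) (hYtw : is_W4_twisted Yetw Yatw Ybtw Ytw) :
  let Je0 := Ytw (jmath_e4 a b ep em) 0 in
  let J0 := Ytw (jmath4 e ap am bp bm) 0 in
  let L0 := Ytw (omega4 ep em ap am bp bm) 1 in
  forall g, g \in G336 ->
    let T := fun w : W4tw e a b =>
      rep_act rho_a rho_b g (Je0 (sgnF w)) + rep_act rho_a rho_b g^-1%g (Je0 (sgnF w)) in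
    exists c : R[i] -> R[i] -> R[i],
      is_graded_trace J0 L0 T c /\
      forall tau z : R[i],
        0 < - complex.Im z -> - complex.Im z < complex.Im tau ->
        series_converges (fun m n => - c m n) tau z (psi4 (cl g) tau z).
Proof.
move=> Je0 J0 L0 g gH T; have gVH : g^-1%g \in G336 by rewrite groupV.
have [lam [up [um [ud gup gum trA lamN]]]] := rep_eigenbasis rho_a gH habases.
have [mu [vp [vm [vd gvp gvm trB muN]]]] := rep_eigenbasis rho_b gH hbbases.
have lam1 j : modulus (lam j) = 1 by apply: root_of_unity_modulus (order_gt0 g) (lamN j).
have mu1 j : modulus (mu j) = 1 by apply: root_of_unity_modulus (order_gt0 g) (muN j).
have lamV1 j : modulus (lam j)^-1 = 1 by rewrite modulusV lam1 invr1.
have muV1 j : modulus (mu j)^-1 = 1 by rewrite modulusV mu1 invr1.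
have lam0 j : lam j != 0 by rewrite -modulus_eq0 lam1 oner_eq0.
have mu0 j : mu j != 0 by rewrite -modulus_eq0 mu1 oner_eq0.
have hl k : \sum_j lam j ^+ k = chi2 R (cl (g ^+ k)%g) by rewrite -trA hrho_a ?groupX.
have hm k : \sum_j mu j ^+ k = chi8 R (cl (g ^+ k)%g) by rewrite -trB hrho_b ?groupX.
have [w hw hf] := class_factors hcl.2 gH lam1 mu1 hl hm.
(* The eigenvectors of [g] serve [g^-1] too, with the inverse eigenvalues. *)
have up_plus j : tnth up j \in pplus a by case: ud => h _ _ _; apply: (basis_mem h); apply: mem_tnth.
have vp_plus j : tnth vp j \in pplus b by case: vd => h _ _ _; apply: (basis_mem h); apply: mem_tnth.
have gVup j : rep_full rho_a g^-1%g (tnth up j) = (lam j)^-1 *: tnth up j.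
  exact: (rep_full_inv gH (up_plus j) (lam0 j) (gup j)).
have gVvp j : rep_full rho_b g^-1%g (tnth vp j) = (mu j)^-1 *: tnth vp j.
  exact: (rep_full_inv gH (vp_plus j) (mu0 j) (gvp j)).
have lamV0 j : (lam j)^-1 != 0 by rewrite invr_eq0.
have muV0 j : (mu j)^-1 != 0 by rewrite invr_eq0.
have gVum := rep_eigen_minus gVH ud lamV0 gVup.
have gVvm := rep_eigen_minus gVH vd muV0 gVvp.
pose lamV j := (lam j)^-1; pose muV j := (mu j)^-1.
pose t p := w4_sign R p * occ_charge R[i] true 1 p.1.1
  * (w4_eigen lam mu p + w4_eigen lamV muV p).
have Ylin u r : linear (Ytw u r) by case: hYtw => Y' [_ [[_ h] _]].
have modesE := w4_modes hebases habases hbbases hYe hYa hYb hYetw hYatw hYbtw hYtw ud vd.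
have basis := w4_basis hebases ud vd.
exists (weight_trace w4_valid (@w4_charge R) (@w4_energy R) t); split.
  apply: (diagonal_graded_trace basis (Ylin _ _) (Ylin _ _)).
  - by move=> p _; have [_ h _] := modesE p; exact: h.
  - by move=> p _; have [_ _ h] := modesE p; exact: h.
  - move=> p _; have [h _ _] := modesE p.
    exact: (twining_eigen (Ylin _ _) (rep_act_linear rho_a rho_b gH)
      (rep_act_linear rho_a rho_b gVH) (sgnF_state ep em up um vp vm p) h
      (rep_act_state ep em p gH gup gum gvp gvm)
      (rep_act_state ep em p gVH gVup gVum gVvp gVvm)).
  - exact: w4_fibers_finite.
move=> tau z z0 zt; have [q1 y1 yq1] := domain_moduli z0 zt.
rewrite (psi4_limit q1 y1 yq1 _ hw).
rewrite -(w4_limit_class (e2pi z) q1 hf).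
have hfV X : [/\ \prod_j (1 - lamV j * X) = factor_prod (chi2_factors (cl g) w^-1) X,
    \prod_j (1 - muV j * X) = factor_prod (chi8_factors (cl g) w^-1) X,
    \prod_j (1 - (lamV j)^-1 * X) = factor_prod (chi2_factors (cl g) w^-1^-1) X
  & \prod_j (1 - (muV j)^-1 * X) = factor_prod (chi8_factors (cl g) w^-1^-1) X].
  have [h1 h2 h3 h4] := hf X; rewrite !invrK -h1 -h2.
  by split=> //; apply: eq_bigr => j _; rewrite invrK.
rewrite -(w4_limit_class (e2pi z) q1 hfV).
have hc0 : modulus (1 / 2 : R[i]) <= 1.
  by rewrite mul1r modulusV modulus_nat invf_le1 ?ltr0n // ler1n.
have hc i : modulus (mode_charge R[i] 1 i) <= 1.
  by rewrite /mode_charge; case: ifP => _; rewrite ?modulusN modulus1.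
have [B hB] := w4_sum_bound lam1 mu1 q1 y1 yq1 hc0 hc.
have [B' hB'] := w4_sum_bound lamV1 muV1 q1 y1 yq1 hc0 hc.
have S1 := @w4_sum_limit R lam mu _ _ mu1 q1 y1 yq1.
have S2 := @w4_sum_limit R lamV muV _ _ muV1 q1 y1 yq1.
have S := slimD S1 S2.
apply: (series_converges_regroup w4_box_valid w4_box_mono w4_box_exh
  (F := fun p => w4_term lam mu (e2pi z) (e2pi tau) (1 / 2) (mode_charge R[i] 1) p
    + w4_term lamV muV (e2pi z) (e2pi tau) (1 / 2) (mode_charge R[i] 1) p) (B := B + B')).
- move=> N; apply: le_trans (lerD (hB N) (hB' N)); rewrite -big_split /=.
  by apply: ler_sum => p _; exact: modulusD.
- by apply: slim_ext S => N; rewrite -big_split.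
- move=> p _; have oc : 1 / 2 + \sum_(i < size p.1.1) mode_charge R[i] 1 i *+ (p.1.1`_i)%R
      = occ_charge R[i] true 1 p.1.1 by rewrite /occ_charge expr1 mulN1r mulNr opprK.
  have e1 := w4_termE lam mu tau z (1 / 2) (mode_charge R[i] 1) p.
  have e2 := w4_termE lamV muV tau z (1 / 2) (mode_charge R[i] 1) p.
  apply: (etrans (congr2 +%R e1 e2)); rewrite /t oc.
  move: (w4_sign R p) (occ_charge _ _ _ _) (w4_eigen lam mu p) (w4_eigen lamV muV p).
  by move: (e2pi _) (e2pi _) => *; ring.
- exact: w4_fibers_finite.
Qed.
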